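(* Let $k=2\kappa+1$ with $\kappa\in\{0,1,2,\dots\}$, let $T>0$, and let $u\in C([0,T];C_p^{k+2})$ be the unique solution of the periodic regularized long wave problem $$u_t+u_x+uu_x-u_{xxt}=0\ \ (x\in(0,1),\ t>0),\qquad \partial_x^iu(0,t)=\partial_x^iu(1,t)\ (i\ge0),\qquad u(x,0)=U_0(x).$$ Then, for $h=1/N$ sufficiently small, there exists a unique solution $\tilde u(\cdot,t)\in\mathcal{V}_h^k$, $t\in[0,T]$, of the semi-discrete problem $$(\tilde u_t,\chi)+(P[\tilde u_{xt}],\chi_x)=(P[\tilde u+\tfrac12\tilde u^2],\chi_x)\quad\text{for all }\chi\in\mathcal{V}_h^k,\qquad \tilde u(\cdot,0)=PU_0,$$ and there exists a constant $C>0$ independent of $h$ such that for all $t\in[0,T]$ $$\|u-\tilde u\|\le Ch^{k+1},\qquad \|u_x-P[\tilde u_x]\|\le Ch^{k+1},\qquad \|u_x-\tilde u_x\|\le Ch^{k}.$$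
   Context: $C_p$ is the space of continuous $1$-periodic real functions and $C_p^m$ the set of $f\in C_p$ with $f^{(j)}\in C_p$ for $j=1,\dots,m$. For $N\ge1$, $h=1/N$, $x_i=ih$, and $\mathcal{V}_h^k=\{\phi\in C_p:\ \phi|_{[x_{i-1},x_i]}\text{ is a polynomial of degree}\le k,\ i=1,\dots,N\}$. $(\cdot,\cdot)$ and $\|\cdot\|$ are the inner product and norm of $L^2(0,1)$, and $P$ is the $L^2(0,1)$-orthogonal projection onto $\mathcal{V}_h^k$. Subscripts denote (piecewise) partial derivatives. *)

(* Defs.v *)
From Stdlib Require Import Reals ClassicalEpsilon.
From Coquelicot Require Import Coquelicot.
Open Scope R_scope.

Definition Cp (f : R -> R) : Prop :=
  (forall x, continuous f x) /\ (forall x, f (x + 1) = f x).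

Definition Cpm (m : nat) (f : R -> R) : Prop :=
  forall j : nat, (j <= m)%nat ->
    ((j < m)%nat -> forall x, ex_derive (Derive_n f j) x) /\ Cp (Derive_n f j).

Definition poly_on (k : nat) (a b : R) (f : R -> R) : Prop :=
  exists c : nat -> R, forall x, a <= x <= b ->
    f x = sum_f_R0 (fun j => c j * x ^ j) k.

Definition Vh (N k : nat) (phi : R -> R) : Prop :=
  Cp phi /\
  forall i : nat, (i < N)%nat -> poly_on k (INR i / INR N) (INR (i + 1) / INR N) phi.

Definition ip (f g : R -> R) : R := RInt (fun x => f x * g x) 0 1.
Definition L2norm (f : R -> R) : R := sqrt (ip f f).

(** L^2(0,1)-orthogonal projection onto V_h^k (the unique phi in V_h^k with
    f - phi orthogonal to V_h^k; chosen by Hilbert's epsilon). *)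
Definition Proj (N k : nat) (f : R -> R) : R -> R :=
  epsilon (inhabits (fun _ : R => 0))
    (fun phi => Vh N k phi /\
       forall chi, Vh N k chi -> ip (fun x => f x - phi x) chi = 0).

(** (Piecewise) x-derivative: Coquelicot's total [Derive]; off the nodes it is
    the classical derivative (and at nodes it is irrelevant in integrals). *)
Definition dx (f : R -> R) : R -> R := fun x => Derive f x.

Definition RLW_solution (k : nat) (T : R) (U0 : R -> R) (u : R -> R -> R) : Prop :=
  (forall t, 0 <= t <= T -> Cpm (k + 2) (u t)) /\
  (forall j : nat, (j <= k + 2)%nat ->
     forall t, 0 <= t <= T -> forall eps, 0 < eps ->
       exists delta, 0 < delta /\
         forall s, 0 <= s <= T -> Rabs (s - t) < delta ->
           forall x, Rabs (Derive_n (u s) j x - Derive_n (u t) j x) < eps) /\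
  (forall t x, 0 < t < T -> 0 < x < 1 ->
     ex_derive (fun s => u s x) t /\
     ex_derive (fun s => Derive_n (u s) 2 x) t /\
     Derive (fun s => u s x) t + Derive (u t) x + u t x * Derive (u t) x
       - Derive (fun s => Derive_n (u s) 2 x) t = 0) /\
  (forall x, u 0 x = U0 x).

Definition semidiscrete_solution (N k : nat) (T : R) (U0 : R -> R)
    (ut : R -> R -> R) : Prop :=
  (forall t, 0 <= t <= T -> Vh N k (ut t)) /\
  (forall x t, 0 <= t <= T ->
     filterlim (fun s => ut s x) (within (fun s => 0 <= s <= T) (locally t))
       (locally (ut t x))) /\
  (forall t x, 0 < t < T ->
     ex_derive (fun s => ut s x) t /\ ex_derive (fun s => dx (ut s) x) t) /\
  (forall t, 0 < t < T -> forall chi, Vh N k chi ->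
     ip (fun x => Derive (fun s => ut s x) t) chi
     + ip (Proj N k (fun x => Derive (fun s => dx (ut s) x) t)) (dx chi)
     = ip (Proj N k (fun x => ut t x + / 2 * (ut t x) ^ 2)) (dx chi)) /\
  (forall x, ut 0 x = Proj N k U0 x).

(* Main.v *)
(** On [Vh] put G chi := P chi_x. The scheme is an ordinary differential equation for the energy product (f, g) + (G f, G g): its right-hand side (flux ut, G chi) is Lipschitz once the flux is truncated, so a solution exists. The order k+1 rests on a superconvergence of P special to odd k on a uniform mesh: up to O(h^(k+2)), the error of a suitable interpolant of v is on each element a multiple of the Legendre polynomial of degree k+1, which is orthogonal to [Vh] and to its derivatives; with an inverse inequality, |(v - P v, chi_x)| <= C h^(k+1) |chi|. A Gronwall estimate in the energy norm then compares ut with P u, and a final inverse inequality shows that, for small h, ut stays below the truncation level. *)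

Require Import Defs.
From Stdlib Require Import Reals Arith ZArith Lra Lia.
From Stdlib Require Import FunctionalExtensionality ClassicalEpsilon.
From Coquelicot Require Import Coquelicot.
Open Scope R_scope.

(** * Finite sums, piecewise continuous functions and the L2 norm *)

(** The obstacle is regularity in time. [RLW_solution] gives u_t and u_xxt only pointwise, and only
    the combination u_t - u_xxt is identified by the equation, as -(flux u)_x. Hence P u is never
    differentiated in t. Instead the weak form of u(t) - u(0) is lifted to [Vh] by the Riesz map of
    the energy product: the lift y has coordinates whose derivatives are (flux u, chi_x), so ut(t) -
    ut(0) - y(t) obeys a differential inequality, while z = y - (P u(t) - P u(0)) is shown to be
    small at each fixed time and enters only as data. A semi-discrete solution is likewise regular
    in t only at each fixed x. The orthonormal bases are therefore built so that every coordinate is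
    a finite combination of point values; continuity and differentiability in t pass to the
    coordinates, and the scheme becomes an explicit system of ordinary differential equations. The
    error estimate is proved for the truncated flow, where it needs no bound on ut; such a bound is
    a consequence of it. *)

Fixpoint Sum (f : nat -> R) (n : nat) : R :=
  match n with O => 0 | S m => Sum f m + f m end.

Lemma Sum_ext f g n : (forall j, (j < n)%nat -> f j = g j) -> Sum f n = Sum g n.
Proof.
induction n; simpl; intros H; auto.
rewrite IHn; [rewrite H; auto|intros; apply H; lia].
Qed.

Lemma Sum_plus f g n : Sum (fun j => f j + g j) n = Sum f n + Sum g n.
Proof. induction n; simpl; lra. Qed.

Lemma Sum_scal c f n : Sum (fun j => c * f j) n = c * Sum f n.
Proof. induction n; simpl; [lra|rewrite IHn; lra]. Qed.

Lemma Sum_minus f g n : Sum (fun j => f j - g j) n = Sum f n - Sum g n.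
Proof. induction n; simpl; lra. Qed.

Lemma Sum_const c n : Sum (fun _ => c) n = INR n * c.
Proof. induction n; [simpl; lra|]. rewrite S_INR; simpl; lra. Qed.

Lemma Sum_le f g n : (forall j, (j < n)%nat -> f j <= g j) -> Sum f n <= Sum g n.
Proof.
induction n; simpl; intros H; [lra|].
assert (f n <= g n) by (apply H; lia).
assert (Sum f n <= Sum g n) by (apply IHn; intros; apply H; lia). lra.
Qed.

Lemma Sum_nonneg f n : (forall j, (j < n)%nat -> 0 <= f j) -> 0 <= Sum f n.
Proof.
intros H. replace 0 with (Sum (fun _ => 0) n).
now apply Sum_le. rewrite Sum_const; ring.
Qed.

Lemma Sum_term_le f n i : (forall j, (j < n)%nat -> 0 <= f j) -> (i < n)%nat -> f i <= Sum f n.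
Proof.
induction n; intros H Hi; [lia|simpl].
destruct (Nat.eq_dec i n) as [->|].
- assert (0 <= Sum f n) by (apply Sum_nonneg; intros; apply H; lia). lra.
- assert (f i <= Sum f n) by (apply IHn; [intros; apply H|]; lia).
  assert (0 <= f n) by (apply H; lia). lra.
Qed.

Lemma Sum_delta c i n : (i < n)%nat -> Sum (fun j => c j * (if Nat.eq_dec j i then 1 else 0)) n = c i.
Proof.
induction n; intros H; [lia|simpl].
destruct (Nat.eq_dec n i) as [->|Hne].
- rewrite (Sum_ext _ (fun _ => 0)).
  + rewrite Sum_const; ring.
  + intros j Hj. destruct (Nat.eq_dec j i); [lia|ring].
- rewrite IHn by lia. ring.
Qed.

Lemma sum_f_R0_Sum f k : sum_f_R0 f k = Sum f (S k).
Proof. induction k; simpl in *; [ring|rewrite IHk; reflexivity]. Qed.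

Lemma RInt_plusR (f g : R -> R) a b : ex_RInt f a b -> ex_RInt g a b ->
  RInt (fun x => f x + g x) a b = RInt f a b + RInt g a b.
Proof. intros; apply (RInt_plus f g); auto. Qed.

Lemma RInt_minusR (f g : R -> R) a b : ex_RInt f a b -> ex_RInt g a b ->
  RInt (fun x => f x - g x) a b = RInt f a b - RInt g a b.
Proof. intros; apply (RInt_minus f g); auto. Qed.

Lemma RInt_scalR (f : R -> R) c a b : ex_RInt f a b ->
  RInt (fun x => c * f x) a b = c * RInt f a b.
Proof. intros; apply (RInt_scal f); auto. Qed.

Lemma RInt_ChaslesR (f : R -> R) a b c : ex_RInt f a b -> ex_RInt f b c ->
  RInt f a b + RInt f b c = RInt f a c.
Proof. intros; apply (RInt_Chasles f); auto. Qed.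

Lemma ex_RInt_cont (f : R -> R) a b : (forall x, continuous f x) -> ex_RInt f a b.
Proof. intros H; apply (@ex_RInt_continuous R_CompleteNormedModule); auto. Qed.

Lemma cont_plus (f g : R -> R) x : continuous f x -> continuous g x -> continuous (fun x => f x + g x) x.
Proof. intros; apply (continuous_plus f g); auto. Qed.
Lemma cont_minus (f g : R -> R) x : continuous f x -> continuous g x -> continuous (fun x => f x - g x) x.
Proof. intros; apply (continuous_minus f g); auto. Qed.
Lemma cont_mult (f g : R -> R) x : continuous f x -> continuous g x -> continuous (fun x => f x * g x) x.
Proof. intros; apply (continuous_mult f g); auto. Qed.
Lemma cont_scal c (f : R -> R) x : continuous f x -> continuous (fun x => c * f x) x.
Proof. intros; apply cont_mult; auto. apply continuous_const. Qed.

Lemma ex_derive_cont (f : R -> R) x : ex_derive f x -> continuous f x.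
Proof. apply (@ex_derive_continuous R_AbsRing R_NormedModule). Qed.

Lemma is_derive_cont (f : R -> R) x l : is_derive f x l -> continuous f x.
Proof. intros; apply ex_derive_cont; eexists; eauto. Qed.

Lemma is_derive_plusR (f g : R -> R) x a b : is_derive f x a -> is_derive g x b ->
  is_derive (fun y => f y + g y) x (a + b).
Proof. apply (@is_derive_plus R_AbsRing R_NormedModule). Qed.
Lemma is_derive_minusR (f g : R -> R) x a b : is_derive f x a -> is_derive g x b ->
  is_derive (fun y => f y - g y) x (a - b).
Proof. apply (@is_derive_minus R_AbsRing R_NormedModule). Qed.
Lemma is_derive_multR (f g : R -> R) x a b : is_derive f x a -> is_derive g x b ->
  is_derive (fun y => f y * g y) x (a * g x + f x * b).
Proof. intros Hf Hg. apply (@is_derive_mult R_AbsRing f g x a b Hf Hg). intros; apply Rmult_comm. Qed.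

Lemma locally_between a b x : a < x < b -> locally x (fun y => a < y /\ y < b).
Proof. intros H. apply filter_and; [apply (open_gt a)|apply (open_lt b)]; lra. Qed.

Lemma RInt_ge_0R (f : R -> R) a b : a <= b -> ex_RInt f a b ->
  (forall x, a < x < b -> 0 <= f x) -> 0 <= RInt f a b.
Proof. intros; apply RInt_ge_0; auto. Qed.

Lemma ex_RInt_sub (f : R -> R) a b c d : a <= c -> c <= d -> d <= b ->
  ex_RInt f a b -> ex_RInt f c d.
Proof.
intros. apply (@ex_RInt_Chasles_1 R_CompleteNormedModule f c d b); [lra|].
apply (@ex_RInt_Chasles_2 R_CompleteNormedModule f a c b); auto. lra.
Qed.

(** A positive value persists on an interval inside [[a, b]], over which the integral is then
    positive. Definiteness of [ip] on [Vh] and on polynomials rests on this. *)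
Lemma RInt_zero_cont (f : R -> R) a b : a < b ->
  (forall x, continuous f x) -> (forall x, a <= x <= b -> 0 <= f x) ->
  RInt f a b = 0 -> forall x, a <= x <= b -> f x = 0.
Proof.
intros Hab Hc Hp H0 x Hx.
destruct (Rle_lt_or_eq_dec _ _ (Hp x Hx)) as [Hlt|]; auto. exfalso.
assert (Hl : locally x (fun y => 0 < f y)).
{ apply (Hc x). apply (open_gt 0); auto. }
destruct Hl as [d Hd].
pose proof (cond_pos d) as Hdp.
(* Clipping to [[a, b]] leaves a nondegenerate interval even when [x] is an end point. *)
set (c := Rmax a (x - d/2)). set (e := Rmin b (x + d/2)).
assert (Hca : a <= c) by apply Rmax_l.
assert (Heb : e <= b) by apply Rmin_l.
assert (Hce : c < e).
{ unfold c, e, Rmax, Rmin. destruct Rle_dec; destruct Rle_dec; lra. }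
assert (Hc1 : x - d/2 <= c) by apply Rmax_r.
assert (He1 : e <= x + d/2) by apply Rmin_r.
assert (E : forall p q, ex_RInt f p q) by (intros; now apply ex_RInt_cont).
assert (Hpos : 0 < RInt f c e).
{ apply RInt_gt_0; auto. intros y Hy. apply Hd.
  apply Rabs_def1; unfold minus, plus, opp; simpl; lra. }
assert (0 <= RInt f a c) by (apply RInt_ge_0R; auto; intros; apply Hp; lra).
assert (0 <= RInt f e b) by (apply RInt_ge_0R; auto; intros; apply Hp; lra).
pose proof (RInt_ChaslesR f a c e (E _ _) (E _ _)).
pose proof (RInt_ChaslesR f a e b (E _ _) (E _ _)). lra.
Qed.

(** * The uniform mesh and functions continuous on each element *)

Definition node (N i : nat) : R := INR i / INR N.

Lemma mesh_size N : (1 <= N)%nat -> 0 < / INR N /\ / INR N <= 1 /\ INR N * / INR N = 1.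
Proof.
intros HN. assert (H : 1 <= INR N) by (apply (le_INR 1); auto).
split; [apply Rinv_0_lt_compat; lra|split; [|field; lra]]. rewrite <- Rinv_1. apply Rinv_le_contravar; lra.
Qed.

Lemma node_0 N : node N 0 = 0.
Proof. unfold node; simpl; unfold Rdiv; ring. Qed.
Lemma INR_gt0 N : (1 <= N)%nat -> 0 < INR N.
Proof. intros; apply lt_0_INR; lia. Qed.
Lemma node_N N : (1 <= N)%nat -> node N N = 1.
Proof. intros H; unfold node; apply INR_gt0 in H; field; lra. Qed.
Lemma node_S N i : (1 <= N)%nat -> node N (i+1) = node N i + / INR N.
Proof. intros H; unfold node; apply INR_gt0 in H; rewrite plus_INR; simpl; field; lra. Qed.
Lemma node_lt N i : (1 <= N)%nat -> node N i < node N (i+1).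
Proof. intros H; rewrite node_S; auto. apply INR_gt0 in H.
assert (0 < / INR N) by now apply Rinv_0_lt_compat. lra. Qed.
Lemma node_le N i j : (1 <= N)%nat -> (i <= j)%nat -> node N i <= node N j.
Proof. intros H Hij. unfold node. apply Rmult_le_compat_r.
left; apply Rinv_0_lt_compat, INR_gt0; auto. now apply le_INR. Qed.
Lemma node_range N i : (1 <= N)%nat -> (i <= N)%nat -> 0 <= node N i <= 1.
Proof. intros H Hi; split. rewrite <- (node_0 N); apply node_le; auto; lia.
rewrite <- (node_N N); auto. apply node_le; auto. Qed.

(** Asking for a globally continuous [g] that agrees on the open element leaves the nodal values of
    [f] free, so derivatives of [Vh] functions qualify, and integrability and algebra reduce to
    continuous functions without one-sided limits. *)
Definition PC (N : nat) (f : R -> R) : Prop :=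
  forall i, (i < N)%nat -> exists g : R -> R, (forall x, continuous g x) /\
    forall x, node N i < x < node N (i + 1) -> f x = g x.

Lemma PC_cont N f : (forall x, continuous f x) -> PC N f.
Proof. intros H i _; exists f; auto. Qed.
Lemma PC_const N c : PC N (fun _ => c).
Proof. apply PC_cont; intros; apply continuous_const. Qed.
Lemma PC_plus N f g : PC N f -> PC N g -> PC N (fun x => f x + g x).
Proof. intros Hf Hg i Hi. destruct (Hf i Hi) as (f1 & ? & E1), (Hg i Hi) as (g1 & ? & E2).
exists (fun x => f1 x + g1 x); split; intros. apply cont_plus; auto. now rewrite E1, E2. Qed.
Lemma PC_minus N f g : PC N f -> PC N g -> PC N (fun x => f x - g x).
Proof. intros Hf Hg i Hi. destruct (Hf i Hi) as (f1 & ? & E1), (Hg i Hi) as (g1 & ? & E2).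
exists (fun x => f1 x - g1 x); split; intros. apply cont_minus; auto. now rewrite E1, E2. Qed.
Lemma PC_mult N f g : PC N f -> PC N g -> PC N (fun x => f x * g x).
Proof. intros Hf Hg i Hi. destruct (Hf i Hi) as (f1 & ? & E1), (Hg i Hi) as (g1 & ? & E2).
exists (fun x => f1 x * g1 x); split; intros. apply cont_mult; auto. now rewrite E1, E2. Qed.
Lemma PC_scal N c f : PC N f -> PC N (fun x => c * f x).
Proof. intros; apply PC_mult; auto. apply PC_const. Qed.
Lemma PC_Sum N (f : nat -> R -> R) n : (forall j, (j < n)%nat -> PC N (f j)) -> PC N (fun x => Sum (fun j => f j x) n).
Proof. induction n; intros H; simpl. apply PC_const. apply PC_plus; [apply IHn; intros; apply H; lia|apply H; lia]. Qed.
Lemma PC_ext N f g : (1 <= N)%nat -> (forall x, 0 <= x <= 1 -> f x = g x) -> PC N f -> PC N g.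
Proof. intros HN H Hf i Hi. destruct (Hf i Hi) as (f1 & ? & E1). exists f1; split; auto.
intros x Hx. rewrite <- H; auto.
pose proof (node_range N i HN ltac:(lia)). pose proof (node_range N (i+1) HN ltac:(lia)). lra. Qed.

Lemma PC_ex_el N f i : (1 <= N)%nat -> PC N f -> (i < N)%nat -> ex_RInt f (node N i) (node N (i+1)).
Proof.
intros HN Hf Hi. destruct (Hf i Hi) as (g & Hg & E).
pose proof (node_lt N i HN).
apply ex_RInt_ext with g; [|now apply ex_RInt_cont].
intros x Hx. rewrite Rmin_left, Rmax_right in Hx by lra. now rewrite E.
Qed.

Lemma PC_Sum_el N f n : (1 <= N)%nat -> PC N f -> (n <= N)%nat ->
  ex_RInt f 0 (node N n) /\ RInt f 0 (node N n) = Sum (fun i => RInt f (node N i) (node N (i+1))) n.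
Proof.
intros HN Hf; induction n; intros Hn.
- rewrite node_0; split. apply ex_RInt_point. simpl. apply (RInt_point 0 f).
- destruct IHn as [E1 E2]; [lia|].
  assert (E3 := PC_ex_el N f n HN Hf ltac:(lia)).
  replace (S n) with (n+1)%nat in * by lia.
  split. eapply ex_RInt_Chasles; eauto.
  rewrite <- (RInt_ChaslesR f _ (node N n)); auto.
  replace (n+1)%nat with (S n) by lia. simpl. rewrite E2.
  now replace (n+1)%nat with (S n) by lia.
Qed.

Lemma PC_ex N f : (1 <= N)%nat -> PC N f -> ex_RInt f 0 1.
Proof. intros HN Hf. rewrite <- (node_N N HN). apply PC_Sum_el; auto. Qed.

Lemma RInt_elements N f : (1 <= N)%nat -> PC N f ->
  RInt f 0 1 = Sum (fun i => RInt f (node N i) (node N (i+1))) N.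
Proof. intros HN Hf. rewrite <- (node_N N HN) at 1. apply PC_Sum_el; auto. Qed.

(** * The inner product and norm of L^2(0,1) on piecewise continuous functions *)

Lemma ip_sym f g : ip f g = ip g f.
Proof. unfold ip. f_equal. apply functional_extensionality; intros; ring. Qed.

Lemma ip_ext f g f' g' : (forall x, 0 < x < 1 -> f x = f' x) -> (forall x, 0 < x < 1 -> g x = g' x) ->
  ip f g = ip f' g'.
Proof. intros H1 H2. unfold ip. apply RInt_ext. rewrite Rmin_left, Rmax_right by lra.
intros x Hx; rewrite H1, H2; auto. Qed.

Lemma ip_plus_l N f g h : (1 <= N)%nat -> PC N f -> PC N g -> PC N h ->
  ip (fun x => f x + g x) h = ip f h + ip g h.
Proof. intros. unfold ip. rewrite <- RInt_plusR.
f_equal; apply functional_extensionality; intros; ring.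
all: apply (PC_ex N); auto; now apply PC_mult. Qed.
Lemma ip_minus_l N f g h : (1 <= N)%nat -> PC N f -> PC N g -> PC N h ->
  ip (fun x => f x - g x) h = ip f h - ip g h.
Proof. intros. unfold ip. rewrite <- RInt_minusR.
f_equal; apply functional_extensionality; intros; ring.
all: apply (PC_ex N); auto; now apply PC_mult. Qed.
Lemma ip_scal_l N c f h : (1 <= N)%nat -> PC N f -> PC N h ->
  ip (fun x => c * f x) h = c * ip f h.
Proof. intros. unfold ip. rewrite <- RInt_scalR.
f_equal; apply functional_extensionality; intros; ring.
all: apply (PC_ex N); auto; now apply PC_mult. Qed.
Lemma ip_plus_r N f g h : (1 <= N)%nat -> PC N f -> PC N g -> PC N h ->
  ip h (fun x => f x + g x) = ip h f + ip h g.
Proof. intros; rewrite ip_sym, (ip_plus_l N), (ip_sym f), (ip_sym g); auto. Qed.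
Lemma ip_minus_r N f g h : (1 <= N)%nat -> PC N f -> PC N g -> PC N h ->
  ip h (fun x => f x - g x) = ip h f - ip h g.
Proof. intros; rewrite ip_sym, (ip_minus_l N), (ip_sym f), (ip_sym g); auto. Qed.
Lemma ip_scal_r N c f h : (1 <= N)%nat -> PC N f -> PC N h ->
  ip h (fun x => c * f x) = c * ip h f.
Proof. intros; rewrite ip_sym, (ip_scal_l N), (ip_sym f); auto. Qed.
Lemma ip_0_l f : ip (fun _ => 0) f = 0.
Proof. unfold ip. rewrite (RInt_ext _ (fun _ => 0)). rewrite RInt_const. unfold scal; simpl; unfold mult; simpl; ring.
intros x _; change (0 * f x = 0); ring. Qed.
Lemma ip_Sum_l N c (f : nat -> R -> R) h n : (1 <= N)%nat -> (forall j, (j<n)%nat -> PC N (f j)) -> PC N h ->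
  ip (fun x => Sum (fun j => c j * f j x) n) h = Sum (fun j => c j * ip (f j) h) n.
Proof.
intros HN Hf Hh. induction n; simpl. apply ip_0_l.
rewrite (ip_plus_l N), (ip_scal_l N), IHn; auto. all: auto.
apply (PC_Sum N (fun j x => c j * f j x)). intros; apply PC_scal; auto.
apply PC_scal; auto.
Qed.

Lemma ip_pos N f : (1 <= N)%nat -> PC N f -> 0 <= ip f f.
Proof. intros. unfold ip. apply RInt_ge_0R; [lra| |intros; apply Rle_0_sqr].
apply (PC_ex N); auto; now apply PC_mult. Qed.

Lemma L2_sq N f : (1 <= N)%nat -> PC N f -> L2norm f * L2norm f = ip f f.
Proof. intros; apply sqrt_sqrt. now apply (ip_pos N). Qed.
Lemma L2_pos f : 0 <= L2norm f.
Proof. apply sqrt_pos. Qed.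

Lemma le_of_sq a b : 0 <= b -> a * a <= b * b -> a <= b.
Proof. intros Hb H. apply Rnot_lt_le; intros Hl. nra. Qed.

(** On [PC] the form [ip] is only semidefinite (nodal values are invisible to it), so the case
    [ip g g = 0] needs its own argument. *)
Lemma ip_CS_sq N f g : (1 <= N)%nat -> PC N f -> PC N g -> ip f g * ip f g <= ip f f * ip g g.
Proof.
intros HN Hf Hg.
assert (Q : forall s t, 0 <= s*s * ip f f + 2 * s * t * ip f g + t*t* ip g g).
{ intros s t.
  pose proof (ip_pos N (fun x => s * f x + t * g x) HN ltac:(apply PC_plus; apply PC_scal; auto)) as H.
  rewrite (ip_plus_l N), !(ip_scal_l N), !(ip_plus_r N), !(ip_scal_r N) in H by (auto; try apply PC_plus; apply PC_scal; auto).
  rewrite (ip_sym g f) in H. nra. }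
pose proof (ip_pos N g HN Hg).
destruct (Req_dec (ip g g) 0) as [E|E].
- destruct (Req_dec (ip f g) 0) as [E'|E']; [rewrite E'; nra|]. exfalso.
  (* When [ip g g = 0] these weights give the quadratic form the value - (f, g)^2, which would be
     negative. *)
  pose proof (Q (- ip f g) ((ip f f + 1) / 2)) as Q1. rewrite E in Q1. nra.
- pose proof (Q (ip g g) (- ip f g)) as Q1.
  apply Rmult_le_reg_l with (ip g g); nra.
Qed.

Lemma ip_CS N f g : (1 <= N)%nat -> PC N f -> PC N g -> Rabs (ip f g) <= L2norm f * L2norm g.
Proof.
intros HN Hf Hg. apply le_of_sq. apply Rmult_le_pos; apply L2_pos.
replace (L2norm f * L2norm g * (L2norm f * L2norm g)) with ((L2norm f*L2norm f) * (L2norm g * L2norm g)) by ring.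
rewrite !(L2_sq N); auto. rewrite <- Rabs_mult, Rabs_right.
now apply (ip_CS_sq N). apply Rle_ge, Rle_0_sqr.
Qed.

Lemma L2_triang N f g : (1 <= N)%nat -> PC N f -> PC N g -> L2norm (fun x => f x + g x) <= L2norm f + L2norm g.
Proof.
intros HN Hf Hg. pose proof (L2_pos f). pose proof (L2_pos g).
apply le_of_sq; [lra|]. rewrite (L2_sq N); auto. 2: now apply PC_plus.
rewrite (ip_plus_l N), !(ip_plus_r N), (ip_sym g f); auto. 2: now apply PC_plus.
pose proof (ip_CS N f g HN Hf Hg). pose proof (Rle_abs (ip f g)).
rewrite <- (L2_sq N f), <- (L2_sq N g); auto. nra.
Qed.

Lemma L2_ext f g : (forall x, 0 < x < 1 -> f x = g x) -> L2norm f = L2norm g.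
Proof. intros H; unfold L2norm. f_equal. now apply ip_ext. Qed.

Lemma L2_scal N c f : (1 <= N)%nat -> PC N f -> L2norm (fun x => c * f x) = Rabs c * L2norm f.
Proof. intros. unfold L2norm. rewrite (ip_scal_l N), (ip_scal_r N); auto. 2: now apply PC_scal.
rewrite <- Rmult_assoc, sqrt_mult_alt by apply Rle_0_sqr. f_equal.
apply sqrt_Rsqr_abs. Qed.

Lemma L2_minus N f g : (1 <= N)%nat -> PC N f -> PC N g -> L2norm (fun x => f x - g x) <= L2norm f + L2norm g.
Proof.
intros HN Hf Hg. rewrite (L2_ext _ (fun x => f x + (-1) * g x)) by (intros; ring).
eapply Rle_trans. apply (L2_triang N); auto. now apply PC_scal.
rewrite (L2_scal N); auto. rewrite Rabs_left by lra. lra.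
Qed.

Lemma L2_tri3 N f g h : (1 <= N)%nat -> PC N f -> PC N g -> PC N h ->
  L2norm (fun x => f x - h x) <= L2norm (fun x => f x - g x) + L2norm (fun x => g x - h x).
Proof.
intros HN Hf Hg Hh. rewrite (L2_ext _ (fun x => (f x - g x) + (g x - h x))) by (intros; ring).
apply (L2_triang N); auto; now apply PC_minus.
Qed.

Lemma L2_le_sq N f b : (1 <= N)%nat -> PC N f -> 0 <= b -> ip f f <= b * b -> L2norm f <= b.
Proof. intros. apply le_of_sq; auto. rewrite (L2_sq N); auto. Qed.

Lemma ip_mono N f g : (1 <= N)%nat -> PC N f -> PC N g ->
  (forall i x, (i < N)%nat -> node N i < x < node N (i+1) -> Rabs (f x) <= Rabs (g x)) -> ip f f <= ip g g.
Proof.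
intros HN Hf Hg H. unfold ip. rewrite !(RInt_elements N); auto; try now apply PC_mult.
apply Sum_le. intros i Hi. apply RInt_le.
left; now apply node_lt. 1,2: apply (PC_ex_el N); auto; now apply PC_mult.
intros x Hx. specialize (H i x Hi Hx).
rewrite <- (Rabs_right (f x * f x)), <- (Rabs_right (g x * g x)) by apply Rle_ge, Rle_0_sqr.
rewrite !Rabs_mult. pose proof (Rabs_pos (f x)). nra.
Qed.

Lemma L2_mono N f g : (1 <= N)%nat -> PC N f -> PC N g ->
  (forall i x, (i < N)%nat -> node N i < x < node N (i+1) -> Rabs (f x) <= Rabs (g x)) -> L2norm f <= L2norm g.
Proof. intros. apply sqrt_le_1_alt. now apply (ip_mono N). Qed.

Lemma L2_const c : L2norm (fun _ => c) = Rabs c.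
Proof. unfold L2norm, ip. rewrite RInt_const. unfold scal; simpl; unfold mult; simpl.
replace ((1-0)*(c*c)) with (Rsqr c) by (unfold Rsqr; ring). apply sqrt_Rsqr_abs. Qed.

Lemma L2_bound N f b : (1 <= N)%nat -> PC N f -> 0 <= b ->
  (forall i x, (i < N)%nat -> node N i < x < node N (i+1) -> Rabs (f x) <= b) -> L2norm f <= b.
Proof.
intros. rewrite <- (Rabs_right b), <- (L2_const b) by lra. apply (L2_mono N); auto.
apply PC_const. intros. rewrite (Rabs_right b); eauto; lra.
Qed.

(** * Polynomials, dual bases and orthonormal bases *)

Lemma Sum_head f n : Sum f (S n) = f O + Sum (fun j => f (S j)) n.
Proof. induction n; simpl in *; lra. Qed.

Definition polyR (k : nat) (f : R -> R) : Prop :=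
  exists c : nat -> R, forall x, f x = Sum (fun j => c j * x ^ j) (S k).

Lemma polyR_S k f : polyR k f -> polyR (S k) f.
Proof.
intros [c H]. exists (fun j => if le_dec j k then c j else 0). intros x.
rewrite H. simpl Sum at 2. destruct (le_dec (S k) k); [lia|].
rewrite Rmult_0_l, Rplus_0_r. change (Sum (fun j : nat => (if le_dec j k then c j else 0) * x ^ j) k +
 (if le_dec k k then c k else 0) * x ^ k) with (Sum (fun j : nat => (if le_dec j k then c j else 0) * x ^ j) (S k)).
apply Sum_ext. intros j Hj. destruct (le_dec j k); [auto|lia].
Qed.
Lemma polyR_le k l f : (k <= l)%nat -> polyR k f -> polyR l f.
Proof. induction 1; auto. intros; apply polyR_S; auto. Qed.
Lemma polyR_ext k f g : (forall x, f x = g x) -> polyR k f -> polyR k g.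
Proof. intros E [c H]; exists c; intros; rewrite <- E; auto. Qed.
Lemma polyR_0 c : polyR 0 (fun _ => c).
Proof. exists (fun _ => c); intros; simpl; ring. Qed.
Lemma polyR_const k c : polyR k (fun _ => c).
Proof. apply (polyR_le 0); [lia|apply polyR_0]. Qed.
Lemma polyR_plus k f g : polyR k f -> polyR k g -> polyR k (fun x => f x + g x).
Proof. intros [c H] [d H']; exists (fun j => c j + d j); intros x. rewrite H, H', <- Sum_plus.
apply Sum_ext; intros; ring. Qed.
Lemma polyR_scal k a f : polyR k f -> polyR k (fun x => a * f x).
Proof. intros [c H]; exists (fun j => a * c j); intros x. rewrite H, <- Sum_scal.
apply Sum_ext; intros; ring. Qed.
Lemma polyR_minus k f g : polyR k f -> polyR k g -> polyR k (fun x => f x - g x).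
Proof. intros. apply polyR_ext with (fun x => f x + (-1) * g x). intros; ring.
apply polyR_plus; auto. now apply polyR_scal. Qed.
Lemma polyR_mulX k f : polyR k f -> polyR (S k) (fun x => x * f x).
Proof.
intros [c H]. exists (fun j => match j with O => 0 | S j => c j end). intros x.
rewrite Sum_head, H, <- Sum_scal. rewrite Rmult_0_l, Rplus_0_l. apply Sum_ext; intros; simpl; ring.
Qed.
Lemma polyR_mul_aff k a b f : polyR k f -> polyR (S k) (fun x => (a * x + b) * f x).
Proof.
intros H. apply polyR_ext with (fun x => a * (x * f x) + b * f x). intros; ring.
apply polyR_plus. now apply polyR_scal, polyR_mulX. now apply polyR_S, polyR_scal.
Qed.
Lemma polyR_Sum k (f : nat -> R -> R) n : (forall j, (j < n)%nat -> polyR k (f j)) -> polyR k (fun x => Sum (fun j => f j x) n).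
Proof. induction n; intros H; simpl. apply polyR_const.
apply polyR_plus; [apply IHn; intros; apply H; lia|apply H; lia]. Qed.
Lemma polyR_pow_aff a b j : polyR j (fun x => (a * x + b) ^ j).
Proof. induction j; simpl. apply polyR_0. now apply polyR_mul_aff. Qed.
Lemma polyR_pow j : polyR j (fun x => x ^ j).
Proof. apply polyR_ext with (fun x => (1 * x + 0)^j). intros; f_equal; ring. apply polyR_pow_aff. Qed.
Lemma polyR_aff k f a b : polyR k f -> polyR k (fun x => f (a * x + b)).
Proof.
intros [c H]. apply polyR_ext with (fun x => Sum (fun j => c j * (a * x + b)^j) (S k)).
intros; now rewrite H. apply (polyR_Sum k (fun j x => c j * (a * x + b)^j)).
intros j Hj. apply polyR_scal, (polyR_le j); [lia|]. apply polyR_pow_aff.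
Qed.

Lemma polyR_derive k f : polyR k f -> exists f', polyR k f' /\ forall x, is_derive f x (f' x).
Proof.
intros [c H].
assert (G : forall n, exists f', polyR n f' /\ forall x, is_derive (fun x => Sum (fun j => c j * x^j) (S n)) x (f' x)).
{ induction n.
  - exists (fun _ => 0); split; [apply polyR_0|]. intros x; simpl. auto_derive; auto; ring.
  - destruct IHn as (f' & P & D).
    exists (fun x => f' x + c (S n) * (INR (S n) * x ^ n)). split.
    + apply polyR_S, polyR_plus; auto. apply polyR_scal, polyR_scal, polyR_pow.
    + intros x. change (fun x0 => Sum (fun j => c j * x0 ^ j) (S (S n))) with
        (fun x0 => Sum (fun j => c j * x0 ^ j) (S n) + c (S n) * x0 ^ (S n)).
      apply is_derive_plusR; auto.
      auto_derive; auto. simpl Nat.pred. simpl. ring. }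
destruct (G k) as (f' & P & D). exists f'; split; auto.
intros x. apply is_derive_ext with (fun x => Sum (fun j => c j * x^j) (S k)); auto.
Qed.

Lemma polyR_cont k f x : polyR k f -> continuous f x.
Proof. intros H. destruct (polyR_derive _ _ H) as (f' & _ & D). eapply is_derive_cont; eauto. Qed.

(** Horner's scheme: with f(x) = c0 + x g(x) and g(x) = g(r) + (x - r) q(x), the difference f(x) -
    f(r) equals (x - r) (g(r) + x q(x)). *)
Lemma polyR_factor k r f : polyR (S k) f -> exists q, polyR k q /\ forall x, f x = f r + (x - r) * q x.
Proof.
revert f; induction k; intros f [c H].
- exists (fun _ => c 1%nat); split; [apply polyR_0|]. intros x. rewrite !H; simpl; ring.
- set (g := fun x => Sum (fun j => c (S j) * x ^ j) (S (S k))).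
  assert (Hg : polyR (S k) g) by (exists (fun j => c (S j)); reflexivity).
  assert (E : forall x, f x = c O + x * g x).
  { intros x. rewrite H, Sum_head. unfold g. rewrite <- Sum_scal. simpl pow at 1. rewrite Rmult_1_r. f_equal.
    apply Sum_ext; intros; simpl; ring. }
  destruct (IHk g Hg) as (q & Pq & Eq).
  exists (fun x => g r + x * q x). split.
  + apply polyR_plus. apply polyR_const. now apply polyR_mulX.
  + intros x. rewrite !E. rewrite (Eq x). ring.
Qed.

Lemma polyR_roots k f (r : nat -> R) : polyR k f ->
  (forall i j, (i <= k)%nat -> (j <= k)%nat -> i <> j -> r i <> r j) ->
  (forall j, (j <= k)%nat -> f (r j) = 0) -> forall x, f x = 0.
Proof.
revert f; induction k; intros f Hf Hr H0 x.
- destruct Hf as [c Hc]. rewrite Hc. specialize (H0 0%nat (le_n _)). rewrite Hc in H0. simpl in *. lra.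
- destruct (polyR_factor k (r (S k)) f Hf) as (q & Pq & Eq).
  assert (Hq : forall x, q x = 0).
  { apply IHk; auto. intros j Hj. pose proof (H0 j ltac:(lia)) as Hj0. pose proof (H0 (S k) ltac:(lia)) as Hk0.
    pose proof (Eq (r j)) as E. rewrite Hj0, Hk0, Rplus_0_l in E.
    symmetry in E; apply Rmult_integral in E; destruct E as [E|E]; auto.
    exfalso; apply (Hr j (S k)); auto; try lia. lra. }
  rewrite Eq, Hq, H0 by lia. ring.
Qed.

Lemma poly_on_iff k a b f : poly_on k a b f <-> exists p, polyR k p /\ forall x, a <= x <= b -> f x = p x.
Proof.
split.
- intros [c H]. exists (fun x => Sum (fun j => c j * x ^ j) (S k)). split; [exists c; auto|].
  intros x Hx. rewrite H, sum_f_R0_Sum; auto.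
- intros (p & [c Hc] & H). exists c. intros x Hx. rewrite H, Hc, sum_f_R0_Sum; auto.
Qed.

Definition subsp (V : (R -> R) -> Prop) : Prop :=
  V (fun _ => 0) /\ forall a b f g, V f -> V g -> V (fun x => a * f x + b * g x).

Lemma fun_ext (f g : R -> R) : (forall x, f x = g x) -> f = g.
Proof. apply functional_extensionality. Qed.

Lemma subsp_scal V a f : subsp V -> V f -> V (fun x => a * f x).
Proof. intros [_ H] Hf. replace (fun x => a * f x) with (fun x => a * f x + 0 * f x) by (apply fun_ext; intros; ring). auto. Qed.
Lemma subsp_plus V f g : subsp V -> V f -> V g -> V (fun x => f x + g x).
Proof. intros [_ H] Hf Hg. replace (fun x => f x + g x) with (fun x => 1 * f x + 1 * g x) by (apply fun_ext; intros; ring). auto. Qed.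
Lemma subsp_minus V f g : subsp V -> V f -> V g -> V (fun x => f x - g x).
Proof. intros [_ H] Hf Hg. replace (fun x => f x - g x) with (fun x => 1 * f x + (-1) * g x) by (apply fun_ext; intros; ring). auto. Qed.
Lemma subsp_Sum V (c : nat -> R) (f : nat -> R -> R) n : subsp V -> (forall j, (j < n)%nat -> V (f j)) ->
  V (fun x => Sum (fun j => c j * f j x) n).
Proof.
intros HV; induction n; intros H; simpl. apply HV.
apply (subsp_plus V (fun x => Sum (fun j => c j * f j x) n) (fun x => c n * f n x)); auto.
apply subsp_scal; auto.
Qed.

(** Definiteness yields vanishing at every point because members of [V] are functions, not classes;
    identities derived from it hold at the nodes too. *)
Definition bilin (V : (R -> R) -> Prop) (B : (R -> R) -> (R -> R) -> R) : Prop :=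
  (forall f g h a b, V f -> V g -> V h -> B (fun x => a * f x + b * g x) h = a * B f h + b * B g h) /\
  (forall f g, V f -> V g -> B f g = B g f) /\
  (forall f, V f -> 0 <= B f f) /\
  (forall f, V f -> B f f = 0 -> forall x, f x = 0).

Lemma bilin_0 V B h : subsp V -> bilin V B -> V h -> B (fun _ => 0) h = 0.
Proof. intros HV (H & _) Hh. specialize (H (fun _ => 0) (fun _ => 0) h 0 0 (proj1 HV) (proj1 HV) Hh).
cbv beta in H.
replace (fun _ : R => 0 * 0 + 0 * 0) with (fun _ : R => 0) in H by (apply fun_ext; intros; ring). lra. Qed.

Lemma bilin_Sum V B (c : nat -> R) (f : nat -> R -> R) h n : subsp V -> bilin V B -> (forall j, (j < n)%nat -> V (f j)) -> V h ->
  B (fun x => Sum (fun j => c j * f j x) n) h = Sum (fun j => c j * B (f j) h) n.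
Proof.
intros HV HB Hf Hh. induction n; simpl. now apply (bilin_0 V).
pose proof (proj1 HB (fun x => Sum (fun j => c j * f j x) n) (f n) h 1 (c n)) as E.
replace (fun x => Sum (fun j => c j * f j x) n + c n * f n x) with
 (fun x => 1 * Sum (fun j => c j * f j x) n + c n * f n x) by (apply fun_ext; intros; ring).
rewrite E, IHn; auto. ring. apply subsp_Sum; auto.
Qed.

Definition orthonormal (B : (R -> R) -> (R -> R) -> R) n (phi : nat -> R -> R) : Prop :=
  forall i j, (i < n)%nat -> (j < n)%nat -> B (phi i) (phi j) = if Nat.eq_dec i j then 1 else 0.

(** Gram-Schmidt without dimension theory: induction on the number of points that determine members
    of [V]. Dropping the last point means passing to the subspace vanishing there, which is all of
    [V] or has codimension one. The matrix [al] records that coordinates are combinations of point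
    values; this carries regularity in t at fixed points over to coordinates. *)
Lemma orthonormal_basis B (p : nat -> R) m : forall V, subsp V -> bilin V B ->
  (forall f, V f -> (forall i, (i < m)%nat -> f (p i) = 0) -> forall x, f x = 0) ->
  exists n (phi : nat -> R -> R) (al : nat -> nat -> R), (forall j, V (phi j)) /\ orthonormal B n phi /\
   forall f, V f -> (forall x, f x = Sum (fun j => B f (phi j) * phi j x) n) /\
     forall j, (j < n)%nat -> B f (phi j) = Sum (fun i => al j i * f (p i)) m.
Proof.
induction m; intros V HV HB Hker.
- exists O, (fun _ _ => 0), (fun _ _ => 0). split; [intros; apply HV|split; [intros i j; lia|]].
  intros f Hf. split; [|intros; lia]. intros x. apply Hker; auto; lia.
- set (V' := fun f => V f /\ f (p m) = 0).
  pose proof HB as (B1 & B2 & B3 & B4).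
  destruct (IHm V') as (n & phi & al & Hphi & Ho & Hrep).
  { split; [split; [apply HV|auto]|]. intros a b f g [Hf Ef] [Hg Eg]. split. now apply HV. rewrite Ef, Eg; ring. }
  { split; [intros f g h a b [? _] [? _] [? _]; auto|split; [intros f g [? _] [? _]; auto|split; intros f [? _]; auto]]. }
  { intros f [Hf Ef] H. apply Hker; auto. intros i Hi. destruct (Nat.eq_dec i m) as [->|]; auto. apply H; lia. }
  assert (HVp : forall j, V (phi j)) by (intros; apply Hphi).
  destruct (classic (exists v, V v /\ v (p m) <> 0)) as [(v & Hv & Hvm)|Hno].
  2:{ exists n, phi, (fun j i => if Nat.eq_dec i m then 0 else al j i). split; [|split]; auto. intros f Hf.
      destruct (Hrep f) as [R1 R2]. { split; auto. apply NNPP; intros H; apply Hno; eauto. }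
      split; auto. intros j Hj. rewrite R2 by auto. simpl. destruct (Nat.eq_dec m m); [|lia]. rewrite Rmult_0_l, Rplus_0_r.
      apply Sum_ext. intros i Hi. destruct (Nat.eq_dec i m); [lia|auto]. }
  (* [r] is [v] minus its orthogonal projection onto [V']. The basis functions of [V'] vanish at
     [p m], so [r (p m) = v (p m)] is nonzero, hence so is [r]. *)
  set (r := fun x => v x - Sum (fun j => B v (phi j) * phi j x) n).
  assert (Vr : V r) by (apply (subsp_minus V v); auto; apply subsp_Sum; auto).
  assert (Er : r (p m) = v (p m)).
  { unfold r. rewrite (Sum_ext _ (fun _ => 0)), Sum_const. ring. intros j _. rewrite (proj2 (Hphi j)). ring. }
  assert (Hrp : 0 < B r r).
  { destruct (Req_dec (B r r) 0) as [E|E]; [|specialize (B3 r Vr); lra]. rewrite (B4 r Vr E) in Er. congruence. }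
  set (s := sqrt (B r r)). assert (Hs : 0 < s) by now apply sqrt_lt_R0.
  assert (Hss : s * s = B r r) by (apply sqrt_sqrt; lra).
  set (e := fun x => / s * r x). assert (Ve : V e) by now apply subsp_scal.
  assert (Bscal : forall a f h, V f -> V h -> B (fun x => a * f x) h = a * B f h).
  { intros a f h Hf Hh. replace (fun x => a * f x) with (fun x => a * f x + 0 * f x) by (apply fun_ext; intros; ring). rewrite B1; auto. ring. }
  assert (Hr : forall j, (j < n)%nat -> B r (phi j) = 0).
  { intros j Hj. unfold r.
    replace (fun x => v x - Sum (fun j => B v (phi j) * phi j x) n) with
      (fun x => 1 * v x + -1 * Sum (fun j => B v (phi j) * phi j x) n) by (apply fun_ext; intros; ring).
    rewrite B1, (bilin_Sum V); auto. 2: apply subsp_Sum; auto.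
    rewrite (Sum_ext _ (fun i => B v (phi i) * (if Nat.eq_dec i j then 1 else 0))), Sum_delta; auto. ring.
    intros; rewrite Ho; auto. }
  assert (He : forall j, (j < n)%nat -> B e (phi j) = 0) by (intros; unfold e; rewrite Bscal, Hr by auto; ring).
  assert (Hre : B r e = s) by (rewrite B2 by auto; unfold e; rewrite Bscal, <- Hss by auto; field; lra).
  (* Write f = g + l r with l = f(p m) / r(p m), so that g lies in [V']. The old coordinates are
     those of g, whose values are f(p i) - l r(p i), which produces the extra coefficient at [p m];
     the new coordinate is l s. *)
  exists (S n), (fun j => if lt_dec j n then phi j else e),
    (fun j i => if lt_dec j n then (if Nat.eq_dec i m then - Sum (fun i => al j i * r (p i)) m / r (p m) else al j i)
                else if Nat.eq_dec i m then s / r (p m) else 0).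
  split; [intros j; destruct (lt_dec j n); auto|split].
  + intros i j Hi Hj. destruct (lt_dec i n), (lt_dec j n).
    * apply Ho; auto.
    * rewrite B2, He by auto. destruct (Nat.eq_dec i j); [lia|auto].
    * rewrite He by auto. destruct (Nat.eq_dec i j); [lia|auto].
    * unfold e at 1. rewrite Bscal, Hre by auto. destruct (Nat.eq_dec i j); [field; lra|lia].
  + intros f Hf. set (l := f (p m) / r (p m)). set (g := fun x => f x - l * r x).
    assert (Vg : V' g).
    { split. apply (subsp_minus V f (fun x => l * r x)); auto. now apply subsp_scal. unfold g, l. field. congruence. }
    destruct (Hrep g Vg) as [R1 R2].
    assert (Bf : forall h, V h -> B f h = B g h + l * B r h).
    { intros h Hh. replace f with (fun x => 1 * g x + l * r x) at 1 by (apply fun_ext; intros; unfold g; ring).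
      rewrite B1; auto. ring. apply Vg. }
    assert (Bfp : forall j, (j < n)%nat -> B f (phi j) = B g (phi j)) by (intros; rewrite Bf, Hr by auto; ring).
    assert (Bfe : B f e = l * s).
    { rewrite Bf, Hre, (fun_ext g _ R1), (bilin_Sum V) by auto. rewrite (Sum_ext _ (fun _ => 0)), Sum_const. ring.
      intros j Hj. rewrite (B2 (phi j)), He by auto. ring. }
    split.
    * intros x. simpl. destruct (lt_dec n n); [lia|]. rewrite (Sum_ext _ (fun j => B g (phi j) * phi j x)), <- R1, Bfe.
      unfold g, e. field. lra. intros j Hj. destruct (lt_dec j n); [|lia]. now rewrite Bfp.
    * intros j Hj. simpl. destruct (lt_dec j n), (Nat.eq_dec m m); try lia.
      -- rewrite Bfp, R2 by auto. rewrite (Sum_ext (fun i => _ * f (p i)) (fun i => al j i * g (p i) + l * (al j i * r (p i)))).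
         rewrite Sum_plus, Sum_scal. unfold l. field. congruence.
         intros i Hi. destruct (Nat.eq_dec i m); [lia|]. unfold g; ring.
      -- rewrite (Sum_ext _ (fun _ => 0)), Sum_const, Bfe. unfold l. field. congruence.
         intros i Hi. destruct (Nat.eq_dec i m); [lia|ring].
Qed.

(** * The finite element space, the projection and the discrete derivative *)

(** Values are prescribed on closed elements, which forces agreement at the nodes and hence
    continuity on [0,1], while [f'] is prescribed only on open elements, where it may jump from one
    to the next. *)
Definition PC1 (N : nat) (f f' : R -> R) : Prop :=
  forall i, (i < N)%nat -> exists g g' : R -> R, (forall x, is_derive g x (g' x)) /\
    (forall x, continuous g' x) /\ (forall x, node N i <= x <= node N (i + 1) -> f x = g x) /\
    (forall x, node N i < x < node N (i + 1) -> f' x = g' x).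

Lemma PC1_PC N f f' : PC1 N f f' -> PC N f.
Proof. intros H i Hi. destruct (H i Hi) as (g & g' & D & C & E & E'). exists g; split.
intros x; eapply is_derive_cont; eauto. intros; apply E; lra. Qed.
Lemma PC1_PC' N f f' : PC1 N f f' -> PC N f'.
Proof. intros H i Hi. destruct (H i Hi) as (g & g' & D & C & E & E'). exists g'; split; auto. Qed.

Lemma Sum_telescope (f : nat -> R) n : Sum (fun i => f (i + 1)%nat - f i) n = f n - f O.
Proof. induction n; simpl; [ring|rewrite IHn]. replace (n+1)%nat with (S n) by lia. ring. Qed.

(** Since both functions have a single value at each node, the boundary terms of the elements
    telescope. *)
Lemma ip_by_parts N f f' g g' : (1 <= N)%nat -> PC1 N f f' -> PC1 N g g' ->
  ip f' g + ip f g' = f 1 * g 1 - f 0 * g 0.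
Proof.
intros HN Hf Hg.
pose proof (PC1_PC _ _ _ Hf). pose proof (PC1_PC' _ _ _ Hf).
pose proof (PC1_PC _ _ _ Hg). pose proof (PC1_PC' _ _ _ Hg).
assert (PC N (fun x => f' x * g x)) by now apply PC_mult.
assert (PC N (fun x => f x * g' x)) by now apply PC_mult.
unfold ip. rewrite <- RInt_plusR by now apply (PC_ex N).
rewrite (RInt_elements N); auto. 2: now apply PC_plus.
rewrite (Sum_ext _ (fun i => f (node N (i+1)) * g (node N (i+1)) - f (node N i) * g (node N i))).
- rewrite (Sum_telescope (fun i => f (node N i) * g (node N i))). now rewrite node_N, node_0.
- intros i Hi. destruct (Hf i Hi) as (a & a' & Da & Ca & Ea & Ea'), (Hg i Hi) as (b & b' & Db & Cb & Eb & Eb').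
  pose proof (node_lt N i HN).
  rewrite (RInt_ext _ (fun x => a' x * b x + a x * b' x)).
  2:{ rewrite Rmin_left, Rmax_right by lra. intros x Hx. rewrite Ea, Ea', Eb, Eb' by lra. reflexivity. }
  rewrite Ea, Eb, Ea, Eb by lra.
  apply is_RInt_unique. apply (is_RInt_derive (fun x => a x * b x) (fun x => a' x * b x + a x * b' x)).
  + intros x _. apply (is_derive_multR a b x (a' x) (b' x)); auto.
  + intros x _. apply cont_plus; apply cont_mult; auto; eapply is_derive_cont; eauto.
Qed.

Lemma Cp_per f : Cp f -> forall z x, f (x + IZR z) = f x.
Proof.
intros [_ H]. assert (P : forall n x, f (x + INR n) = f x).
{ induction n; intros x. simpl; f_equal; ring. rewrite S_INR.
  replace (x + (INR n + 1)) with ((x + INR n) + 1) by ring. rewrite H; auto. }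
intros z x. destruct (Z_le_dec 0 z) as [Hz|Hz].
- rewrite <- (Z2Nat.id z), <- INR_IZR_INZ by lia. apply P.
- rewrite <- (P (Z.to_nat (- z)) (x + IZR z)). f_equal.
  rewrite INR_IZR_INZ, Z2Nat.id, opp_IZR by lia. ring.
Qed.

Lemma frac_ex x : exists z y, 0 <= y < 1 /\ x = y + IZR z.
Proof. exists (Int_part x), (x - IZR (Int_part x)). pose proof (base_Int_part x). split; [lra|ring]. Qed.

Lemma find_el N n y : (1 <= N)%nat -> 0 <= y < node N n -> exists i, (i < n)%nat /\ node N i <= y < node N (i+1).
Proof.
intros HN; induction n; intros H. rewrite node_0 in H; lra.
destruct (Rlt_le_dec y (node N n)) as [Hl|Hl].
- destruct IHn as (i & ? & ?); [lra|]. exists i; split; auto.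
- exists n; split; auto. replace (n+1)%nat with (S n) by lia. lra.
Qed.

Lemma find_el_closed N x : (1 <= N)%nat -> 0 <= x <= 1 -> exists i, (i < N)%nat /\ node N i <= x <= node N (i + 1).
Proof.
intros HN Hx. destruct (Req_dec x 1) as [->|].
- exists (N - 1)%nat. split; [lia|]. replace (N - 1 + 1)%nat with N by lia. rewrite node_N by auto. split; [|lra].
  apply node_range; auto; lia.
- destruct (find_el N N x HN) as (i & ? & ?). rewrite node_N; auto; lra. exists i; split; auto; lra.
Qed.

Lemma Vh_el N k f i : Vh N k f -> (i < N)%nat -> exists p, polyR k p /\ forall x, node N i <= x <= node N (i+1) -> f x = p x.
Proof. intros [_ H] Hi. specialize (H i Hi). apply poly_on_iff in H. exact H. Qed.

Lemma Vh_cont N k f x : Vh N k f -> continuous f x.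
Proof. intros [[H _] _]; auto. Qed.

Lemma Vh_PC N k f : Vh N k f -> PC N f.
Proof. intros H; apply PC_cont; intros; eapply Vh_cont; eauto. Qed.

Lemma Vh_subsp N k : subsp (Vh N k).
Proof.
split.
- split; [split; auto; intros; apply continuous_const|]. intros i Hi. apply poly_on_iff.
  exists (fun _ => 0); split; auto. apply polyR_const.
- intros a b f g [[Cf Pf] Hf] [[Cg Pg] Hg]. split; [split|].
  + intros x; apply cont_plus; now apply cont_scal.
  + intros x; now rewrite Pf, Pg.
  + intros i Hi. apply poly_on_iff. destruct (proj1 (poly_on_iff _ _ _ _) (Hf i Hi)) as (p & Pp & Ep).
    destruct (proj1 (poly_on_iff _ _ _ _) (Hg i Hi)) as (q & Pq & Eq).
    exists (fun x => a * p x + b * q x). split. apply polyR_plus; now apply polyR_scal.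
    intros x Hx. now rewrite Ep, Eq.
Qed.

Lemma Vh_const N k c : Vh N k (fun _ => c).
Proof.
split; [split; auto; intros; apply continuous_const|]. intros i Hi. apply poly_on_iff.
exists (fun _ => c); split; auto. apply polyR_const.
Qed.

(** With m = i (k + 1) + j this is x_i + j h / (k + 1) for j = 0, ..., k: the k + 1 distinct points
    of element i that fix a polynomial of degree k, the right end being left to the next element. *)
Definition element_point (N k m : nat) : R := node N (m / S k) + INR (m mod S k) / INR (S k) * / INR N.

Lemma Vh_unisolvent N k f : (1 <= N)%nat -> Vh N k f ->
  (forall m, (m < N * S k)%nat -> f (element_point N k m) = 0) -> forall x, f x = 0.
Proof.
intros HN Hf H0 x. destruct (frac_ex x) as (z & y & Hy & ->). rewrite Cp_per by apply Hf.
destruct (find_el N N y HN) as (i & Hi & Hyi). now rewrite node_N.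
destruct (Vh_el N k f i Hf Hi) as (p & Pp & Ep). rewrite Ep by lra.
assert (HNp : 0 < / INR N) by now apply Rinv_0_lt_compat, INR_gt0.
assert (Hk : 0 < / INR (S k)) by (apply Rinv_0_lt_compat, INR_gt0; lia).
apply (polyR_roots k p (fun j => node N i + INR j / INR (S k) * / INR N)); auto.
- intros a b Ha Hb Hab E. apply Hab, INR_eq.
  apply Rplus_eq_reg_l in E. apply Rmult_eq_reg_r in E; [|lra]. apply Rmult_eq_reg_r in E; lra.
- intros j Hj. assert (Hm : (i * S k + j < N * S k)%nat) by nia.
  pose proof (H0 _ Hm) as E. unfold element_point in E.
  rewrite Nat.div_add_l, (Nat.div_small j), Nat.add_0_r in E by lia.
  rewrite Nat.add_comm, Nat.Div0.mod_add, Nat.mod_small in E by lia.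
  rewrite <- Ep; auto. rewrite node_S by auto.
  assert (0 <= INR j / INR (S k) <= 1).
  { split. apply Rmult_le_pos; [apply pos_INR|lra].
    apply Rmult_le_reg_r with (INR (S k)). apply INR_gt0; lia. unfold Rdiv. rewrite Rmult_assoc, Rinv_l, Rmult_1_l, Rmult_1_r.
    apply le_INR; lia. apply not_0_INR; lia. }
  split; nra.
Qed.

Lemma Vh_eq_01 N k f : Vh N k f -> (forall x, 0 <= x <= 1 -> f x = 0) -> forall x, f x = 0.
Proof. intros Hf H x. destruct (frac_ex x) as (z & y & Hy & ->). rewrite Cp_per by apply Hf. apply H; lra. Qed.

Lemma Vh_ip_def N k f : Vh N k f -> ip f f = 0 -> forall x, f x = 0.
Proof.
intros Hf H0. apply (Vh_eq_01 N k); auto. intros x Hx.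
assert (f x * f x = 0).
{ apply (RInt_zero_cont (fun x => f x * f x) 0 1); auto. lra. intros; apply cont_mult; eapply Vh_cont; eauto.
  intros; apply Rle_0_sqr. }
nra.
Qed.

Lemma ip_bilin N k : (1 <= N)%nat -> bilin (Vh N k) ip.
Proof.
intros HN. split; [|split; [|split]].
- intros f g h a b Hf Hg Hh. apply Vh_PC in Hf, Hg, Hh.
  rewrite (ip_plus_l N), !(ip_scal_l N); auto; now apply PC_scal.
- intros; apply ip_sym.
- intros f Hf. apply (ip_pos N); auto. eapply Vh_PC; eauto.
- intros; eapply Vh_ip_def; eauto.
Qed.

Lemma Vh_basis N k B : (1 <= N)%nat -> bilin (Vh N k) B -> exists n phi, (forall j, Vh N k (phi j)) /\ orthonormal B n phi /\
   (forall f, Vh N k f -> forall x, f x = Sum (fun j => B f (phi j) * phi j x) n) /\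
   exists m (p : nat -> R) al, forall f, Vh N k f -> forall j, (j < n)%nat -> B f (phi j) = Sum (fun i => al j i * f (p i)) m.
Proof.
intros HN HB.
destruct (orthonormal_basis B (element_point N k) (N * S k) (Vh N k) (Vh_subsp N k) HB) as (n & phi & al & HV & Ho & H).
{ intros; eapply Vh_unisolvent; eauto. }
exists n, phi. split; [|split; [|split]]; auto. intros f Hf; apply (H f Hf).
exists (N * S k)%nat, (element_point N k), al. intros f Hf; apply (H f Hf).
Qed.

(** The epsilon in [Proj] is meaningful once a witness exists: the Fourier sum of [f] in an
    L^2-orthonormal basis of [Vh]. *)
Lemma Proj_spec N k f : (1 <= N)%nat -> PC N f -> Vh N k (Proj N k f) /\
  forall chi, Vh N k chi -> ip (fun x => f x - Proj N k f x) chi = 0.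
Proof.
intros HN Hf. unfold Proj. apply epsilon_spec.
destruct (Vh_basis N k ip HN (ip_bilin N k HN)) as (n & phi & Hphi & Ho & Hrep & _).
set (P := fun x => Sum (fun j => ip f (phi j) * phi j x) n).
assert (VP : Vh N k P) by (apply (subsp_Sum (Vh N k) (fun j => ip f (phi j)) phi); auto; apply Vh_subsp).
assert (Hphi' : forall j, PC N (phi j)) by (intros; eapply Vh_PC; eauto).
exists P; split; auto.
intros chi Hc. pose proof (Vh_PC _ _ _ Hc). pose proof (Vh_PC _ _ _ VP).
rewrite (ip_minus_l N); auto.
rewrite (fun_ext chi _ (Hrep chi Hc)).
rewrite !(ip_sym _ (fun x => Sum _ n)), !(ip_Sum_l N); auto.
rewrite <- Sum_minus. rewrite (Sum_ext _ (fun _ => 0)). rewrite Sum_const; ring.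
intros j Hj. unfold P. rewrite (ip_sym (phi j) f), (ip_sym (phi j)), (ip_Sum_l N); auto.
rewrite (Sum_ext _ (fun i => ip f (phi i) * (if Nat.eq_dec i j then 1 else 0))).
rewrite Sum_delta; auto; ring. intros; rewrite Ho; auto.
Qed.

Lemma Proj_V N k f : (1 <= N)%nat -> PC N f -> Vh N k (Proj N k f).
Proof. intros; now apply Proj_spec. Qed.
Lemma Proj_PC N k f : (1 <= N)%nat -> PC N f -> PC N (Proj N k f).
Proof. intros; eapply Vh_PC, Proj_V; auto. Qed.
Lemma Proj_ip N k f chi : (1 <= N)%nat -> PC N f -> Vh N k chi -> ip (Proj N k f) chi = ip f chi.
Proof. intros HN Hf Hc. pose proof (proj2 (Proj_spec N k f HN Hf) chi Hc) as E.
rewrite (ip_minus_l N) in E; auto. lra. now apply Proj_PC. eapply Vh_PC; eauto. Qed.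

Lemma Vh_ip_ext N k f g : (1 <= N)%nat -> Vh N k f -> Vh N k g -> (forall chi, Vh N k chi -> ip f chi = ip g chi) -> forall x, f x = g x.
Proof.
intros HN Hf Hg H x. apply Rminus_diag_uniq.
assert (VD : Vh N k (fun x => f x - g x)) by (apply subsp_minus; auto; apply Vh_subsp).
apply (Vh_ip_def N k (fun x => f x - g x)); auto.
rewrite (ip_minus_l N); try (eapply Vh_PC; eauto); auto. rewrite H; auto. ring.
Qed.

Lemma Proj_unique N k f th : (1 <= N)%nat -> PC N f -> Vh N k th -> (forall chi, Vh N k chi -> ip f chi = ip th chi) ->
  forall x, Proj N k f x = th x.
Proof. intros HN Hf Ht H. apply (Vh_ip_ext N k); auto. now apply Proj_V. intros; rewrite Proj_ip; auto. Qed.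

(* Coquelicot's [Derive] only samples the increments 1/(n+1) > 0, so at a node it returns the right derivative; hence [dx] is linear on [Vh] at every point. *)
Definition right_derive (f : R -> R) (x l : R) : Prop :=
  exists g d, is_derive g x l /\ 0 < d /\ forall y, x <= y < x + d -> f y = g y.

Lemma right_derive_Derive f x l : right_derive f x l -> Derive f x = l.
Proof.
intros (g & d & Dg & Hd & E). rewrite <- (is_derive_unique _ _ _ Dg).
unfold Derive, Lim. f_equal. apply Lim_seq_ext_loc.
destruct (archimed_cor1 d Hd) as (n0 & Hn0 & Hn0').
exists n0. intros n Hn. simpl.
assert (0 < INR n0) by (apply lt_0_INR; lia). pose proof (le_INR _ _ Hn).
assert (0 < / (INR n + 1)) by (apply Rinv_0_lt_compat; lra).
assert (/ (INR n + 1) < / INR n0) by (apply Rinv_lt_contravar; nra).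
rewrite !E; auto; lra.
Qed.

Lemma right_derive_lin f g x a b l m : right_derive f x l -> right_derive g x m -> right_derive (fun y => a * f y + b * g y) x (a * l + b * m).
Proof.
intros (f1 & d & Df & Hd & E) (g1 & e & Dg & He & E').
exists (fun y => a * f1 y + b * g1 y), (Rmin d e). split; [|split].
- apply is_derive_plusR; now apply is_derive_scal.
- now apply Rmin_pos.
- intros y Hy. pose proof (Rmin_l d e). pose proof (Rmin_r d e). rewrite E, E'; lra.
Qed.

Lemma Vh_right_derive N k f x : (1 <= N)%nat -> Vh N k f -> right_derive f x (dx f x).
Proof.
intros HN Hf.
assert (H : exists l, right_derive f x l).
{ destruct (frac_ex x) as (z & y & Hy & ->).
  destruct (find_el N N y HN) as (i & Hi & Hyi). now rewrite node_N.
  destruct (Vh_el N k f i Hf Hi) as (p & Pp & Ep).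
  destruct (polyR_derive _ _ Pp) as (p' & _ & Dp).
  (* The element is half-open with [y < node N (i+1)], so the same polynomial, shifted by the
     period, represents [f] on a nontrivial interval to the right. *)
  exists (p' y), (fun s => p (s - IZR z)), (node N (i+1) - y). split; [|split].
  - pose proof (@is_derive_comp R_AbsRing R_NormedModule p (fun s => s - IZR z) (y + IZR z) (p' y) 1) as D.
    replace (p' y) with (scal 1 (p' y)) by (unfold scal; simpl; unfold mult; simpl; ring).
    apply D. replace (y + IZR z - IZR z) with y by ring; auto. auto_derive; auto.
  - lra.
  - intros s Hs. rewrite <- Ep by lra. rewrite <- (Cp_per f (proj1 Hf) z (s - IZR z)). f_equal; ring. }
destruct H as [l Hl]. unfold dx. now rewrite (right_derive_Derive _ _ _ Hl).
Qed.

Lemma dx_lin N k f g a b x : (1 <= N)%nat -> Vh N k f -> Vh N k g ->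
  dx (fun y => a * f y + b * g y) x = a * dx f x + b * dx g x.
Proof. intros HN Hf Hg. apply right_derive_Derive, right_derive_lin; eapply Vh_right_derive; eauto. Qed.

Lemma dx_Sum N k (c : nat -> R) (f : nat -> R -> R) n x : (1 <= N)%nat -> (forall j, (j < n)%nat -> Vh N k (f j)) ->
  dx (fun y => Sum (fun j => c j * f j y) n) x = Sum (fun j => c j * dx (f j) x) n.
Proof.
intros HN; induction n; intros H; simpl. unfold dx. apply Derive_const.
rewrite <- IHn by auto.
replace (fun y => Sum (fun j => c j * f j y) n + c n * f n y) with
  (fun y => 1 * Sum (fun j => c j * f j y) n + c n * f n y) by (apply fun_ext; intros; ring).
rewrite (dx_lin N k (fun y => Sum (fun j => c j * f j y) n) (f n)); auto. ring.
apply (subsp_Sum (Vh N k)); auto. apply Vh_subsp.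
Qed.

Lemma Vh_PC1 N k f : (1 <= N)%nat -> Vh N k f -> PC1 N f (dx f).
Proof.
intros HN Hf i Hi. destruct (Vh_el N k f i Hf Hi) as (p & Pp & Ep).
destruct (polyR_derive _ _ Pp) as (p' & P' & Dp).
exists p, p'. split; [exact Dp|split; [intros; eapply polyR_cont; eauto|split; [exact Ep|]]].
intros x Hx. apply right_derive_Derive. exists p, (node N (i+1) - x). split; auto. split; [lra|]. intros; apply Ep; lra.
Qed.

Lemma Vh_dx_el N k f i : (1 <= N)%nat -> Vh N k f -> (i < N)%nat -> exists p p', polyR k p /\ polyR k p' /\
   (forall x, is_derive p x (p' x)) /\
   (forall x, node N i <= x <= node N (i+1) -> f x = p x) /\ (forall x, node N i < x < node N (i+1) -> dx f x = p' x).
Proof.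
intros HN Hf Hi. destruct (Vh_el N k f i Hf Hi) as (p & Pp & Ep).
destruct (polyR_derive _ _ Pp) as (p' & P' & Dp).
exists p, p'. split; [auto|split; [auto|split; [exact Dp|split; [exact Ep|]]]].
intros x Hx. apply right_derive_Derive. exists p, (node N (i+1) - x). split; auto. split; [lra|]. intros; apply Ep; lra.
Qed.

Lemma Vh_dxPC N k f : (1 <= N)%nat -> Vh N k f -> PC N (dx f).
Proof. intros; eapply PC1_PC', Vh_PC1; eauto. Qed.

Lemma Vh_per1 N k f : Vh N k f -> f 1 = f 0.
Proof. intros [[_ H] _]. rewrite <- (H 0). f_equal; ring. Qed.

(* With G := Gh, testing against [dx chi] or against [G chi] is the same on [Vh], so the scheme reads (ut_t, chi) + (G ut_t, G chi) = (flux ut, G chi). *)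
Definition Gh (N k : nat) (f : R -> R) : R -> R := Proj N k (dx f).

Lemma Gh_V N k f : (1 <= N)%nat -> Vh N k f -> Vh N k (Gh N k f).
Proof. intros; apply Proj_V; auto. eapply Vh_dxPC; eauto. Qed.
Ltac pc := solve [auto | eauto 8 using PC_const, PC_plus, PC_minus, PC_mult, PC_scal, Vh_PC, Vh_dxPC, Proj_V, Gh_V].

Lemma Gh_ip N k f chi : (1 <= N)%nat -> Vh N k f -> Vh N k chi -> ip (Gh N k f) chi = ip (dx f) chi.
Proof. intros; apply Proj_ip; auto. eapply Vh_dxPC; eauto. Qed.
Lemma ip_dx_Gh N k th chi : (1 <= N)%nat -> Vh N k th -> Vh N k chi -> ip th (dx chi) = ip th (Gh N k chi).
Proof. intros. rewrite (ip_sym th (Gh _ _ _)), Gh_ip; auto. apply ip_sym. Qed.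
Lemma Gh_Sum N k (c : nat -> R) (f : nat -> R -> R) n x : (1 <= N)%nat -> (forall j, (j < n)%nat -> Vh N k (f j)) ->
  Gh N k (fun y => Sum (fun j => c j * f j y) n) x = Sum (fun j => c j * Gh N k (f j) x) n.
Proof.
intros HN H. unfold Gh. rewrite (fun_ext (dx _) _ (fun y => dx_Sum N k c f n y HN H)).
apply (Proj_unique N k _ (fun x => Sum (fun j => c j * Proj N k (dx (f j)) x) n)); auto.
- apply (PC_Sum N (fun j x => c j * dx (f j) x)). intros; apply PC_scal. eapply Vh_dxPC; eauto.
- apply (subsp_Sum (Vh N k)). apply Vh_subsp. intros; apply Gh_V; auto.
- intros chi Hc. rewrite !(ip_Sum_l N); auto. apply Sum_ext; intros j Hj. f_equal. symmetry. now apply Gh_ip; auto.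
  intros; eapply Vh_PC, Gh_V; eauto. eapply Vh_PC; eauto. intros; eapply Vh_dxPC; eauto. eapply Vh_PC; eauto.
Qed.
Lemma Gh_lin N k f g a b x : (1 <= N)%nat -> Vh N k f -> Vh N k g ->
  Gh N k (fun y => a * f y + b * g y) x = a * Gh N k f x + b * Gh N k g x.
Proof.
intros HN Hf Hg.
pose proof (Gh_Sum N k (fun j => match j with O => a | _ => b end) (fun j => match j with O => f | _ => g end) 2 x HN) as E.
simpl in E. replace (fun y => a * f y + b * g y) with (fun y => 0 + a * f y + b * g y) by (apply fun_ext; intros; ring).
rewrite E. ring. intros [|]; auto.
Qed.

(** On [Vh] this is the form acting on ut_t in the scheme, (f, g) + (G f, g_x), written
    symmetrically. In a basis orthonormal for it the mass matrix is the identity, so the time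
    derivative of each coordinate is explicit. *)
Definition energy (N k : nat) (f g : R -> R) : R := ip f g + ip (Gh N k f) (Gh N k g).

Lemma energy_bilin N k : (1 <= N)%nat -> bilin (Vh N k) (energy N k).
Proof.
intros HN. pose proof (ip_bilin N k HN) as (B1 & B2 & B3 & B4). split; [|split; [|split]].
- intros f g h a b Hf Hg Hh. unfold energy. rewrite B1; auto.
  rewrite (fun_ext (Gh N k (fun x => a * f x + b * g x)) _ (fun y => Gh_lin N k f g a b y HN Hf Hg)).
  rewrite B1; try apply Gh_V; auto. ring.
- intros f g Hf Hg. unfold energy. rewrite (ip_sym f g), (ip_sym (Gh _ _ f)). reflexivity.
- intros f Hf. unfold energy. pose proof (B3 f Hf). pose proof (B3 _ (Gh_V N k f HN Hf)). lra.
- intros f Hf E. unfold energy in E. apply B4; auto. pose proof (B3 f Hf). pose proof (B3 _ (Gh_V N k f HN Hf)). lra.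
Qed.

(** * Inverse inequalities and the Legendre polynomial *)

Lemma cont_bounded f a b : a <= b -> (forall x, continuous f x) -> exists B, 0 <= B /\ forall x, a <= x <= b -> Rabs (f x) <= B.
Proof.
intros Hab Hf. destruct (continuity_ab_maj (fun x => Rabs (f x)) a b Hab) as (m & Hm & _).
- intros c _. apply continuity_pt_filterlim. apply (continuous_comp f Rabs). apply Hf. apply continuous_Rabs.
- exists (Rabs (f m)); split; auto. apply Rabs_pos.
Qed.

Lemma polyR_Derive k f : polyR k f -> polyR k (Derive f) /\ forall x, is_derive f x (Derive f x).
Proof.
intros H. destruct (polyR_derive k f H) as (f' & P & D).
assert (E : Derive f = f') by (apply fun_ext; intros; apply is_derive_unique; auto).
rewrite E; auto.
Qed.

Lemma polyR_subsp k : subsp (polyR k).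
Proof. split. apply polyR_const. intros; apply polyR_plus; now apply polyR_scal. Qed.

Lemma polyR_PC N k f : polyR k f -> PC N f.
Proof. intros; apply PC_cont; intros; eapply polyR_cont; eauto. Qed.

Lemma polyR_unisolvent k f : polyR k f -> (forall i, (i < S k)%nat -> f (INR i / INR (S k)) = 0) -> forall x, f x = 0.
Proof.
intros Hf H. apply (polyR_roots k f (fun j => INR j / INR (S k))); auto.
- intros i j Hi Hj Hij E. apply Hij, INR_eq. apply Rmult_eq_reg_r in E; auto.
  apply Rinv_neq_0_compat, not_0_INR; lia.
- intros; apply H; lia.
Qed.

Lemma polyR_ip_def k f : polyR k f -> ip f f = 0 -> forall x, f x = 0.
Proof.
intros Hf H0. apply (polyR_unisolvent k); auto. intros i Hi.
assert (Hk : 0 < INR (S k)) by (apply INR_gt0; lia).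
assert (E : f (INR i / INR (S k)) * f (INR i / INR (S k)) = 0).
{ apply (RInt_zero_cont (fun x => f x * f x) 0 1); auto. lra. intros; apply cont_mult; eapply polyR_cont; eauto.
  intros; apply Rle_0_sqr. split. apply Rmult_le_pos. apply pos_INR. left; now apply Rinv_0_lt_compat.
  apply Rmult_le_reg_r with (INR (S k)); auto. unfold Rdiv. rewrite Rmult_assoc, Rinv_l, Rmult_1_l, Rmult_1_r by lra.
  apply le_INR; lia. }
nra.
Qed.

Lemma polyR_bilin k : bilin (polyR k) ip.
Proof.
split; [|split; [|split]].
- intros f g h a b Hf Hg Hh. apply (polyR_PC 1) in Hf, Hg, Hh.
  rewrite (ip_plus_l 1), !(ip_scal_l 1); auto; now apply PC_scal.
- intros; apply ip_sym.
- intros f Hf. apply (ip_pos 1); auto. eapply polyR_PC; eauto.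
- intros; eapply polyR_ip_def; eauto.
Qed.

Lemma polyR_basis k : exists n phi, (forall j, polyR k (phi j)) /\ orthonormal ip n phi /\
   forall f, polyR k f -> forall x, f x = Sum (fun j => ip f (phi j) * phi j x) n.
Proof.
destruct (orthonormal_basis ip (fun j => INR j / INR (S k)) (S k) _ (polyR_subsp k) (polyR_bilin k)) as (n & phi & al & HV & Ho & H).
{ intros; eapply polyR_unisolvent; eauto. }
exists n, phi. split; [|split]; auto. intros f Hf; apply (H f Hf).
Qed.

Lemma Sum_bound (phi : nat -> R -> R) a b n : a <= b -> (forall j, (j < n)%nat -> forall x, continuous (phi j) x) ->
  exists C, 0 <= C /\ forall c D, 0 <= D -> (forall j, (j < n)%nat -> Rabs (c j) <= D) ->
    forall x, a <= x <= b -> Rabs (Sum (fun j => c j * phi j x) n) <= C * D.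
Proof.
intros Hab. induction n; intros H.
- exists 0; split; [lra|]. intros; simpl. rewrite Rabs_R0; lra.
- destruct IHn as (C & HC & IH); [intros; apply H; lia|].
  destruct (cont_bounded (phi n) a b Hab (H n (le_n _))) as (B & HB & Hb).
  exists (C + B); split; [lra|]. intros c D HD Hc x Hx. simpl.
  eapply Rle_trans; [apply Rabs_triang|]. rewrite Rabs_mult.
  specialize (IH c D HD (fun j Hj => Hc j (Nat.lt_lt_succ_r _ _ Hj)) x Hx). specialize (Hc n (le_n _)). specialize (Hb x Hx).
  pose proof (Rabs_pos (phi n x)). nra.
Qed.

Lemma L2_orthonormal n phi j : orthonormal ip n phi -> (j < n)%nat -> L2norm (phi j) = 1.
Proof. intros H Hj. unfold L2norm. rewrite H; auto. destruct (Nat.eq_dec j j); [apply sqrt_1|lia]. Qed.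

(** Equivalence of norms in finite dimension: coordinates in an orthonormal basis are bounded by the
    L^2 norm, and the basis functions and their derivatives are bounded on [0,1]. *)
Lemma poly_inverse_ref k : exists C, 0 <= C /\ forall p, polyR k p -> forall x, 0 <= x <= 1 ->
  Rabs (p x) <= C * L2norm p /\ Rabs (Derive p x) <= C * L2norm p.
Proof.
destruct (polyR_basis k) as (n & phi & Hphi & Ho & Hrep).
destruct (Sum_bound phi 0 1 n) as (C & HC & Hb); [lra|intros; eapply polyR_cont; eauto|].
destruct (Sum_bound (fun j => Derive (phi j)) 0 1 n) as (C' & HC' & Hb'); [lra|intros; eapply polyR_cont; apply polyR_Derive; eauto|].
exists (C + C'); split; [lra|]. intros p Hp x Hx.
pose proof (L2_pos p).
assert (Hc : forall j, (j < n)%nat -> Rabs (ip p (phi j)) <= L2norm p).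
{ intros j Hj. pose proof (ip_CS 1 p (phi j) (le_n _) (polyR_PC _ _ _ Hp) (polyR_PC _ _ _ (Hphi j))) as E.
  rewrite (L2_orthonormal n) in E; auto. lra. }
specialize (Hb (fun j => ip p (phi j)) (L2norm p) (L2_pos p) Hc x Hx).
specialize (Hb' (fun j => ip p (phi j)) (L2norm p) (L2_pos p) Hc x Hx).
rewrite <- (Hrep p Hp) in Hb. split; [nra|].
replace (Derive p x) with (Sum (fun j => ip p (phi j) * Derive (phi j) x) n). nra.
symmetry. rewrite (Derive_ext _ _ x (Hrep p Hp)). apply is_derive_unique.
assert (G : forall c m, is_derive (fun x => Sum (fun j => c j * phi j x) m) x (Sum (fun j => c j * Derive (phi j) x) m)).
{ intros c m; induction m; simpl. apply @is_derive_const.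
  apply (is_derive_plusR (fun x => Sum (fun j => c j * phi j x) m) (fun x => c m * phi m x)); auto.
  apply is_derive_scal. apply (polyR_Derive k); auto. }
apply G.
Qed.

Lemma RInt_el_ref N i (f : R -> R) : (1 <= N)%nat -> (forall x, continuous f x) ->
  RInt (fun s => f (/ INR N * s + node N i)) 0 1 = INR N * RInt f (node N i) (node N (i+1)).
Proof.
intros HN Hf. pose proof (INR_gt0 N HN).
pose proof (RInt_comp_lin f (/ INR N) (node N i) 0 1 (ex_RInt_cont f _ _ Hf)) as E.
rewrite Rmult_0_r, Rplus_0_l, Rmult_1_r, (Rplus_comm _ (node N i)), <- node_S in E by auto.
rewrite <- E. change (fun y : R => scal (/ INR N) (f (/ INR N * y + node N i))) with (fun y : R => / INR N * (f (/ INR N * y + node N i))).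
rewrite RInt_scalR. rewrite <- Rmult_assoc, Rinv_r, Rmult_1_l by lra. reflexivity.
apply ex_RInt_cont. intros x. apply (continuous_comp (fun s => / INR N * s + node N i) f).
apply ex_derive_cont. auto_derive; auto. apply Hf.
Qed.

Lemma L2norm_sq_cont f : (forall x, continuous f x) -> L2norm f * L2norm f = RInt (fun x => f x * f x) 0 1.
Proof. intros H. rewrite (L2_sq 1); [reflexivity|auto|now apply PC_cont]. Qed.

Lemma Rabs_le_sq a b : Rabs a <= b -> a * a <= b * b.
Proof. intros H. pose proof (Rabs_pos a). rewrite <- (Rabs_right (a*a)), Rabs_mult by apply Rle_ge, Rle_0_sqr. nra. Qed.

(** Scaling x = h s + x_i from the reference interval: the integral of the square contributes a
    factor N and the squared derivative two more. The squared form avoids square roots of N. *)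
Lemma poly_inverse_el k : exists C, 0 <= C /\ forall N i f, (1 <= N)%nat -> polyR k f -> forall x, node N i <= x <= node N (i+1) ->
  f x * f x <= C * INR N * RInt (fun x => f x * f x) (node N i) (node N (i+1)) /\
  Derive f x * Derive f x <= C * INR N ^ 3 * RInt (fun x => f x * f x) (node N i) (node N (i+1)).
Proof.
destruct (poly_inverse_ref k) as (C & HC & H). exists (C * C); split; [nra|]. intros N i f HN Hf x Hx.
pose proof (INR_gt0 N HN) as Hp. assert (Hn : INR N <> 0) by lra.
set (p := fun s => f (/ INR N * s + node N i)).
assert (Pp : polyR k p) by now apply polyR_aff.
assert (Ep : L2norm p * L2norm p = INR N * RInt (fun x => f x * f x) (node N i) (node N (i+1))).
{ rewrite L2norm_sq_cont by (intros; eapply polyR_cont; eauto).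
  apply (RInt_el_ref N i (fun x => f x * f x)); auto. intros; apply cont_mult; eapply polyR_cont; eauto. }
set (s := INR N * (x - node N i)).
rewrite node_S in Hx by auto.
assert (Hs : 0 <= s <= 1).
{ unfold s. split. nra. replace 1 with (INR N * / INR N) by now field. apply Rmult_le_compat_l; lra. }
assert (Ex : / INR N * s + node N i = x) by (unfold s; now field).
destruct (H p Pp s Hs) as [H1 H2]. apply Rabs_le_sq in H1, H2.
split.
- unfold p in H1 at 1 2. rewrite Ex in H1. nra.
- assert (D : Derive p s = / INR N * Derive f x).
  { apply is_derive_unique.
    pose proof (@is_derive_comp R_AbsRing R_NormedModule f (fun s => / INR N * s + node N i) s (Derive f x) (/ INR N)) as D.
    apply D. rewrite Ex. apply (polyR_Derive k); auto. auto_derive; auto. ring. }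
  rewrite D in H2. replace (Derive f x * Derive f x) with (INR N * INR N * (/ INR N * Derive f x * (/ INR N * Derive f x))) by now field.
  replace (C * C * INR N ^ 3 * RInt (fun x0 : R => f x0 * f x0) (node N i) (node N (i + 1))) with
   (INR N * INR N * (C * C * (INR N * RInt (fun x0 : R => f x0 * f x0) (node N i) (node N (i + 1))))) by ring.
  rewrite <- Ep. apply Rmult_le_compat_l; nra.
Qed.

Lemma RInt_el_ext N i (f g : R -> R) : (1 <= N)%nat -> (forall x, node N i < x < node N (i+1) -> f x = g x) ->
  RInt f (node N i) (node N (i+1)) = RInt g (node N i) (node N (i+1)).
Proof. intros HN H. apply RInt_ext. pose proof (node_lt N i HN). rewrite Rmin_left, Rmax_right by lra. auto. Qed.

Lemma ip_self_el_le N f i : (1 <= N)%nat -> PC N f -> (i < N)%nat -> RInt (fun x => f x * f x) (node N i) (node N (i+1)) <= ip f f.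
Proof.
intros HN Hf Hi. assert (PC N (fun x => f x * f x)) by now apply PC_mult.
unfold ip. rewrite (RInt_elements N); auto.
apply (Sum_term_le (fun i => RInt (fun x => f x * f x) (node N i) (node N (i+1)))); auto.
intros j Hj. apply RInt_ge_0R. left; now apply node_lt. now apply (PC_ex_el N). intros; apply Rle_0_sqr.
Qed.

(** The pointwise bound would hold with the square root of N; the cruder N suffices because it is
    applied to quantities with at least one power of h to spare. The constant C + 1 comes from C <=
    (C + 1)^2. *)
Lemma inverse_ineq k : exists C, 0 <= C /\ forall N f, (1 <= N)%nat -> Vh N k f ->
  L2norm (dx f) <= C * INR N * L2norm f /\ forall x, 0 <= x <= 1 -> Rabs (f x) <= C * INR N * L2norm f.
Proof.
destruct (poly_inverse_el k) as (C & HC & H). exists (C + 1); split; [nra|]. intros N f HN Hf.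
pose proof (L2_pos f).
assert (Hp1 : 1 <= INR N) by (apply (le_INR 1); auto).
pose proof (Vh_PC _ _ _ Hf) as HfP. pose proof (Vh_dxPC _ _ _ HN Hf) as HdP.
assert (Hnn : 0 <= (C + 1) * INR N * L2norm f) by (apply Rmult_le_pos; nra).
assert (HC2 : C <= (C+1)*(C+1)) by nra.
split.
- apply (L2_le_sq N); auto.
  replace ((C + 1) * INR N * L2norm f * ((C + 1) * INR N * L2norm f)) with ((C+1)*(C+1) * INR N ^ 2 * (L2norm f * L2norm f)) by ring.
  rewrite (L2_sq N) by auto. apply Rle_trans with (C * INR N ^ 2 * ip f f).
  2:{ apply Rmult_le_compat_r. now apply (ip_pos N). apply Rmult_le_compat_r; auto. apply pow_le; lra. }
  unfold ip. rewrite !(RInt_elements N) by (auto; now apply PC_mult). rewrite <- Sum_scal.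
  apply Sum_le. intros i Hi.
  destruct (Vh_dx_el N k f i HN Hf Hi) as (p & p' & Pp & Pp' & D & E & E').
  rewrite (RInt_el_ext N i (fun x => f x * f x) (fun x => p x * p x)); auto.
  2:{ intros; rewrite E; auto; lra. }
  pose proof (node_lt N i HN).
  set (J := RInt (fun x => p x * p x) (node N i) (node N (i+1))) in *.
  apply Rle_trans with (RInt (fun _ => C * INR N ^ 3 * J) (node N i) (node N (i+1))).
  + apply RInt_le. lra. apply (PC_ex_el N); auto. now apply PC_mult. apply ex_RInt_const.
    intros x Hx. rewrite E' by auto. rewrite <- (is_derive_unique _ _ _ (D x)). apply H; auto. lra.
  + rewrite RInt_const. rewrite node_S by auto. unfold scal; simpl; unfold mult; simpl. right. field; lra.
- intros x Hx. destruct (find_el_closed N x HN Hx) as (i & Hi & Hxi). apply le_of_sq; auto.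
  replace ((C + 1) * INR N * L2norm f * ((C + 1) * INR N * L2norm f)) with ((C+1)*(C+1) * (INR N * INR N) * (L2norm f * L2norm f)) by ring.
  rewrite (L2_sq N) by auto. rewrite <- Rabs_mult, Rabs_right by apply Rle_ge, Rle_0_sqr.
  destruct (Vh_el N k f i Hf Hi) as (p & Pp & E).
  destruct (H N i p HN Pp x Hxi) as [H1 _]. rewrite E by auto. eapply Rle_trans; [apply H1|].
  rewrite (RInt_el_ext N i (fun x => p x * p x) (fun x => f x * f x)); auto.
  2:{ intros; rewrite E; auto; lra. }
  pose proof (ip_self_el_le N f i HN HfP Hi). pose proof (ip_pos N f HN HfP).
  apply Rle_trans with (C * INR N * ip f f). apply Rmult_le_compat_l; nra.
  apply Rmult_le_compat_r; auto. apply Rmult_le_compat; nra.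
Qed.

(** For even n the leading terms of (1 - x)^n and x^n cancel. The induction splits the difference at
    n + 2 into (1 - x)^2 times the one at n plus ((1 - x)^2 - x^2) x^n, where the last bracket is 1
    - 2 x. *)
Lemma pow_reflect_diff m : polyR (2 * m + 1) (fun x => (1 - x) ^ (2 * m + 2) - x ^ (2 * m + 2)).
Proof.
induction m.
- simpl. apply polyR_ext with (fun x => ((-2) * x + 1) * 1). intros; ring. apply polyR_mul_aff, polyR_0.
- replace (2 * S m + 1)%nat with (S (S (2 * m + 1))) by lia.
  replace (2 * S m + 2)%nat with (S (S (2 * m + 2))) by lia.
  apply polyR_ext with (fun x => ((-1) * x + 1) * (((-1) * x + 1) * ((1 - x) ^ (2 * m + 2) - x ^ (2 * m + 2)))
    + ((-2) * x + 1) * x ^ (2 * m + 2)).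
  { intros x; simpl; ring. }
  apply polyR_plus. now do 2 apply polyR_mul_aff.
  apply polyR_mul_aff. replace (S (2*m+1)) with (2*m+2)%nat by lia. apply polyR_pow.
Qed.

(* The monic Legendre polynomial of degree k+1 on [0,1]; as k+1 is even it is symmetric about 1/2, so its end values agree. *)
Lemma legendre kappa : let k := (2 * kappa + 1)%nat in exists Q0, polyR k Q0 /\
  (forall p, polyR k p -> ip (fun x => x ^ S k + Q0 x) p = 0) /\ Q0 0 = 1 + Q0 1.
Proof.
intros k. destruct (polyR_basis k) as (n & phi & Hphi & Ho & Hrep).
set (f := fun x : R => x ^ S k).
set (Q0 := fun x => (-1) * Sum (fun j => ip f (phi j) * phi j x) n).
assert (P0 : polyR k Q0).
{ apply polyR_scal. apply (polyR_Sum k (fun j x => ip f (phi j) * phi j x)). intros; now apply polyR_scal. }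
assert (Pf : polyR (S k) f) by apply polyR_pow.
assert (PCf : PC 1 f) by (eapply polyR_PC; eauto).
assert (PC0 : PC 1 Q0) by (eapply polyR_PC; eauto).
assert (Or : forall p, polyR k p -> ip (fun x => f x + Q0 x) p = 0).
{ intros p Hp. assert (PCp : PC 1 p) by (eapply polyR_PC; eauto).
  rewrite (ip_plus_l 1); auto. unfold Q0. rewrite (ip_scal_l 1), (ip_Sum_l 1); auto.
  2:{ intros; eapply polyR_PC; eauto. }
  2:{ apply (PC_Sum 1 (fun j x => ip f (phi j) * phi j x)). intros; apply PC_scal. eapply polyR_PC; eauto. }
  rewrite (fun_ext p _ (Hrep p Hp)) at 1. rewrite (ip_sym f), (ip_Sum_l 1); auto.
  2:{ intros; eapply polyR_PC; eauto. }
  rewrite (Sum_ext _ (fun j => ip f (phi j) * ip (phi j) p)). ring.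
  intros; rewrite (ip_sym p), (ip_sym _ f). ring. }
exists Q0; split; [|split]; auto.
set (Q := fun x => f x + Q0 x) in *.
assert (PQ : polyR (S k) Q) by (apply polyR_plus; auto; now apply polyR_S).
(* [D] has degree at most k because k + 1 is even, and it is a difference of two functions
   orthogonal to degree k. So it is orthogonal to itself and vanishes; evaluation at 0 gives Q(1) =
   Q(0). *)
set (D := fun x => Q (1 - x) - Q x).
assert (PD : polyR k D).
{ apply polyR_ext with (fun x => ((1 - x)^(2*kappa+2) - x^(2*kappa+2)) + (Q0 ((-1) * x + 1) - Q0 x)).
  - intros x. unfold D, Q, f. replace (2*kappa+2)%nat with (S k) by (unfold k; lia).
    replace (-1*x+1) with (1-x) by ring. ring.
  - apply polyR_plus. apply pow_reflect_diff. apply polyR_minus; auto. now apply polyR_aff. }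
assert (HR : forall p, polyR k p -> ip (fun x => Q (1 - x)) p = 0).
{ intros p Hp. set (g := fun x => Q x * p ((-1) * x + 1)).
  assert (Cg : forall x, continuous g x).
  { intros; apply cont_mult. eapply polyR_cont; eauto. eapply polyR_cont; apply polyR_aff; eauto. }
  pose proof (RInt_comp_lin g (-1) 1 0 1 (ex_RInt_cont g _ _ Cg)) as E.
  replace (-1 * 0 + 1) with 1 in E by ring. replace (-1 * 1 + 1) with 0 in E by ring.
  pose proof (RInt_ChaslesR g 0 1 0 (ex_RInt_cont g _ _ Cg) (ex_RInt_cont g _ _ Cg)) as E1.
  assert (E2 : RInt g 0 1 = 0) by (apply (Or (fun x => p (-1*x+1))); now apply polyR_aff).
  change (fun y : R => scal (-1) (g (-1*y+1))) with (fun y : R => (-1) * (g (-1*y+1))) in E.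
  rewrite RInt_scalR in E.
  2:{ apply ex_RInt_cont. intros x. apply (continuous_comp (fun y => -1*y+1) g). apply ex_derive_cont; auto_derive; auto. apply Cg. }
  assert (E0 : RInt g 0 0 = 0) by (apply (RInt_point 0 g)).
  unfold ip. rewrite (RInt_ext _ (fun y => g (-1*y+1))). lra.
  intros x _. unfold g. replace (-1*x+1) with (1-x) by ring. replace (-1*(1-x)+1) with x by ring. reflexivity. }
assert (ED : ip D D = 0).
{ assert (PC 1 D) by (eapply polyR_PC; eauto). unfold D at 1. rewrite (ip_minus_l 1); auto.
  rewrite HR, (Or D); auto; ring.
  apply PC_cont. intros x. apply continuous_ext with (fun x => Q (-1*x+1)). intros; f_equal; ring. eapply polyR_cont, polyR_aff; eauto.
  eapply polyR_PC; eauto. }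
pose proof (polyR_ip_def k D PD ED 0) as E. unfold D, Q, f in E. simpl in E.
rewrite Rminus_0_r, pow1 in E. lra.
Qed.

(** * Approximation by continuous piecewise polynomials *)

Lemma Int_part_eq z r : IZR z <= r < IZR z + 1 -> Int_part r = z.
Proof.
intros H. pose proof (base_Int_part r) as [H1 H2].
assert (IZR (Int_part r) < IZR (z + 1)) by (rewrite plus_IZR; lra).
assert (IZR z < IZR (Int_part r + 1)) by (rewrite plus_IZR; lra).
apply lt_IZR in H0, H3. lia.
Qed.

Lemma node_IZR N i : node N i = IZR (Z.of_nat i) / INR N.
Proof. unfold node; now rewrite INR_IZR_INZ. Qed.

(** A local polynomial plus the linear interpolant of its nodal discrepancies, so that it takes the
    values [Vn] at both ends of element [z]. Integer indices cover the whole line and turn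
    periodicity into a shift of [z] by N. *)
Definition nodal_fix N (base : Z -> R -> R) (Vn : Z -> R) (z : Z) (x : R) : R :=
  base z x + (Vn z - base z (IZR z / INR N)) * (IZR z + 1 - INR N * x)
  + (Vn (z + 1)%Z - base z (IZR (z + 1) / INR N)) * (INR N * x - IZR z).

(** Adding a linear function per element makes any 1-periodic family of local polynomials continuous
    with prescribed nodal values; linear functions being admissible is where k >= 1 enters. *)
Lemma glue N k base Vn : (1 <= N)%nat -> (1 <= k)%nat -> (forall z, polyR k (base z)) ->
  (forall z x, base (z + Z.of_nat N)%Z (x + 1) = base z x) -> (forall z, Vn (z + Z.of_nat N)%Z = Vn z) ->
  exists w, Vh N k w /\ forall z x, IZR z / INR N <= x <= IZR (z + 1) / INR N -> w x = nodal_fix N base Vn z x.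
Proof.
intros HN Hk Pb Pe Pv. pose proof (INR_gt0 N HN) as Hp. assert (Hn : INR N <> 0) by lra.
set (W := nodal_fix N base Vn).
assert (PW : forall z, polyR k (W z)).
{ intros z. apply polyR_plus. apply polyR_plus; auto.
  - apply polyR_scal. apply polyR_le with 1%nat; auto.
    apply polyR_ext with (fun x => (- INR N * x + (IZR z + 1)) * 1). intros; ring. apply polyR_mul_aff, polyR_0.
  - apply polyR_scal. apply polyR_le with 1%nat; auto.
    apply polyR_ext with (fun x => (INR N * x + (- IZR z)) * 1). intros; ring. apply polyR_mul_aff, polyR_0. }
assert (Wl : forall z, W z (IZR z / INR N) = Vn z).
{ intros z. unfold W, nodal_fix. replace (INR N * (IZR z / INR N)) with (IZR z) by now field. ring. }
assert (Wr : forall z, W z (IZR (z+1) / INR N) = Vn (z+1)%Z).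
{ intros z. unfold W, nodal_fix. replace (INR N * (IZR (z+1) / INR N)) with (IZR (z+1)) by now field.
  rewrite plus_IZR. ring. }
(* The integer part selects the element to the right at a node; by [Wl] and [Wr] the left neighbour
   gives the same value there, hence [Ew] on closed elements. *)
set (w := fun x => W (Int_part (INR N * x)) x).
assert (Ew : forall z x, IZR z / INR N <= x <= IZR (z + 1) / INR N -> w x = W z x).
{ intros z x [H1 H2]. unfold w.
  assert (H1' : IZR z <= INR N * x).
  { replace (IZR z) with (INR N * (IZR z / INR N)) by now field. apply Rmult_le_compat_l; lra. }
  destruct (Req_dec x (IZR (z + 1) / INR N)) as [->|Hne].
  - rewrite Wr. replace (INR N * (IZR (z+1) / INR N)) with (IZR (z+1)) by now field.
    rewrite (Int_part_eq (z+1)) by lra. apply Wl.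
  - assert (H2' : INR N * x < IZR z + 1).
    { rewrite <- plus_IZR. replace (IZR (z+1)) with (INR N * (IZR (z+1) / INR N)) by now field. apply Rmult_lt_compat_l; lra. }
    now rewrite (Int_part_eq z). }
exists w; split; auto. split; [split|].
- cut (forall x : R, continuous w x); [auto|]. intros x. set (z := Int_part (INR N * x)). pose proof (base_Int_part (INR N * x)) as [B1 B2]. fold z in B1, B2.
  (* At a node the continuity of the two adjacent polynomials is combined; elsewhere [w] is locally
     a single polynomial. *)
  destruct (Req_dec (IZR z) (INR N * x)) as [E|E].
  + assert (Ex : x = IZR z / INR N) by (rewrite E; now field).
    assert (C1 := polyR_cont k (W z) x (PW z)). assert (C2 := polyR_cont k (W (z-1)%Z) x (PW _)).
    assert (E1 : W z x = w x) by reflexivity.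
    assert (E2 : W (z-1)%Z x = w x).
    { rewrite <- E1, Ex, Wl. replace (IZR z) with (IZR (z-1+1)) by (f_equal; lia). rewrite Wr. f_equal; lia. }
    unfold continuous in *. rewrite E1 in C1. rewrite E2 in C2.
    intros P HP. specialize (C1 P HP). specialize (C2 P HP). unfold filtermap in *.
    assert (Hd : 0 < / INR N) by now apply Rinv_0_lt_compat.
    assert (L : locally x (fun y => Rabs (y - x) < / INR N)) by (exists (mkposreal _ Hd); intros y Hy; exact Hy).
    generalize (filter_and _ _ L (filter_and _ _ C1 C2)). apply filter_imp. intros y (Hy & Q1 & Q2).
    apply Rabs_def2 in Hy. destruct (Rle_lt_dec x y).
    * rewrite (Ew z); auto. rewrite <- Ex, plus_IZR. unfold Rdiv. rewrite Rmult_plus_distr_r. fold (IZR z / INR N). lra.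
    * rewrite (Ew (z-1)%Z); auto. replace (IZR (z-1+1)) with (IZR z) by (f_equal; lia).
      rewrite <- Ex, minus_IZR. unfold Rdiv. rewrite Rmult_minus_distr_r. fold (IZR z / INR N). lra.
  + apply continuous_ext_loc with (W z). 2: eapply polyR_cont; eauto.
    assert (L : locally x (fun y => IZR z < INR N * y /\ INR N * y < IZR z + 1)).
    { assert (C : continuous (fun y => INR N * y) x) by (apply ex_derive_cont; auto_derive; auto).
      apply filter_and; [apply (C (fun y => IZR z < y)), open_gt|apply (C (fun y => y < IZR z + 1)), open_lt]; lra. }
    revert L; apply filter_imp. intros y [? ?]. unfold w. now rewrite (Int_part_eq z) by lra.
- intros x. unfold w.
  assert (EZ : Int_part (INR N * (x + 1)) = (Int_part (INR N * x) + Z.of_nat N)%Z).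
  { apply Int_part_eq. rewrite plus_IZR, <- INR_IZR_INZ. pose proof (base_Int_part (INR N * x)). lra. }
  rewrite EZ. set (z := Int_part (INR N * x)). unfold W, nodal_fix.
  replace (z + Z.of_nat N + 1)%Z with ((z+1) + Z.of_nat N)%Z by lia.
  rewrite Pe, !Pv, !(plus_IZR _ (Z.of_nat N)), <- !INR_IZR_INZ.
  replace ((IZR z + INR N) / INR N) with (IZR z / INR N + 1) by now field.
  replace ((IZR (z + 1) + INR N) / INR N) with (IZR (z + 1) / INR N + 1) by now field.
  rewrite !Pe. ring.
- intros i Hi. apply poly_on_iff. exists (W (Z.of_nat i)). split; auto.
  intros x Hx. apply Ew. replace (IZR (Z.of_nat i + 1)) with (INR (i+1)). now rewrite <- INR_IZR_INZ.
  rewrite INR_IZR_INZ. f_equal; lia.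
Qed.

(** * Functions with bounded derivatives and their Taylor polynomials *)

Lemma Derive_n_S v n x : Derive_n (Derive v) n x = Derive_n v (S n) x.
Proof. transitivity (Derive_n (Derive_n v 1) n x); [reflexivity|]. rewrite Derive_n_comp. f_equal; lia. Qed.

Lemma ex_derive_n_Derive v m : (forall j, (j <= S m)%nat -> forall x, ex_derive_n v j x) ->
  forall j, (j <= m)%nat -> forall x, ex_derive_n (Derive v) j x.
Proof.
intros H [|j] Hj x; simpl; auto. apply ex_derive_ext with (Derive_n v (S j)).
intros t; symmetry; apply Derive_n_S. apply (H (S (S j))); lia.
Qed.

(** One bound for all derivatives up to order m, uniform on the line: this shape is stable under
    sums and products with explicit constants, and permits induction on m through [Derive]. *)
Definition Cm_bd (m : nat) (B : R) (f : R -> R) : Prop :=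
  forall j, (j <= m)%nat -> forall x, ex_derive_n f j x /\ Rabs (Derive_n f j x) <= B.

Lemma Cm_bd_S m B f : Cm_bd (S m) B f <-> (forall x, Rabs (f x) <= B) /\ (forall x, ex_derive f x) /\ Cm_bd m B (Derive f).
Proof.
split.
- intros H. split; [|split].
  + intros x. apply (H O); lia.
  + intros x. apply (H 1%nat); lia.
  + intros j Hj x. rewrite Derive_n_S. split.
    * apply (ex_derive_n_Derive f m); auto. intros i Hi y; apply H; auto.
    * apply H; lia.
- intros (H0 & Hd & H) [|j] Hj x.
  + split; [simpl; auto|]. apply H0.
  + destruct (H j ltac:(lia) x) as [H1 H2]. rewrite Derive_n_S in H2. split; auto.
    destruct j; [simpl; auto|]. simpl in H1. apply ex_derive_ext with (Derive_n (Derive f) j); auto.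
    intros; apply Derive_n_S.
Qed.

Lemma Cm_bd_0 B f : Cm_bd 0 B f <-> forall x, Rabs (f x) <= B.
Proof. split. intros H x; apply (H O); lia. intros H j Hj x. replace j with O by lia. simpl; auto. Qed.

Lemma Cm_bd_le m n A B f : (m <= n)%nat -> A <= B -> Cm_bd n A f -> Cm_bd m B f.
Proof. intros Hm HA H j Hj x. destruct (H j ltac:(lia) x). split; auto; lra. Qed.

Lemma Cm_bd_plus m : forall A B f g, Cm_bd m A f -> Cm_bd m B g -> Cm_bd m (A + B) (fun x => f x + g x).
Proof.
induction m; intros A B f g Hf Hg.
- rewrite Cm_bd_0 in *. intros x. eapply Rle_trans; [apply Rabs_triang|]. specialize (Hf x); specialize (Hg x); lra.
- rewrite Cm_bd_S in *. destruct Hf as (F0 & Fd & F), Hg as (G0 & Gd & G). split; [|split].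
  + intros x. eapply Rle_trans; [apply Rabs_triang|]. specialize (F0 x); specialize (G0 x); lra.
  + intros x. apply (@ex_derive_plus R_AbsRing R_NormedModule f g); auto.
  + rewrite (fun_ext (Derive _) (fun x => Derive f x + Derive g x)). auto.
    intros; apply Derive_plus; auto.
Qed.

Lemma Cm_bd_scal m c : forall A f, Cm_bd m A f -> Cm_bd m (Rabs c * A) (fun x => c * f x).
Proof.
induction m; intros A f Hf.
- rewrite Cm_bd_0 in *. intros x. rewrite Rabs_mult. apply Rmult_le_compat_l; auto. apply Rabs_pos.
- rewrite Cm_bd_S in *. destruct Hf as (F0 & Fd & F). split; [|split].
  + intros x. rewrite Rabs_mult. apply Rmult_le_compat_l; auto. apply Rabs_pos.
  + intros x. apply (ex_derive_scal f); auto.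
  + rewrite (fun_ext (Derive _) (fun x => c * Derive f x)). auto.
    intros; apply Derive_scal; auto.
Qed.

(** Leibniz's rule by induction: (f g)' has two terms, each covered by the bound at order m, so the
    constant doubles at every step. *)
Lemma Cm_bd_mult m : forall A B f g, Cm_bd m A f -> Cm_bd m B g -> Cm_bd m (2 ^ m * (A * B)) (fun x => f x * g x).
Proof.
induction m; intros A B f g Hf Hg.
- rewrite Cm_bd_0 in *. intros x. rewrite Rabs_mult. simpl. rewrite Rmult_1_l. apply Rmult_le_compat; auto; apply Rabs_pos.
- assert (Hf' : Cm_bd m A f) by (apply (Cm_bd_le m (S m) A); auto; lra).
  assert (Hg' : Cm_bd m B g) by (apply (Cm_bd_le m (S m) B); auto; lra).
  rewrite Cm_bd_S in *. destruct Hf as (F0 & Fd & F), Hg as (G0 & Gd & G). split; [|split].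
  + intros x. rewrite Rabs_mult. pose proof (Rabs_pos (f x)). pose proof (Rabs_pos (g x)).
    assert (1 <= 2 ^ S m) by (apply pow_R1_Rle; lra). assert (Rabs (f x) * Rabs (g x) <= A * B) by (apply Rmult_le_compat; auto). assert (0 <= Rabs (f x) * Rabs (g x)) by (apply Rmult_le_pos; auto). set (q := A * B) in *. set (p := 2 ^ S m) in *. clearbody p q. nra.
  + intros x. apply (ex_derive_mult f g); auto.
  + rewrite (fun_ext (Derive _) (fun x => Derive f x * g x + f x * Derive g x)) by (intros; apply Derive_mult; auto).
    replace (2 ^ S m * (A * B)) with (2 ^ m * (A * B) + 2 ^ m * (A * B)) by (simpl; ring).
    apply Cm_bd_plus; auto.
Qed.

Lemma Cm_bd_minus m A B f g : Cm_bd m A f -> Cm_bd m B g -> Cm_bd m (A + B) (fun x => f x - g x).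
Proof.
intros Hf Hg. pose proof (Cm_bd_plus m _ _ _ _ Hf (Cm_bd_scal m (-1) _ _ Hg)) as E.
apply (Cm_bd_le m m (A + Rabs (-1) * B)); auto. rewrite Rabs_left by lra. lra.
erewrite fun_ext; [exact E|]. intros x; simpl; ring.
Qed.

Definition per_Cm (m : nat) (M : R) (v : R -> R) : Prop := (forall x, v (x + 1) = v x) /\ Cm_bd m M v.

Definition taylor (v : R -> R) (n : nat) (a x : R) : R :=
  Sum (fun m => Derive_n v m a * ((x - a) ^ m / INR (Factorial.fact m))) (S n).

Lemma Derive_n_per (v : R -> R) n x : (forall x, v (x + 1) = v x) -> Derive_n v n (x + 1) = Derive_n v n x.
Proof. intros H. rewrite <- Derive_n_comp_trans. apply Derive_n_ext; auto. Qed.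

Lemma taylor_poly v n a : polyR n (taylor v n a).
Proof.
apply (polyR_Sum n (fun m x => Derive_n v m a * ((x - a) ^ m / INR (Factorial.fact m)))).
intros j Hj. apply polyR_scal. apply (polyR_le j); [lia|].
apply polyR_ext with (fun x => / INR (Factorial.fact j) * (1 * x + (- a))^j).
intros x. unfold Rdiv. rewrite Rmult_comm. do 2 f_equal; ring. apply polyR_scal, polyR_pow_aff.
Qed.

Lemma fact_ge1 n : 1 <= INR (Factorial.fact n).
Proof. apply (le_INR 1). apply Factorial.lt_O_fact. Qed.

Lemma taylor_rem v n a h M x : 0 <= M -> (forall j, (j <= S n)%nat -> forall x, ex_derive_n v j x) ->
  (forall y, Rabs (Derive_n v (S n) y) <= M) -> a <= x <= a + h ->
  Rabs (v x - taylor v n a x) <= M * h ^ (S n).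
Proof.
intros HM Hv Hb Hx. destruct (Req_dec x a) as [->|Hne].
- unfold taylor. rewrite Sum_head, (Sum_ext _ (fun _ => 0)), Sum_const.
  2:{ intros; simpl. rewrite Rminus_diag, Rmult_0_l. unfold Rdiv; ring. }
  simpl Derive_n. simpl Factorial.fact. simpl INR. rewrite pow_O. replace (v a - (v a * (1/1) + INR n * 0)) with 0 by field.
  rewrite Rabs_R0. apply Rmult_le_pos; auto. apply pow_le; lra.
- destruct (Taylor_Lagrange v n a x) as (z & Hz & E). lra. intros; now apply Hv.
  rewrite E, sum_f_R0_Sum. unfold taylor.
  rewrite (Sum_ext _ (fun m => Derive_n v m a * ((x - a) ^ m / INR (Factorial.fact m)))) by (intros; ring).
  match goal with |- Rabs ?A <= _ => replace A with ((x - a) ^ S n / INR (Factorial.fact (S n)) * Derive_n v (S n) z) by ring end.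
  rewrite Rabs_mult, Rmult_comm. pose proof (fact_ge1 (S n)).
  assert (0 <= (x - a)^S n <= h ^ S n) by (split; [apply pow_le; lra|apply pow_incr; lra]).
  apply Rmult_le_compat; auto; try apply Rabs_pos.
  unfold Rdiv. rewrite Rabs_mult, (Rabs_right ((x-a)^S n)) by lra.
  assert (0 < / INR (Factorial.fact (S n)) <= 1).
  { split. apply Rinv_0_lt_compat; lra. rewrite <- Rinv_1. apply Rinv_le_contravar; lra. }
  rewrite Rabs_right by lra. nra.
Qed.

(** Makes the derivative error of a Taylor polynomial a Taylor remainder of [Derive v]. *)
Lemma taylor_derive v n a x : is_derive (taylor v (S n) a) x (taylor (Derive v) n a x).
Proof.
induction n.
- unfold taylor; simpl. auto_derive; auto. change (Derive (fun x0 : R => v x0) a) with (Derive v a). field.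
- unfold taylor in *.
  apply (is_derive_ext (fun x => Sum (fun m => Derive_n v m a * ((x - a) ^ m / INR (Factorial.fact m))) (S (S n))
    + Derive_n v (S (S n)) a * ((x - a) ^ (S (S n)) / INR (Factorial.fact (S (S n)))))). reflexivity.
  change (Sum (fun m => Derive_n (Derive v) m a * ((x - a) ^ m / INR (Factorial.fact m))) (S (S n))) with
   (Sum (fun m => Derive_n (Derive v) m a * ((x - a) ^ m / INR (Factorial.fact m))) (S n) +
    Derive_n (Derive v) (S n) a * ((x - a) ^ (S n) / INR (Factorial.fact (S n)))).
  apply is_derive_plusR; auto.
  rewrite (Derive_n_S v (S n)).
  apply is_derive_scal.
  pose proof (fact_ge1 (S n)). pose proof (pos_INR n).
  change (Factorial.fact (S (S n))) with ((S (S n)) * Factorial.fact (S n))%nat. rewrite mult_INR.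
  generalize (INR (Factorial.fact (S n))) H. intros F HF.
  auto_derive; auto. change (match n with 0%nat => 1 | S _ => INR n + 1 end) with (INR (S n)). simpl pow. rewrite S_INR. unfold Rminus, Rdiv. generalize (x + - a). intros y. generalize (y * y ^ n). intros q. match goal with |- @eq _ ?a ?b => change (@eq R a b) end. field. lra.
Qed.

Lemma taylor_per v n a x : (forall x, v (x + 1) = v x) -> taylor v n (a + 1) (x + 1) = taylor v n a x.
Proof. intros H. apply Sum_ext. intros j _. rewrite Derive_n_per by auto. do 3 f_equal. ring. Qed.

Lemma taylor_at v n a : taylor v n a a = v a.
Proof. unfold taylor. rewrite Sum_head, (Sum_ext _ (fun _ => 0)), Sum_const.
  2:{ intros; simpl. rewrite Rminus_diag, Rmult_0_l. unfold Rdiv; ring. }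
  simpl. field. Qed.

Lemma Derive_lipschitz v M a b : (forall x, ex_derive v x) -> (forall y, Rabs (Derive v y) <= M) -> a <= b ->
  Rabs (v b - v a) <= M * (b - a).
Proof.
intros Hd HM Hab. destruct (MVT_gen v a b (Derive v)) as (c & _ & E).
intros; now apply Derive_correct. intros; apply continuity_pt_filterlim; now apply ex_derive_cont.
rewrite E, Rabs_mult, (Rabs_right (b - a)) by lra. apply Rmult_le_compat_r; auto; lra.
Qed.

Lemma elem_pt N i x : (1 <= N)%nat -> node N i <= x <= node N (i+1) -> 0 <= INR N * x - INR i <= 1.
Proof.
intros HN Hx. pose proof (INR_gt0 N HN). rewrite node_S in Hx by auto. unfold node in Hx.
assert (E : INR N * (INR i / INR N) = INR i) by (field; lra).
assert (E' : INR N * / INR N = 1) by (field; lra). nra.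
Qed.

(** The Taylor polynomial at the left node already has the right value there; at the right node the
    discrepancy is itself a Taylor remainder. Remainder and correction account for the factor 2. *)
Lemma approx_plain k N v M : (1 <= k)%nat -> (1 <= N)%nat -> per_Cm (S k) M v ->
  exists w, Vh N k w /\ forall x, 0 <= x <= 1 -> Rabs (v x - w x) <= 2 * M * (/ INR N) ^ (S k).
Proof.
intros Hk HN [Hper Hb]. pose proof (INR_gt0 N HN) as Hp. set (h := / INR N).
assert (Hd := fun j Hj x => proj1 (Hb j Hj x)). assert (HM := fun x => proj2 (Hb (S k) (le_n _) x)).
assert (HM0 : 0 <= M) by (eapply Rle_trans; [apply Rabs_pos|apply (HM 0)]).
destruct (glue N k (fun z => taylor v k (IZR z / INR N)) (fun z => v (IZR z / INR N))) as (w & Vw & Ew); auto.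
- intros; apply taylor_poly.
- intros z x. rewrite plus_IZR, <- INR_IZR_INZ. replace ((IZR z + INR N) / INR N) with (IZR z / INR N + 1) by (field; lra).
  now apply taylor_per.
- intros z. rewrite plus_IZR, <- INR_IZR_INZ. replace ((IZR z + INR N) / INR N) with (IZR z / INR N + 1) by (field; lra). auto.
- exists w; split; auto. intros x Hx.
  destruct (find_el_closed N x HN Hx) as (i & _ & Hi).
  assert (Ei : IZR (Z.of_nat i + 1) = INR (i + 1)) by (rewrite INR_IZR_INZ; f_equal; lia).
  rewrite (Ew (Z.of_nat i)). 2:{ rewrite Ei, <- INR_IZR_INZ. exact Hi. }
  unfold nodal_fix. rewrite taylor_at, Ei, <- INR_IZR_INZ. fold (node N i) (node N (i+1)).
  set (t := INR N * x - INR i). assert (Ht : 0 <= t <= 1) by (now apply elem_pt).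
  pose proof (node_S N i HN) as Es. fold h in Es.
  assert (R1 : Rabs (v x - taylor v k (node N i) x) <= M * h ^ S k) by (apply taylor_rem; auto; lra).
  assert (R2 : Rabs (v (node N (i+1)) - taylor v k (node N i) (node N (i+1))) <= M * h ^ S k) by (apply taylor_rem; auto; lra).
  set (r := v (node N (i+1)) - taylor v k (node N i) (node N (i+1))) in *.
  match goal with |- Rabs ?A <= _ => replace A with ((v x - taylor v k (node N i) x) - r * t) by ring end.
  eapply Rle_trans; [apply Rabs_triang|]. rewrite Rabs_Ropp, Rabs_mult, (Rabs_right t) by lra.
  pose proof (Rabs_pos r). nra.
Qed.

Lemma scaled_pow (a b h N0 : R) n : N0 <> 0 -> h = / N0 -> h ^ n * (N0 * (a - b)) ^ n = (a - b) ^ n.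
Proof. intros Hn ->. rewrite <- Rpow_mult_distr. f_equal. field; auto. Qed.

(* The leading error q is locally a multiple of the Legendre polynomial of degree k+1, invisible to [Vh]; the coefficients of neighbouring elements differ by O(h), and because the end values of the polynomial agree, the remaining jumps are O(h^(k+2)) and can be absorbed in w. *)
Lemma approx_super kappa : let k := (2 * kappa + 1)%nat in exists C, 0 <= C /\ forall N v M, (1 <= N)%nat -> per_Cm (k + 2) M v ->
  exists w q, Vh N k w /\ PC N q /\
    (forall i p, (i < N)%nat -> polyR k p -> RInt (fun x => q x * p x) (node N i) (node N (i + 1)) = 0) /\
    forall i, (i < N)%nat -> (forall x, node N i <= x <= node N (i + 1) -> Rabs (v x - w x) <= C * M * (/ INR N) ^ (k + 1)) /\
      forall x, node N i < x < node N (i + 1) -> Rabs (v x - w x - q x) <= C * M * (/ INR N) ^ (k + 2) /\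
        Rabs (Derive v x - dx w x) <= C * M * (/ INR N) ^ k.
Proof.
intros k. destruct (legendre kappa) as (Q0 & PQ0 & Or & HQ). fold k in PQ0, Or.
set (Q := fun x => x ^ S k + Q0 x).
assert (PQ : polyR (S k) Q) by (apply polyR_plus; [apply polyR_pow|now apply polyR_S]).
destruct (polyR_Derive _ _ PQ) as [PQ' DQ].
destruct (polyR_Derive _ _ PQ0) as [PQ0' DQ0].
destruct (cont_bounded Q 0 1) as (B & HB & Bb); [lra|intros; eapply polyR_cont; eauto|].
destruct (cont_bounded (Derive Q) 0 1) as (B' & HB' & Bb'); [lra|intros; eapply polyR_cont; eauto|].
assert (HQ00 : Q 0 = Q0 0) by (unfold Q; simpl; ring).
assert (HQ01 : Q 1 = Q0 0) by (unfold Q; rewrite pow1; lra).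
assert (HBQ : Rabs (Q0 0) <= B) by (rewrite <- HQ00; apply Bb; lra).
exists (2 + 2 * B + B'). split; [lra|].
intros N v M HN [Hper Hb].
assert (Hd := fun j Hj x => proj1 (Hb j Hj x)).
assert (HM1 := fun x => proj2 (Hb (k + 1)%nat ltac:(lia) x)). assert (HM2 := fun x => proj2 (Hb (k + 2)%nat (le_n _) x)).
pose proof (INR_gt0 N HN) as Hp. assert (Hn : INR N <> 0) by lra. set (h := / INR N).
destruct (mesh_size N HN) as (Hh & Hh1 & HNh). fold h in Hh, Hh1, HNh.
assert (HM0 : 0 <= M) by (eapply Rle_trans; [apply Rabs_pos|apply (HM1 0)]).
(* The Taylor coefficient of order k + 1 at the node z h. *)
set (c := fun z : Z => Derive_n v (k + 1) (IZR z / INR N) / INR (Factorial.fact (k + 1))).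
(* With s = N x - z, the first Taylor term beyond degree k is c h^(k+1) s^(k+1). Subtracting c
   h^(k+1) Q(s) from it leaves - c h^(k+1) Q0(s), of degree k; so the Taylor polynomial of degree k
   + 1 exceeds [base] by exactly the Legendre term. *)
set (base := fun z x => taylor v k (IZR z / INR N) x - c z * h ^ (S k) * Q0 (INR N * x - IZR z)).
(* The value of [base z] at its own left node, so all of the correction falls on the right node. *)
set (Vn := fun z => v (IZR z / INR N) - c z * h ^ (S k) * Q0 0).
assert (Hsh : forall z, IZR (z + Z.of_nat N) / INR N = IZR z / INR N + 1).
{ intros z. rewrite plus_IZR, <- INR_IZR_INZ. field; lra. }
assert (Hcp : forall z, c (z + Z.of_nat N)%Z = c z).
{ intros z. unfold c. now rewrite Hsh, Derive_n_per. }
pose proof (fact_ge1 (k + 1)) as Hf. set (F := INR (Factorial.fact (k + 1))) in *.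
assert (HiF : 0 < / F <= 1).
{ split. apply Rinv_0_lt_compat; lra. rewrite <- Rinv_1. apply Rinv_le_contravar; lra. }
destruct (glue N k base Vn) as (w & Vw & Ew); auto.
- unfold k; lia.
- intros z. apply polyR_minus. apply taylor_poly. apply polyR_scal.
  apply polyR_ext with (fun x => Q0 (INR N * x + (- IZR z))). intros; f_equal. now apply polyR_aff.
- intros z x. unfold base. rewrite Hsh, Hcp, taylor_per by auto. do 3 f_equal. rewrite plus_IZR, <- INR_IZR_INZ. ring.
- intros z. unfold Vn. now rewrite Hsh, Hcp, Hper.
- set (q := fun x => c (Int_part (INR N * x)) * h ^ (S k) * Q (INR N * x - IZR (Int_part (INR N * x)))).
  assert (Hip : forall i x, node N i < x < node N (i + 1) -> Int_part (INR N * x) = Z.of_nat i).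
  { intros i x Hx. apply Int_part_eq. rewrite node_S, node_IZR in Hx by auto. fold h in Hx.
    assert (E : INR N * (IZR (Z.of_nat i) / INR N) = IZR (Z.of_nat i)) by now field. nra. }
  set (ci := fun i => c (Z.of_nat i)).
  assert (Hq : forall i x, node N i < x < node N (i + 1) -> q x = ci i * h ^ (S k) * Q (INR N * x + - INR i)).
  { intros i x Hx. unfold q. rewrite (Hip i) by auto. now rewrite (INR_IZR_INZ i). }
  assert (Hci : forall i, Rabs (ci i) <= M).
  { intros i. unfold ci, c. fold F. unfold Rdiv. rewrite Rabs_mult, (Rabs_right (/F)) by lra.
    rewrite <- (Rmult_1_r M). apply Rmult_le_compat; try apply Rabs_pos; auto; lra. }
  assert (HDS : forall j, (j <= k + 1)%nat -> forall x, ex_derive (Derive_n v j) x).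
  { intros j Hj x. apply (Hd (S j)). lia. }
  assert (Hcd : forall i, Rabs (ci (i + 1)%nat - ci i) <= M * h).
  { intros i. unfold ci, c. fold F. match goal with |- Rabs (?a / F - ?b / F) <= _ => replace (a / F - b / F) with ((a - b) * / F) by (unfold Rdiv; ring) end.
    rewrite Rabs_mult, (Rabs_right (/F)) by lra. rewrite <- !node_IZR.
    assert (Rabs (Derive_n v (k + 1) (node N (i+1)) - Derive_n v (k + 1) (node N i)) <= M * (node N (i+1) - node N i)).
    { apply Derive_lipschitz. intros; apply HDS; lia. intros y.
      replace (k + 2)%nat with (S (k + 1)) in HM2 by lia. apply HM2. left; now apply node_lt. }
    rewrite node_S in H at 2 by auto. fold h in H. replace (node N i + h - node N i) with h in H by ring.
    pose proof (Rabs_pos (Derive_n v (k + 1) (node N (i+1)) - Derive_n v (k + 1) (node N i))). nra. }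
  exists w, q. split; auto. split; [|split].
  + intros i Hi. exists (fun x => ci i * h ^ (S k) * Q (INR N * x + - INR i)). split; [|now apply Hq].
    intros x. apply cont_scal. eapply polyR_cont, polyR_aff; eauto.
  + intros i p Hi Pp. rewrite (RInt_el_ext N i _ (fun x => ci i * h ^ (S k) * (Q (INR N * x + - INR i) * p x))); auto.
    2:{ intros x Hx. rewrite (Hq i) by auto. ring. }
    assert (Cg : forall x, continuous (fun x => Q (INR N * x + - INR i) * p x) x).
    { intros x. apply cont_mult. eapply polyR_cont, polyR_aff; eauto. eapply polyR_cont; eauto. }
    rewrite RInt_scalR by now apply ex_RInt_cont.
    pose proof (RInt_el_ref N i _ HN Cg) as E. simpl in E.
    assert (E0 : RInt (fun s => Q (INR N * (/ INR N * s + node N i) + - INR i) * p (/ INR N * s + node N i)) 0 1 = 0).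
    { rewrite (RInt_ext _ (fun s => Q s * p (/ INR N * s + node N i))).
      apply (Or (fun s => p (/ INR N * s + node N i))). now apply polyR_aff.
      intros s _. do 2 f_equal. unfold node. match goal with |- ?a = ?b => change (@eq R a b) end. field; auto. }
    rewrite E0 in E. symmetry in E. apply Rmult_integral in E. destruct E as [E|E]; [lra|].
    rewrite E. apply Rmult_0_r.
  + intros i Hi.
    assert (Ei : IZR (Z.of_nat i + 1) = INR (i + 1)) by (rewrite INR_IZR_INZ; f_equal; lia).
    assert (Zi : (Z.of_nat i + 1)%Z = Z.of_nat (i + 1)) by lia.
    set (T := taylor v (S k) (node N i)).
    assert (ET : forall y, T y = taylor v k (node N i) y + ci i * (y - node N i) ^ (S k)).
    { intros y. unfold T, taylor. simpl Sum at 1. unfold ci, c. rewrite <- node_IZR. fold F.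
      change (Sum (fun m => Derive_n v m (node N i) * ((y - node N i) ^ m / INR (fact m))) (S k)) with
       (Sum (fun m => Derive_n v m (node N i) * ((y - node N i) ^ m / INR (fact m))) k + Derive_n v k (node N i) * ((y - node N i) ^ k / INR (fact k))).
      replace (k + 1)%nat with (S k) by lia. unfold F. replace (k + 1)%nat with (S k) by lia.
      change (Derive_n v (S k) (node N i)) with (Derive (Derive_n v k) (node N i)).
      change (INR (fact (S k))) with (INR (fact k + k * fact k)).
      change ((y - node N i) ^ S k) with ((y - node N i) * (y - node N i) ^ k). unfold Rdiv. ring. }
    assert (Hbase : forall y, base (Z.of_nat i) y = T y - ci i * h ^ S k * Q (INR N * y - INR i)).
    { intros y. unfold base. rewrite ET, <- node_IZR, <- INR_IZR_INZ. unfold Q. fold (ci i).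
      replace (INR N * y - INR i) with (INR N * (y - node N i)) by (unfold node; field; auto).
      rewrite <- (scaled_pow y (node N i) h (INR N) (S k)) by auto. ring. }
    set (r := fun y => v y - T y).
    assert (Hr : forall y, node N i <= y <= node N (i+1) -> Rabs (r y) <= M * h ^ (k + 2)).
    { intros y Hy. rewrite node_S in Hy by auto. fold h in Hy. replace (k+2)%nat with (S (S k)) in * by lia.
      apply taylor_rem; auto. }
    (* The mismatch at the right node: a Taylor remainder of order h^(k+2), and h^(k+1) times the
       variation of c over one element, which is O(h). Here Q(1) = Q(0) is what leaves only a
       difference of coefficients. *)
    set (dl := r (node N (i+1)) - (ci (i+1)%nat - ci i) * h ^ (S k) * Q0 0).
    assert (Hdl : Rabs dl <= (1 + B) * (M * h ^ (k + 2))).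
    { unfold dl. eapply Rle_trans; [apply Rabs_triang|]. rewrite Rabs_Ropp, !Rabs_mult, (Rabs_right (h ^ S k)).
      2:{ left; apply pow_lt; auto. }
      specialize (Hr (node N (i+1)) ltac:(pose proof (node_lt N i HN); lra)).
      assert (Rabs (ci (i + 1)%nat - ci i) * h ^ S k * Rabs (Q0 0) <= (M * h) * h ^ S k * B).
      { apply Rmult_le_compat; auto; try apply Rabs_pos. apply Rmult_le_pos. apply Rabs_pos. apply pow_le; lra.
        apply Rmult_le_compat_r; auto. apply pow_le; lra. }
      replace (k+2)%nat with (S (S k)) in * by lia. simpl in *. nra. }
    assert (EwT : forall y, node N i <= y <= node N (i+1) -> w y = T y - ci i * h ^ S k * Q (INR N * y + - INR i) + dl * (INR N * y - INR i)).
    { intros y Hy. rewrite (Ew (Z.of_nat i)). 2:{ rewrite Ei, <- INR_IZR_INZ. exact Hy. }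
      unfold nodal_fix. rewrite !Hbase, Ei, <- INR_IZR_INZ, Zi. fold (node N i) (node N (i+1)).
      replace (INR N * node N i - INR i) with 0 by (unfold node; field; auto).
      replace (INR N * node N (i+1) - INR i) with 1 by (unfold node; rewrite plus_INR; simpl; field; auto).
      unfold Vn. rewrite <- !node_IZR. fold (ci i) (ci (i+1)%nat). rewrite HQ01, HQ00.
      assert (ET0 : T (node N i) = v (node N i)) by apply taylor_at. rewrite ET0.
      unfold dl, r. unfold Rminus at 2. ring. }
    assert (Hhk : h ^ (k + 2) = h * h * h ^ k) by (replace (k+2)%nat with (S (S k)) by lia; simpl; ring).
    assert (Hhk1 : h ^ (k + 1) = h * h ^ k) by (replace (k+1)%nat with (S k) by lia; simpl; ring).
    assert (Hhp : 0 < h ^ k) by now apply pow_lt. assert (HMh : 0 <= M * h ^ (k + 2)) by (apply Rmult_le_pos; auto; apply pow_le; lra).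
    assert (R0 : forall x, node N i <= x <= node N (i+1) -> Rabs (r x - dl * (INR N * x - INR i)) <= (2 + B) * (M * h ^ (k + 2))).
    { intros x Hx. pose proof (elem_pt N i x HN Hx) as Ht. specialize (Hr x Hx). pose proof (Rabs_pos dl).
      eapply Rle_trans; [apply Rabs_triang|]. rewrite Rabs_Ropp, Rabs_mult, (Rabs_right (INR N * x - INR i)) by lra. nra. }
    fold h. split.
    { intros x Hx. specialize (R0 x Hx). pose proof (elem_pt N i x HN Hx) as Ht. rewrite EwT by auto.
      match goal with |- Rabs ?A <= _ => replace A with ((r x - dl * (INR N * x - INR i)) + ci i * h ^ S k * Q (INR N * x + - INR i)) by (unfold r; ring) end.
      assert (Rabs (ci i * h ^ S k * Q (INR N * x + - INR i)) <= M * h ^ (k + 1) * B).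
      { replace (k + 1)%nat with (S k) by lia. rewrite !Rabs_mult, (Rabs_right (h ^ S k)) by (left; now apply pow_lt).
        apply Rmult_le_compat; try apply Rabs_pos. apply Rmult_le_pos. apply Rabs_pos. apply pow_le; lra.
        apply Rmult_le_compat_r; auto. apply pow_le; lra. apply Bb. lra. }
      assert (M * h ^ (k + 2) <= M * h ^ (k + 1)) by (rewrite Hhk, Hhk1, (Rmult_assoc h h); apply Rmult_le_compat_l; auto; assert (0 <= h * h ^ k) by nra; nra).
      eapply Rle_trans; [apply Rabs_triang|]. rewrite (Rmult_assoc _ M). nra. }
    intros x Hx. assert (Hx' : node N i <= x <= node N (i+1)) by lra.
    pose proof (elem_pt N i x HN Hx') as Ht. split.
    * rewrite EwT, (Hq i) by auto.
      match goal with |- Rabs ?A <= _ => replace A with (r x - dl * (INR N * x - INR i)) by (unfold r; ring) end.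
      specialize (R0 x Hx'). rewrite (Rmult_assoc _ M). nra.
    * set (T' := taylor (Derive v) k (node N i)).
      (* Inside the element [w] is given by [EwT]; the chain rule brings a factor N, which lowers
         h^(k+1) to h^k. *)
      assert (Dw : dx w x = T' x - ci i * h ^ S k * (INR N * Derive Q (INR N * x + - INR i)) + dl * INR N).
      { apply is_derive_unique.
        apply is_derive_ext_loc with (fun y => T y - ci i * h ^ S k * Q (INR N * y + - INR i) + dl * (INR N * y - INR i)).
        - assert (L : locally x (fun y => node N i < y /\ y < node N (i+1))).
          { apply locally_between; lra. }
          revert L; apply filter_imp. intros y Hy. symmetry; apply EwT; lra.
        - apply (is_derive_plusR (fun y => T y - ci i * h ^ S k * Q (INR N * y + - INR i))).
          apply (is_derive_minusR T). apply taylor_derive.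
          apply is_derive_scal.
          apply (@is_derive_comp R_AbsRing R_NormedModule Q (fun y => INR N * y + - INR i)). apply DQ. auto_derive; auto; ring.
          auto_derive; auto; ring. }
      rewrite Dw.
      assert (R1 : Rabs (Derive v x - T' x) <= M * h ^ S k).
      { rewrite node_S in Hx' by auto. fold h in Hx'. apply taylor_rem; auto.
        apply ex_derive_n_Derive. intros; apply Hd; lia.
        intros y. rewrite Derive_n_S. replace (S (S k)) with (k+2)%nat by lia. auto. }
      match goal with |- Rabs ?A <= _ => replace A with ((Derive v x - T' x) + (ci i * (h ^ S k * INR N) * Derive Q (INR N * x + - INR i) - dl * INR N)) by ring end.
      assert (EhN : h ^ S k * INR N = h ^ k) by (simpl; replace (h * h ^ k * INR N) with (INR N * h * h ^ k) by ring; rewrite HNh; ring).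
      rewrite EhN.
      assert (R2 : Rabs (ci i * h ^ k * Derive Q (INR N * x + - INR i)) <= M * h ^ k * B').
      { rewrite !Rabs_mult, (Rabs_right (h ^ k)) by lra. apply Rmult_le_compat; try apply Rabs_pos.
        apply Rmult_le_pos; [apply Rabs_pos|lra]. apply Rmult_le_compat_r; auto; lra. apply Bb'. lra. }
      assert (R3 : Rabs (dl * INR N) <= (1 + B) * (M * h ^ (k+1))).
      { rewrite Rabs_mult, (Rabs_right (INR N)) by lra.
        apply Rle_trans with ((1 + B) * (M * h ^ (k+2)) * INR N). apply Rmult_le_compat_r; lra.
        rewrite Hhk, Hhk1. right. replace ((1 + B) * (M * (h * h * h ^ k)) * INR N) with ((1+B) * (M * (h * h ^ k)) * (INR N * h)) by ring.
        rewrite HNh; ring. }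
      eapply Rle_trans; [apply Rabs_triang|].
      eapply Rle_trans; [apply Rplus_le_compat_l; apply Rabs_triang|]. rewrite Rabs_Ropp.
      rewrite Hhk1 in R3. simpl in R1.
      assert (0 <= M * h ^ k) by (apply Rmult_le_pos; lra).
      assert (M * (h * h ^ k) <= M * h ^ k) by (replace (M * (h * h^k)) with (h * (M * h ^ k)) by ring; nra).
      replace ((2 + 2 * B + B') * M * h ^ k) with ((2 + 2 * B + B') * (M * h ^ k)) by ring. nra.
Qed.

(** * Superconvergence of the projection *)

Lemma per_Cm_le m n M v : (m <= n)%nat -> per_Cm n M v -> per_Cm m M v.
Proof. intros H [Hp Hb]; split; auto. apply (Cm_bd_le m n M); auto; lra. Qed.

Lemma per_Cm_ge0 m M v : per_Cm m M v -> 0 <= M.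
Proof. intros [_ H]. eapply Rle_trans; [apply Rabs_pos|apply (H O (Nat.le_0_l _) 0)]. Qed.

Lemma per_Cm_cont m M v x : (1 <= m)%nat -> per_Cm m M v -> continuous v x.
Proof. intros Hm [_ H]. apply ex_derive_cont. apply (H 1%nat); auto. Qed.

Lemma per_Cm_Derive m M v : per_Cm (S m) M v -> per_Cm m M (Derive v).
Proof. intros [Hp H]; split. intros x; apply (Derive_n_per v 1 x Hp). apply Cm_bd_S, H. Qed.

Lemma per_Cm_minus m A B f g : per_Cm m A f -> per_Cm m B g -> per_Cm m (A + B) (fun x => f x - g x).
Proof. intros [Pf Hf] [Pg Hg]. split; [intros; now rewrite Pf, Pg|now apply Cm_bd_minus]. Qed.

Lemma per_Cm_PC1 N m M v : (2 <= m)%nat -> per_Cm m M v -> PC1 N v (dx v).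
Proof.
intros Hm Hv i Hi. exists v, (Derive v). split; [|split; [|split]]; auto.
- intros x. apply Derive_correct. apply (proj2 Hv 1%nat). lia.
- intros x. apply (per_Cm_cont 1 M); auto. apply per_Cm_Derive. now apply (per_Cm_le 2 m).
Qed.

(** The residual e is orthogonal to [Vh], so (e, e) = (e, f - w), and Cauchy-Schwarz finishes. *)
Lemma Proj_best N k f w : (1 <= N)%nat -> PC N f -> Vh N k w ->
  L2norm (fun x => f x - Proj N k f x) <= L2norm (fun x => f x - w x).
Proof.
intros HN Hf Hw. pose proof (Proj_V N k f HN Hf) as VP. pose proof (Vh_PC _ _ _ VP) as PP. pose proof (Vh_PC _ _ _ Hw) as Pw.
set (e := fun x => f x - Proj N k f x). assert (Pe : PC N e) by pc.
assert (E : ip e e = ip e (fun x => f x - w x)).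
{ assert (V : Vh N k (fun x => w x - Proj N k f x)) by (apply subsp_minus; auto; apply Vh_subsp).
  pose proof (proj2 (Proj_spec N k f HN Hf) _ V) as E. fold e in E.
  rewrite (ip_minus_r N) in E; auto. unfold e at 2. rewrite !(ip_minus_r N); auto. lra. }
pose proof (ip_CS N e (fun x => f x - w x) HN Pe ltac:(pc)) as C.
rewrite <- E in C. pose proof (Rle_abs (ip e e)). rewrite <- (L2_sq N) in * by pc.
fold e. pose proof (L2_pos e). pose proof (L2_pos (fun x => f x - w x)).
destruct (Req_dec (L2norm e) 0); [lra|]. apply Rmult_le_reg_l with (L2norm e); lra.
Qed.

(** Asks for one derivative less than the superconvergent estimates, so it applies to u_x. *)
Lemma proj_plain N k v M : (1 <= k)%nat -> (1 <= N)%nat -> per_Cm (S k) M v ->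
  L2norm (fun x => v x - Proj N k v x) <= 2 * M * (/ INR N) ^ (S k).
Proof.
intros Hk HN Hv. destruct (approx_plain k N v M Hk HN Hv) as (w & Vw & Ew).
assert (PC N v) by (apply PC_cont; intros; apply (per_Cm_cont (S k) M); auto; lia).
pose proof (per_Cm_ge0 _ _ _ Hv) as HM0.
assert (0 < / INR N) by (apply Rinv_0_lt_compat, INR_gt0; auto).
eapply Rle_trans; [apply (Proj_best N k v w); auto|].
apply (L2_bound N); auto. apply PC_minus; auto. pc.
apply Rmult_le_pos; [lra|apply pow_le; lra].
intros i x Hi Hx. apply Ew. pose proof (node_range N i HN ltac:(lia)). pose proof (node_range N (i+1) HN ltac:(lia)). lra.
Qed.

Lemma ip_pw_orth N q g : (1 <= N)%nat -> PC N q -> PC N g ->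
  (forall i, (i < N)%nat -> RInt (fun x => q x * g x) (node N i) (node N (i + 1)) = 0) -> ip q g = 0.
Proof.
intros HN Hq Hg H. unfold ip. rewrite (RInt_elements N); auto. 2: pc.
rewrite (Sum_ext _ (fun _ => 0)); auto. rewrite Sum_const; ring.
Qed.

(* The gain over the inverse inequality in the second estimate comes from P (v - w) being one order smaller than v - w. *)
Lemma proj_super kappa : let k := (2 * kappa + 1)%nat in exists C, 0 <= C /\ forall N v M, (1 <= N)%nat -> per_Cm (k + 2) M v ->
  L2norm (fun x => v x - Proj N k v x) <= C * M * (/ INR N) ^ (k + 1) /\
  (forall chi, Vh N k chi -> Rabs (ip (fun x => v x - Proj N k v x) (dx chi)) <= C * M * (/ INR N) ^ (k + 1) * L2norm chi) /\
  L2norm (fun x => dx v x - dx (Proj N k v) x) <= C * M * (/ INR N) ^ k /\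
  (forall x, 0 <= x <= 1 -> Rabs (v x - Proj N k v x) <= C * M * (/ INR N) ^ (k + 1)).
Proof.
intros k. destruct (approx_super kappa) as (Ca & HCa & HA). fold k in HA.
destruct (inverse_ineq k) as (Ci & HCi & HI).
exists ((3 + 2 * Ci) * Ca). split; [nra|]. intros N v M HN Hv.
destruct (HA N v M HN Hv) as (w & q & Vw & Pq & Oq & Hel). clear HA.
set (h := / INR N) in *.
destruct (mesh_size N HN) as (Hh & Hh1 & HNh). fold h in Hh, Hh1, HNh.
pose proof (per_Cm_ge0 _ _ _ Hv) as HM0.
assert (Cv : forall x, continuous v x) by (intros; apply (per_Cm_cont (k+2) M); auto; lia).
assert (Pv : PC N v) by now apply PC_cont.
assert (Pw : PC N w) by pc.
assert (VP := Proj_V N k v HN Pv). assert (PP := Vh_PC _ _ _ VP).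
(* This is - P (v - w), and v - w = [rho + q] with q invisible to [Vh]. *)
set (th := fun x => w x - Proj N k v x).
assert (Vth : Vh N k th) by (apply subsp_minus; auto; apply Vh_subsp).
assert (Pth := Vh_PC _ _ _ Vth).
set (rho := fun x => v x - w x - q x).
assert (Pr : PC N rho) by (apply PC_minus; auto; now apply PC_minus).
set (A := Ca * M * h ^ (k+1)). assert (HA : 0 <= A) by (apply Rmult_le_pos; [nra|apply pow_le; lra]).
assert (EA : Ca * M * h ^ (k + 2) = A * h) by (unfold A; replace (k+2)%nat with (S (k+1)) by lia; simpl; ring).
assert (EA' : Ca * M * h ^ k * h = A) by (unfold A; replace (k+1)%nat with (S k) by lia; simpl; ring).
assert (Nr : L2norm rho <= A * h).
{ apply (L2_bound N); auto. nra. intros i x Hi Hx. rewrite <- EA. now apply (proj2 (Hel i Hi)). }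
assert (Oq' : forall chi, Vh N k chi -> ip q chi = 0 /\ ip q (dx chi) = 0).
{ intros chi Hc. split.
  - apply (ip_pw_orth N); auto. pc. intros i Hi.
    destruct (Vh_dx_el N k chi i HN Hc Hi) as (p & p' & Pp & Pp' & D & E & E').
    rewrite (RInt_el_ext N i _ (fun x => q x * p x)); auto. intros; rewrite E; auto; lra.
  - apply (ip_pw_orth N); auto. pc. intros i Hi.
    destruct (Vh_dx_el N k chi i HN Hc Hi) as (p & p' & Pp & Pp' & D & E & E').
    rewrite (RInt_el_ext N i _ (fun x => q x * p' x)); auto. intros; rewrite E'; auto; lra. }
(* (th, th) = (w - v, th) = - (rho, th), since q is orthogonal to [Vh]: the projection keeps only
   the part of order h^(k+2). *)
assert (Nth : L2norm th <= A * h).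
{ assert (E : ip th th = - ip rho th).
  { assert (E1 : ip (fun x => rho x + q x) th = ip v th - ip w th).
    { rewrite <- (ip_minus_l N) by pc. apply ip_ext; auto. intros; unfold rho; ring. }
    rewrite (ip_plus_l N), (proj1 (Oq' th Vth)) in E1 by pc.
    assert (E2 : ip th th = ip w th - ip (Proj N k v) th) by (unfold th at 1; now apply (ip_minus_l N)).
    rewrite (Proj_ip N) in E2 by pc. lra. }
  pose proof (ip_CS N rho th HN Pr Pth) as C. rewrite <- (L2_sq N) in E by pc.
  pose proof (Rle_abs (- ip rho th)) as R1. rewrite Rabs_Ropp in R1.
  pose proof (L2_pos th). destruct (Req_dec (L2norm th) 0); [nra|].
  apply Rle_trans with (L2norm rho); auto. apply Rmult_le_reg_r with (L2norm th); lra. }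
assert (Hdec : forall x, v x - Proj N k v x = rho x + q x + th x) by (intros; unfold rho, th; ring).
assert (HAh : A * h <= A) by nra.
replace ((3 + 2 * Ci) * Ca * M * h ^ (k + 1)) with ((3 + 2 * Ci) * A) by (unfold A; ring).
(* The extra h in the bound of [th] pays for the factor N of the inverse inequality. *)
assert (Nci : Ci * INR N * L2norm th <= Ci * A).
{ apply Rle_trans with (Ci * INR N * (A * h)). apply Rmult_le_compat_l; auto. apply Rmult_le_pos; auto; apply pos_INR.
  replace (Ci * INR N * (A * h)) with (Ci * A * (INR N * h)) by ring. rewrite HNh; lra. }
assert (Pd : forall x, 0 <= x <= 1 -> Rabs (v x - Proj N k v x) <= (3 + 2 * Ci) * A).
{ intros x Hx. destruct (find_el_closed N x HN Hx) as (i & Hi & Hxi). pose proof (proj1 (Hel i Hi) x Hxi).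
  destruct (HI N th HN Vth) as [_ I]. specialize (I x Hx).
  replace (v x - Proj N k v x) with ((v x - w x) + th x) by (unfold th; ring).
  eapply Rle_trans; [apply Rabs_triang|]. fold A in H. nra. }
split; [|split; [|split]]; auto.
- apply (L2_bound N); auto. pc. nra. intros i x Hi Hx. apply Pd.
  pose proof (node_range N i HN ltac:(lia)). pose proof (node_range N (i+1) HN ltac:(lia)). lra.
- intros chi Hc. destruct (HI N chi HN Hc) as [I1 _]. pose proof (Vh_dxPC _ _ _ HN Hc) as Pdc.
  rewrite (ip_ext _ (dx chi) (fun x => (rho x + q x) + th x) (dx chi)) by pc.
  rewrite (ip_plus_l N), (ip_plus_l N), (proj2 (Oq' chi Hc)) by pc.
  rewrite Rplus_0_r. eapply Rle_trans; [apply Rabs_triang|].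
  pose proof (ip_CS N rho (dx chi) HN Pr Pdc). pose proof (ip_CS N th (dx chi) HN Pth Pdc).
  pose proof (L2_pos (dx chi)). pose proof (L2_pos chi).
  assert (forall g, L2norm g <= A * h -> L2norm g * L2norm (dx chi) <= A * Ci * L2norm chi).
  { intros g Hg. replace (A * Ci * L2norm chi) with ((A * h) * (Ci * INR N * L2norm chi)).
    apply Rmult_le_compat; auto; apply L2_pos.
    replace (A * h * (Ci * INR N * L2norm chi)) with (A * Ci * L2norm chi * (INR N * h)) by ring. rewrite HNh; ring. }
  pose proof (H3 rho Nr). pose proof (H3 th Nth).
  nra.
- destruct (HI N th HN Vth) as [I1 _].
  assert (Pdv : PC N (dx v)) by (apply (PC1_PC' N v); apply (per_Cm_PC1 N (k+2) M); auto; lia).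
  assert (Pdw : PC N (dx w)) by pc.
  assert (PdP : PC N (dx (Proj N k v))) by pc.
  eapply Rle_trans; [apply (L2_tri3 N (dx v) (dx w)); auto|].
  rewrite (L2_ext (fun x => dx w x - dx (Proj N k v) x) (dx th)).
  2:{ intros x _. unfold th. replace (fun y => w y - Proj N k v y) with (fun y => 1 * w y + (-1) * Proj N k v y) by (apply fun_ext; intros; ring).
      rewrite (dx_lin N k w (Proj N k v)); auto. ring. }
  assert (N1 : L2norm (fun x => dx v x - dx w x) <= Ca * M * h ^ k).
  { apply (L2_bound N); auto. pc. apply Rmult_le_pos; [nra|apply pow_le; lra].
    intros i x Hi Hx. now apply (proj2 (Hel i Hi)). }
  set (A' := Ca * M * h ^ k) in *.
  replace ((3 + 2 * Ci) * Ca * M * h ^ k) with ((3 + 2 * Ci) * A') by (unfold A'; ring).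
  nra.
Qed.

(** * Ordinary differential equations *)

Lemma half_pow_small D eps : 0 < eps -> exists m, D * (/2) ^ m < eps.
Proof.
intros He. assert (Hd : 0 < eps / (Rabs D + 1)) by (pose proof (Rabs_pos D); apply Rdiv_lt_0_compat; lra).
destruct (pow_lt_1_zero (/2) ltac:(rewrite Rabs_right; lra) _ Hd) as (m & Hm). exists m.
specialize (Hm m (le_n _)). assert (0 < (/2)^m) by (apply pow_lt; lra). rewrite Rabs_right in Hm by lra.
pose proof (Rabs_pos D). pose proof (Rle_abs D).
apply Rle_lt_trans with ((Rabs D + 1) * (/2)^m). nra.
apply Rlt_le_trans with ((Rabs D + 1) * (eps / (Rabs D + 1))). apply Rmult_lt_compat_l; lra. right; field; lra.
Qed.

Lemma half_pow_zero x D : (forall m, Rabs x <= D * (/2) ^ m) -> x = 0.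
Proof.
intros H. apply NNPP; intros Hx. assert (0 < Rabs x) by now apply Rabs_pos_lt.
destruct (half_pow_small D (Rabs x) H0) as (m & Hm). specialize (H m). lra.
Qed.

(** The partial sums of the geometric bound give the Cauchy property and, in the limit, the tail 2 D
    / 2^m. [real (Lim_seq u)] names the limit, so limits of functions need no choice. *)
Lemma geom_lim (u : nat -> R) D : 0 <= D -> (forall m, Rabs (u (S m) - u m) <= D * (/2)^m) ->
  forall m, Rabs (u m - real (Lim_seq u)) <= 2 * D * (/2)^m.
Proof.
intros HD H.
assert (Hp : forall m, 0 < (/2)^m) by (intros; apply pow_lt; lra).
assert (H2 : forall p m, Rabs (u (m + p)%nat - u m) <= 2 * D * (/2)^m - 2 * D * (/2)^(m+p)).
{ induction p; intros m. rewrite Nat.add_0_r, Rminus_diag, Rabs_R0. lra.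
  replace (m + S p)%nat with (S (m + p)) by lia.
  replace (u (S (m+p)) - u m) with ((u (S (m+p)) - u (m+p)%nat) + (u (m+p)%nat - u m)) by ring.
  eapply Rle_trans; [apply Rabs_triang|]. specialize (H (m+p)%nat). specialize (IHp m). simpl. lra. }
assert (H3 : forall p m, Rabs (u (m + p)%nat - u m) <= 2 * D * (/2)^m).
{ intros p m. specialize (H2 p m). specialize (Hp (m+p)%nat). nra. }
assert (Ex : ex_finite_lim_seq u).
{ apply ex_lim_seq_cauchy_corr. intros eps. destruct (half_pow_small (4 * D) eps (cond_pos eps)) as (M & HM).
  exists M. intros n m Hn Hm. replace n with (M + (n - M))%nat by lia. replace m with (M + (m - M))%nat by lia.
  pose proof (H3 (n-M)%nat M) as A1. pose proof (H3 (m-M)%nat M) as A2.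
  apply Rabs_le_between in A1, A2. apply Rabs_def1; lra. }
destruct Ex as [l Hl]. rewrite (is_lim_seq_unique _ _ Hl). simpl. intros m.
assert (L : is_lim_seq (fun p => Rabs (u (m + p)%nat - u m)) (Rabs (l - u m))).
{ apply (is_lim_seq_abs (fun p => u (m+p)%nat - u m) (l - u m)).
  apply (is_lim_seq_minus' _ _ l (u m)). apply is_lim_seq_ext with (fun p => u (p + m)%nat). intros; f_equal; lia.
  now apply is_lim_seq_incr_n. apply is_lim_seq_const. }
rewrite Rabs_minus_sym.
apply (is_lim_seq_le _ _ _ _ (fun p => H3 p m) L (is_lim_seq_const _)).
Qed.

Lemma cont_of_lipschitz_comp n (f : (nat -> R) -> nat -> R) K (b : R -> nat -> R) j :
  (forall b b' j, (j < n)%nat -> Rabs (f b j - f b' j) <= K * Sum (fun i => Rabs (b i - b' i)) n) ->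
  (j < n)%nat -> (forall i, (i < n)%nat -> forall t, continuous (fun s => b s i) t) ->
  forall t, continuous (fun s => f (b s) j) t.
Proof.
intros Hf Hj Hb t.
assert (C : continuous (fun s => K * Sum (fun i => Rabs (b s i - b t i)) n) t).
{ apply cont_scal. clear -Hb. induction n; simpl. apply continuous_const.
  apply cont_plus. apply IHn; auto. apply (continuous_comp (fun s => b s n - b t n) Rabs).
  apply cont_minus; auto. apply continuous_const. apply continuous_Rabs. }
apply filterlim_locally. intros eps.
assert (C0 : K * Sum (fun i => Rabs (b t i - b t i)) n = 0).
{ rewrite (Sum_ext _ (fun _ => 0)), Sum_const. ring. intros; rewrite Rminus_diag; apply Rabs_R0. }
specialize (C (fun y => y < eps)). unfold filtermap in C.
assert (L : locally t (fun s => K * Sum (fun i => Rabs (b s i - b t i)) n < eps)).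
{ apply C. apply open_lt. rewrite C0. apply cond_pos. }
revert L; apply filter_imp. intros s Hs. eapply Rle_lt_trans; [|apply Hs]. apply Hf; auto.
Qed.

Fixpoint picard_iter (f : (nat -> R) -> nat -> R) (b0 : nat -> R) (m : nat) (t : R) (j : nat) : R :=
  match m with O => b0 j | S m => b0 j + RInt (fun s => f (picard_iter f b0 m s) j) 0 t end.

Lemma is_derive_RInt_cont (g : R -> R) t : (forall s, continuous g s) -> is_derive (fun t => RInt g 0 t) t (g t).
Proof.
intros Hg. apply (is_derive_RInt g (fun t => RInt g 0 t) 0 t); auto.
apply filter_forall. intros x. apply (@RInt_correct R_CompleteNormedModule). now apply ex_RInt_cont.
Qed.

Lemma RInt_exp_bound (g : R -> R) D L t : 0 < L -> 0 <= t -> (forall s, continuous g s) ->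
  (forall s, 0 <= s <= t -> Rabs (g s) <= D * exp (L * s)) -> 0 <= D -> Rabs (RInt g 0 t) <= D / L * exp (L * t).
Proof.
intros HL Ht Cg Hg HD.
assert (I : is_RInt (fun s => D * exp (L * s)) 0 t (D / L * exp (L * t) - D / L * exp (L * 0))).
{ apply (is_RInt_derive (fun s => D / L * exp (L * s)) (fun s => D * exp (L * s))).
  intros; auto_derive; auto. field; lra. intros; apply ex_derive_cont; auto_derive; auto. }
pose proof (norm_RInt_le g (fun s => D * exp (L * s)) 0 t _ _ Ht Hg (RInt_correct g 0 t (ex_RInt_cont g 0 t Cg)) I) as B.
eapply Rle_trans; [apply B|]. rewrite Rmult_0_r, exp_0. assert (0 <= D / L) by (apply Rmult_le_pos; auto; left; now apply Rinv_0_lt_compat). lra.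
Qed.

(** The vector field is globally Lipschitz in the sum norm, so the Picard iteration contracts on the
    whole half-line in a norm with an exponential weight; the solution is global at once, with no
    continuation argument. *)
Lemma picard n (f : (nat -> R) -> nat -> R) K (b0 : nat -> R) : 0 <= K ->
  (forall b b' j, (j < n)%nat -> Rabs (f b j - f b' j) <= K * Sum (fun i => Rabs (b i - b' i)) n) ->
  exists b : R -> nat -> R, (forall j, (j < n)%nat -> b 0 j = b0 j) /\
    (forall j, (j < n)%nat -> forall t, continuous (fun s => b s j) t) /\
    (forall j, (j < n)%nat -> forall t, 0 < t -> is_derive (fun s => b s j) t (f (b t) j)).
Proof.
intros HK Hf. set (p := picard_iter f b0).
(* n K is the Lipschitz constant of the system in the sum norm; the added 1 keeps the division by L
   legitimate. *)
set (L := INR n * K + 1). assert (HnK : 0 <= INR n * K) by (apply Rmult_le_pos; auto; apply pos_INR).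
assert (HL : 1 <= L) by (unfold L; lra).
assert (Cp : forall m j, (j < n)%nat -> forall t, continuous (fun s => p m s j) t).
{ induction m; intros j Hj t. apply continuous_const.
  apply cont_plus. apply continuous_const. eapply is_derive_cont. apply is_derive_RInt_cont.
  now apply (cont_of_lipschitz_comp n f K). }
assert (Cf : forall m j, (j < n)%nat -> forall t, continuous (fun s => f (p m s) j) t).
{ intros m j Hj. apply (cont_of_lipschitz_comp n f K); auto. }
set (A := Sum (fun j => Rabs (f b0 j)) n).
assert (HA : 0 <= A) by (apply Sum_nonneg; intros; apply Rabs_pos).
(* Integrating exp(2 L s) gains 1 / (2 L), and n K <= L, so each iteration halves the weighted
   increment. *)
assert (Hd : forall m j s, (j < n)%nat -> 0 <= s -> Sum (fun j => Rabs (p (S m) s j - p m s j)) n <= A * (/2)^m * exp (2 * L * s)).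
{ intros m j s Hj. clear j Hj. revert s. induction m; intros s Hs.
  - rewrite (Sum_ext _ (fun j => s * Rabs (f b0 j))).
    2:{ intros j Hj. change (p 1%nat s j - p 0%nat s j) with (b0 j + RInt (fun _ => f b0 j) 0 s - b0 j). rewrite RInt_const. unfold scal; simpl; unfold mult; simpl.
        replace (b0 j + (s - 0) * f b0 j - b0 j) with (s * f b0 j) by ring. rewrite Rabs_mult, Rabs_right; auto; lra. }
    rewrite Sum_scal. fold A. simpl pow. pose proof (exp_ineq1_le (2 * L * s)). assert (s <= L * s) by nra. nra.
  - apply Rle_trans with (Sum (fun j => K * (A * (/2)^m) / (2*L) * exp (2 * L * s)) n).
    + apply Sum_le. intros j Hj.
      assert (E : p (S (S m)) s j - p (S m) s j = RInt (fun r => f (p (S m) r) j - f (p m r) j) 0 s).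
      { rewrite RInt_minusR by (apply ex_RInt_cont; auto).
        assert (G : forall x y z : R, (x + y) - (x + z) = y - z) by (intros; ring).
        exact (G (b0 j) (RInt (fun r => f (p (S m) r) j) 0 s) (RInt (fun r => f (p m r) j) 0 s)). }
      rewrite E. apply RInt_exp_bound; auto. lra.
      * intros r. apply cont_minus; auto.
      * intros r Hr. eapply Rle_trans; [apply Hf; auto|]. rewrite Rmult_assoc. apply Rmult_le_compat_l; auto. apply IHm; lra.
      * apply Rmult_le_pos; auto. apply Rmult_le_pos; auto. apply pow_le; lra.
    + rewrite Sum_const. simpl pow. set (e := exp (2 * L * s)). assert (0 < e) by apply exp_pos.
      assert (0 <= A * (/2)^m) by (apply Rmult_le_pos; auto; apply pow_le; lra).
      replace (INR n * (K * (A * (/ 2) ^ m) / (2 * L) * e)) with ((INR n * K / L) * (A * (/2)^m * / 2 * e)) by (field; lra).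
      replace (A * (/2 * (/2)^m) * e) with (1 * (A * (/2)^m * / 2 * e)) by ring.
      apply Rmult_le_compat_r. apply Rmult_le_pos; lra. apply Rmult_le_reg_r with L; [lra|]. unfold Rdiv. rewrite Rmult_assoc, Rinv_l by lra. unfold L; lra. }
(* Freezing the argument at 0 for negative t makes [b] continuous on the whole line; the derivative
   is claimed only for t > 0. *)
set (b := fun t j => real (Lim_seq (fun m => p m (Rmax t 0) j))).
set (E := fun s => 2 * (A * exp (2 * L * s))).
assert (HE : forall s, 0 <= E s) by (intros s; unfold E; pose proof (exp_pos (2 * L * s)); nra).
assert (HEm : forall s s', s <= s' -> E s <= E s').
{ intros s s' H. unfold E. apply Rmult_le_compat_l; [lra|]. apply Rmult_le_compat_l; auto.
  destruct (Req_dec s s') as [->|]; [lra|]. left; apply exp_increasing; nra. }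
assert (Hb : forall m t j, (j < n)%nat -> Rabs (p m (Rmax t 0) j - b t j) <= E (Rmax t 0) * (/2)^m).
{ intros m t j Hj. unfold b, E. apply (geom_lim (fun m => p m (Rmax t 0) j)).
  apply Rmult_le_pos; auto. left; apply exp_pos.
  intros q. pose proof (Rmax_r t 0). specialize (Hd q j (Rmax t 0) Hj H).
  pose proof (Sum_term_le (fun j => Rabs (p (S q) (Rmax t 0) j - p q (Rmax t 0) j)) n j) as Q. simpl in Q.
  eapply Rle_trans; [apply Q; auto; intros; apply Rabs_pos|]. eapply Rle_trans; [apply Hd|]. right; ring. }
assert (Cb : forall j, (j < n)%nat -> forall t, continuous (fun s => b s j) t).
{ intros j Hj t. apply filterlim_locally. intros eps.
  assert (He3 : 0 < eps / 3) by (pose proof (cond_pos eps); lra).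
  destruct (half_pow_small (E (Rmax t 0 + 1)) (eps/3) He3) as (m & Hm).
  assert (C : continuous (fun s => p m (Rmax s 0) j) t).
  { apply (continuous_comp (fun s => Rmax s 0) (fun s => p m s j)); auto.
    apply (continuous_ext (fun s => (s + Rabs s) / 2)). intros s; unfold Rmax, Rabs; destruct Rle_dec; destruct Rcase_abs; lra.
    apply cont_mult. apply cont_plus. apply continuous_id. apply continuous_Rabs. apply continuous_const. }
  pose proof (proj1 (filterlim_locally _ _) C (mkposreal _ He3)) as L1.
  assert (L2 : locally t (fun s => s < t + 1)) by (apply open_lt; lra).
  generalize (filter_and _ _ L1 L2). apply filter_imp. intros s [Hs1 Hs2].
  assert (Hs1' : Rabs (p m (Rmax s 0) j - p m (Rmax t 0) j) < eps / 3) by exact Hs1.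
  assert (Hms : Rmax s 0 <= Rmax t 0 + 1) by (unfold Rmax; repeat destruct Rle_dec; lra).
  pose proof (Hb m s j Hj) as B1. pose proof (Hb m t j Hj) as B2.
  assert (Hpp : 0 < (/2)^m) by (apply pow_lt; lra).
  assert (E (Rmax s 0) * (/2)^m <= E (Rmax t 0 + 1) * (/2)^m) by (apply Rmult_le_compat_r; [lra|apply HEm; auto]).
  assert (E (Rmax t 0) * (/2)^m <= E (Rmax t 0 + 1) * (/2)^m) by (apply Rmult_le_compat_r; [lra|apply HEm; lra]).
  change (Rabs (b s j - b t j) < eps).
  apply Rabs_def2 in Hs1'. apply Rabs_le_between in B1, B2. apply Rabs_def1; lra. }
assert (Cfb : forall j, (j < n)%nat -> forall t, continuous (fun s => f (b s) j) t).
{ intros j Hj. apply (cont_of_lipschitz_comp n f K); auto. }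
assert (Eq : forall j t, (j < n)%nat -> 0 <= t -> b t j = b0 j + RInt (fun s => f (b s) j) 0 t).
{ intros j t Hj Ht. apply Rminus_diag_uniq.
  apply half_pow_zero with (E t + t * (K * (INR n * E t))). intros m.
  assert (B1 := Hb (S m) t j Hj). rewrite Rmax_left in B1 by lra.
  assert (B2 : Rabs (RInt (fun s => f (p m s) j - f (b s) j) 0 t) <= (t - 0) * (K * (INR n * (E t * (/2)^m)))).
  { apply abs_RInt_le_const; auto. apply ex_RInt_cont; intros; apply cont_minus; auto.
    intros s Hs. eapply Rle_trans; [apply Hf; auto|]. apply Rmult_le_compat_l; auto.
    rewrite <- Sum_const. apply Sum_le. intros i Hi. pose proof (Hb m s i Hi) as B3. rewrite Rmax_left in B3 by lra.
    eapply Rle_trans; [apply B3|]. apply Rmult_le_compat_r. apply pow_le; lra. apply HEm; lra. }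
  rewrite RInt_minusR in B2 by (apply ex_RInt_cont; auto).
  assert (Ep : p (S m) t j = b0 j + RInt (fun s => f (p m s) j) 0 t) by reflexivity. rewrite Ep in B1.
  set (I1 := RInt (fun s => f (p m s) j) 0 t : R) in *. set (I2 := RInt (fun s => f (b s) j) 0 t : R) in *.
  replace (b t j - (b0 j + I2)) with (- (b0 j + I1 - b t j) + (I1 - I2)) by ring.
  eapply Rle_trans; [apply Rabs_triang|]. rewrite Rabs_Ropp.
  simpl in B1. assert (0 <= E t * (/2)^m) by (apply Rmult_le_pos; auto; apply pow_le; lra).
  replace ((E t + t * (K * (INR n * E t))) * (/2)^m) with (E t * (/2)^m + (t - 0) * (K * (INR n * (E t * (/2)^m)))) by ring. lra. }
exists b. split; [|split]; auto.
- intros j Hj. rewrite Eq by (auto; lra). rewrite (RInt_point 0 (fun s => f (b s) j)). unfold zero; simpl; ring.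
- intros j Hj t Ht. apply is_derive_ext_loc with (fun t => b0 j + RInt (fun s => f (b s) j) 0 t).
  + assert (Lt : locally t (fun s => 0 < s)) by (apply open_gt; auto).
    revert Lt; apply filter_imp. intros s Hs. symmetry; apply Eq; auto; lra.
  + replace (f (b t) j) with (0 + f (b t) j) by ring.
    apply (is_derive_plusR (fun _ => b0 j)). apply @is_derive_const.
    apply (is_derive_RInt_cont (fun s => f (b s) j)); auto.
Qed.

(** The 1-Lipschitz retraction of the line onto [a, b]. It serves twice: to extend functions of t
    beyond [0,T], and to truncate the flux. *)
Definition clamp (a b s : R) : R := Rmax a (Rmin b s).
Lemma clamp_in a b s : a <= b -> a <= clamp a b s <= b.
Proof. intros H. unfold clamp, Rmax, Rmin. repeat destruct Rle_dec; lra. Qed.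
Lemma clamp_id a b s : a <= s <= b -> clamp a b s = s.
Proof. intros H. unfold clamp, Rmax, Rmin. repeat destruct Rle_dec; lra. Qed.
Lemma clamp_lip a b s t : Rabs (clamp a b s - clamp a b t) <= Rabs (s - t).
Proof. unfold clamp, Rmax, Rmin, Rabs. repeat destruct Rle_dec; repeat destruct Rcase_abs; lra. Qed.
Lemma clamp_cont a b t : continuous (clamp a b) t.
Proof.
apply filterlim_locally. intros eps. exists eps. intros s Hs.
eapply Rle_lt_trans; [apply clamp_lip|exact Hs].
Qed.

(* Continuity on [0,T] relative to that interval. *)
Definition contT (T : R) (f : R -> R) : Prop := forall x, continuous (fun s => f (clamp 0 T s)) x.

Lemma contT_cont T f : (forall x, continuous f x) -> contT T f.
Proof. intros H x. apply (continuous_comp (clamp 0 T) f); auto. apply clamp_cont. Qed.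

Lemma contT_epsd T f : 0 <= T -> (forall t, 0 <= t <= T -> forall eps, 0 < eps -> exists d, 0 < d /\
  forall s, 0 <= s <= T -> Rabs (s - t) < d -> Rabs (f s - f t) < eps) -> contT T f.
Proof.
intros HT H x. apply filterlim_locally. intros eps.
destruct (H (clamp 0 T x) (clamp_in 0 T x HT) eps (cond_pos eps)) as (d & Hd & Hs).
exists (mkposreal d Hd). intros s Hsx. apply Hs. now apply clamp_in. eapply Rle_lt_trans; [apply clamp_lip|exact Hsx].
Qed.

Lemma contT_within T f : 0 <= T -> (forall t, 0 <= t <= T ->
  filterlim f (within (fun s => 0 <= s <= T) (locally t)) (locally (f t))) -> contT T f.
Proof.
intros HT H. apply contT_epsd; auto. intros t Ht eps He.
pose proof (proj1 (filterlim_locally _ _) (H t Ht) (mkposreal _ He)) as [d Hd].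
exists d. split. apply cond_pos. intros s Hs Hst. apply (Hd s); auto.
Qed.

Lemma contT_bounded T f : 0 <= T -> contT T f -> exists B, 0 <= B /\ forall t, 0 <= t <= T -> Rabs (f t) <= B.
Proof.
intros HT H. destruct (cont_bounded _ 0 T HT H) as (B & HB & Hb). exists B; split; auto.
intros t Ht. specialize (Hb t Ht). now rewrite clamp_id in Hb.
Qed.

Lemma nonincreasing_T T f f' : contT T f -> (forall t, 0 < t < T -> is_derive f t (f' t)) ->
  (forall t, 0 < t < T -> f' t <= 0) -> forall t, 0 <= t <= T -> f t <= f 0.
Proof.
intros Hc Hd Hn t Ht. destruct (Req_dec t 0) as [->|Hne]; [lra|].
(* The intermediate point may be an end point, where no derivative is known; the default 0 there
   keeps the sign needed. *)
destruct (MVT_gen (fun s => f (clamp 0 T s)) 0 t (fun s => if Rlt_dec 0 s then if Rlt_dec s T then f' s else 0 else 0)) as (c & Hcc & E).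
- intros x Hx. rewrite Rmin_left, Rmax_right in Hx by lra.
  destruct (Rlt_dec 0 x); [|lra]. destruct (Rlt_dec x T); [|lra].
  apply is_derive_ext_loc with f; [|apply Hd; lra].
  assert (L : locally x (fun y => 0 < y /\ y < T)) by (apply locally_between; lra).
  revert L; apply filter_imp. intros y Hy. rewrite clamp_id; auto; lra.
- intros; apply continuity_pt_filterlim. apply Hc.
- rewrite !clamp_id in E by lra.
  assert ((if Rlt_dec 0 c then if Rlt_dec c T then f' c else 0 else 0) <= 0).
  { destruct (Rlt_dec 0 c); [|lra]. destruct (Rlt_dec c T); [|lra]. apply Hn; lra. }
  nra.
Qed.

(** S(t) exp(-lam t) - c t is nonincreasing, because its derivative is at most c exp(-lam t) - c. *)
Lemma gronwall T S S' lam c : 0 <= lam -> 0 <= c -> contT T S -> (forall t, 0 < t < T -> is_derive S t (S' t)) ->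
  (forall t, 0 < t < T -> S' t <= lam * S t + c) -> forall t, 0 <= t <= T -> S t <= (S 0 + c * t) * exp (lam * t).
Proof.
intros Hl Hc HS Hd Hb t Ht.
set (g := fun t => S t * exp (- lam * t) - c * t).
assert (G : g t <= g 0).
{ apply (nonincreasing_T T g (fun t => S' t * exp (- lam * t) + S t * (- lam * exp (- lam * t)) - c)); auto.
  - intros x. unfold g. apply cont_minus. apply cont_mult; auto.
    apply (continuous_comp (clamp 0 T) (fun y => exp (- lam * y))). apply clamp_cont. apply ex_derive_cont; auto_derive; auto.
    apply cont_scal. apply clamp_cont.
  - intros s Hs. unfold g. apply (is_derive_minusR (fun t => S t * exp (- lam * t))).
    2: auto_derive; auto; ring.
    apply (is_derive_multR S (fun t => exp (- lam * t)) s (S' s) (- lam * exp (- lam * s))).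
    apply Hd; auto. auto_derive; auto; ring.
  - intros s Hs. specialize (Hb s Hs).
    assert (E1 : exp (- lam * s) <= 1).
    { rewrite <- exp_0. destruct (Req_dec (- lam * s) 0) as [->|]; [lra|]. left; apply exp_increasing. nra. }
    pose proof (exp_pos (- lam * s)). nra. }
unfold g in G. rewrite !Rmult_0_r, exp_0 in G.
assert (Ee : exp (- lam * t) * exp (lam * t) = 1) by (rewrite <- exp_plus; replace (- lam * t + lam * t) with 0 by ring; apply exp_0).
pose proof (exp_pos (lam * t)). replace (S t) with (S t * exp (- lam * t) * exp (lam * t)) by (rewrite Rmult_assoc, Ee; ring).
apply Rmult_le_compat_r; lra.
Qed.

Lemma lipschitz_T T f f' B : 0 <= B -> contT T f -> (forall t, 0 < t < T -> is_derive f t (f' t)) ->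
  (forall t, 0 < t < T -> Rabs (f' t) <= B) -> forall t, 0 <= t <= T -> Rabs (f t - f 0) <= B * t.
Proof.
intros HB Hc Hd Hb t Ht.
assert (A1 : f t - B * t <= f 0 - B * 0).
{ apply (nonincreasing_T T (fun t => f t - B * t) (fun t => f' t - B)); auto.
  - intros x. apply cont_minus; auto. apply cont_scal, clamp_cont.
  - intros s Hs. apply (is_derive_minusR f); auto. auto_derive; auto; ring.
  - intros s Hs. specialize (Hb s Hs). apply Rabs_le_between in Hb. lra. }
assert (A2 : - f t - B * t <= - f 0 - B * 0).
{ apply (nonincreasing_T T (fun t => - f t - B * t) (fun t => - f' t - B)); auto.
  - intros x. apply cont_minus. apply (continuous_opp (fun s => f (clamp 0 T s))); auto. apply cont_scal, clamp_cont.
  - intros s Hs. apply (is_derive_minusR (fun t => - f t)).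
    apply (@is_derive_opp R_AbsRing R_NormedModule f); auto. auto_derive; auto; ring.
  - intros s Hs. specialize (Hb s Hs). apply Rabs_le_between in Hb. lra. }
apply Rabs_le_between. lra.
Qed.

(** * The exact solution *)

Lemma Cp_bounded f : Cp f -> exists B, forall x, Rabs (f x) <= B.
Proof.
intros H. destruct (cont_bounded f 0 1) as (B & _ & Hb); [lra|apply H|]. exists B. intros x.
destruct (frac_ex x) as (z & y & Hy & ->). rewrite Cp_per by pc. apply Hb; lra.
Qed.

(** Compactness of [0,T] by a supremum argument: a bound up to a time s near the supremum m extends
    past m, since within distance d of m the functions differ from [D m] by less than 1. *)
Lemma uniform_bound T (D : R -> R -> R) : 0 <= T -> (forall t, 0 <= t <= T -> exists B, forall x, Rabs (D t x) <= B) ->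
  (forall t, 0 <= t <= T -> exists d, 0 < d /\ forall s, 0 <= s <= T -> Rabs (s - t) < d -> forall x, Rabs (D s x - D t x) < 1) ->
  exists B, forall t, 0 <= t <= T -> forall x, Rabs (D t x) <= B.
Proof.
intros HT Hb Hc.
set (E := fun s => 0 <= s <= T /\ exists B, forall t, 0 <= t <= s -> forall x, Rabs (D t x) <= B).
assert (E0 : E 0). { split; [lra|]. destruct (Hb 0) as [B HB]; [lra|]. exists B. intros t Ht. replace t with 0 by lra. auto. }
destruct (completeness E) as [m [Hm1 Hm2]].
{ exists T. intros s [Hs _]; lra. } { exists 0; auto. }
assert (Hm : 0 <= m <= T). { split. apply Hm1; auto. apply Hm2. intros s [Hs _]; lra. }
destruct (Hc m Hm) as (d & Hd & Hdd). destruct (Hb m Hm) as [Bm HBm].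
assert (Hs : exists s, E s /\ m - d < s).
{ apply NNPP; intros Hn. assert (m <= m - d). { apply Hm2. intros s Hs. apply Rnot_lt_le; intros Hl; apply Hn; eauto. } lra. }
destruct Hs as (s & [Hs [B HB]] & Hsm).
assert (E' : E (Rmin (m + d / 2) T)).
{ split. split. apply Rmin_glb; lra. apply Rmin_r. exists (Rmax B (Bm + 1)). intros t Ht x.
  pose proof (Rmin_l (m + d/2) T). pose proof (Rmin_r (m + d/2) T).
  destruct (Rle_dec t s).
  - eapply Rle_trans; [apply HB; lra|apply Rmax_l].
  - eapply Rle_trans; [|apply Rmax_r].
    assert (Rabs (D t x - D m x) < 1). { apply Hdd; [lra|]. apply Rabs_def1; lra. }
    replace (D t x) with ((D t x - D m x) + D m x) by ring. eapply Rle_trans; [apply Rabs_triang|]. specialize (HBm x). lra. }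
(* If m + d/2 were at most T it would be a member of [E] beyond its supremum, so the minimum is
   T. *)
pose proof (Hm1 _ E') as Hle. unfold Rmin in Hle, E'. destruct (Rle_dec (m + d/2) T); [lra|]. destruct E' as [_ HE]. exact HE.
Qed.

Definition flux (v : R -> R) : R -> R := fun x => v x + / 2 * v x ^ 2.

Lemma flux_reg m B v : per_Cm m B v -> per_Cm m (B + 2 ^ m * (B * B)) (flux v).
Proof.
intros [Hp H]. split. intros x; unfold flux; now rewrite Hp.
pose proof (Cm_bd_plus m _ _ _ _ H (Cm_bd_scal m (/2) _ _ (Cm_bd_mult m _ _ _ _ H H))) as E.
apply (Cm_bd_le m m (B + Rabs (/ 2) * (2 ^ m * (B * B)))); auto.
- rewrite Rabs_right by lra. assert (0 <= 2 ^ m * (B * B)) by (apply Rmult_le_pos; [apply pow_le; lra|nra]). lra.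
- erewrite fun_ext; [exact E|]. intros x; unfold flux; simpl; ring.
Qed.

Lemma RLW_bound k T U0 u : 0 < T -> RLW_solution k T U0 u ->
  exists M, 0 < M /\ forall t, 0 <= t <= T -> per_Cm (k + 2) M (u t) /\ per_Cm (k + 2) M (flux (u t)).
Proof.
intros HT (Hreg & Hcont & _ & _).
assert (H : forall m, (m <= k + 2)%nat -> exists M, 0 < M /\ forall t, 0 <= t <= T -> forall j, (j <= m)%nat -> forall x, Rabs (Derive_n (u t) j x) <= M).
{ assert (H1 : forall j, (j <= k + 2)%nat -> exists B, forall t, 0 <= t <= T -> forall x, Rabs (Derive_n (u t) j x) <= B).
  { intros j Hj. apply (uniform_bound T (fun t => Derive_n (u t) j)); [lra| |].
    - intros t Ht. apply Cp_bounded. apply Hreg; auto.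
    - intros t Ht. apply (Hcont j Hj t Ht 1). lra. }
  induction m; intros Hm.
  - destruct (H1 O Hm) as [B HB]. exists (Rmax B 1). split. eapply Rlt_le_trans; [|apply Rmax_r]; lra.
    intros t Ht j Hj x. replace j with O by lia. eapply Rle_trans; [apply HB; auto|apply Rmax_l].
  - destruct IHm as (M & HM & HMb); [lia|]. destruct (H1 (S m) Hm) as [B HB]. exists (Rmax M B). split.
    eapply Rlt_le_trans; [apply HM|apply Rmax_l]. intros t Ht j Hj x.
    destruct (Nat.eq_dec j (S m)) as [->|]. eapply Rle_trans; [apply HB; auto|apply Rmax_r].
    eapply Rle_trans; [apply HMb; auto; lia|apply Rmax_l]. }
destruct (H (k + 2)%nat (le_n _)) as (M & HM & HMb). exists (M + 2 ^ (k + 2) * (M * M)).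
assert (H0 : 0 <= 2 ^ (k + 2) * (M * M)) by (apply Rmult_le_pos; [apply pow_le; lra|nra]).
split; [lra|]. intros t Ht.
assert (R : per_Cm (k + 2) M (u t)).
{ split. intros x; apply (proj2 (Hreg t Ht O ltac:(lia))).
  intros j Hj x. split; auto. destruct j; simpl; auto. apply (Hreg t Ht j); lia. }
split; [|now apply flux_reg]. split; [apply R|]. apply (Cm_bd_le _ (k + 2) M); auto. lra. apply R.
Qed.

Lemma RLW_regular N k T U0 u : 0 < T -> (1 <= N)%nat -> RLW_solution k T U0 u -> forall t, 0 <= t <= T ->
  PC1 N (u t) (dx (u t)) /\ PC N (u t) /\ PC N (dx (u t)).
Proof.
intros HT HN Hu t Ht. destruct (RLW_bound k T U0 u HT Hu) as (M & _ & Hb).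
assert (Q : PC1 N (u t) (dx (u t))) by (apply (per_Cm_PC1 N (k + 2) M); [lia|now apply Hb]).
split; [|split]; auto. now apply (PC1_PC N _ (dx (u t))). now apply (PC1_PC' N (u t)).
Qed.

Lemma Derive_flux v x : ex_derive v x -> Derive (flux v) x = (1 + v x) * Derive v x.
Proof.
intros H. apply is_derive_unique. unfold flux. auto_derive; auto. change (Derive (fun x => v x) x) with (Derive v x). field.
Qed.

(** The equation identifies the time derivative of u - u_xx as - (flux u)_x, which is continuous in
    t uniformly in x. The mean value theorem in t at each fixed x then makes the difference
    quotients converge uniformly, and this replaces differentiation under the integral. *)
Lemma RLW_w_derive N k T U0 u Psi : 0 < T -> (1 <= N)%nat -> RLW_solution k T U0 u -> PC N Psi ->
  let b := fun t => ip (fun x => u t x - Derive_n (u t) 2 x) Psi in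
  contT T b /\ forall t, 0 < t < T -> is_derive b t (- ip (Derive (flux (u t))) Psi).
Proof.
intros HT HN Hu HPsi b. destruct (RLW_bound k T U0 u HT Hu) as (M & HM & Hbd).
destruct Hu as (Hreg & Hcont & Hpde & _).
assert (Hex : forall t, 0 <= t <= T -> forall x, ex_derive (u t) x).
{ intros t Ht x. apply (proj2 (proj1 (Hbd t Ht)) 1%nat); lia. }
assert (Hcj : forall t j, 0 <= t <= T -> (j <= k + 2)%nat -> PC N (Derive_n (u t) j)).
{ intros t j Ht Hj. apply PC_cont. apply (proj2 (Hreg t Ht j Hj)). }
assert (Pw : forall t, 0 <= t <= T -> PC N (fun x => u t x - Derive_n (u t) 2 x)).
{ intros t Ht. apply PC_minus. apply (Hcj t O); auto; lia. apply Hcj; auto; lia. }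
assert (HinN : forall i x, (i < N)%nat -> node N i < x < node N (i+1) -> 0 < x < 1).
{ intros i x Hi Hx. pose proof (node_range N i HN ltac:(lia)). pose proof (node_range N (i+1) HN ltac:(lia)). lra. }
pose proof (L2_pos Psi) as HL.
split.
- apply contT_epsd; [lra|]. intros t Ht eps He.
  set (e' := eps / (2 * (L2norm Psi + 1))).
  assert (He' : 0 < e') by (apply Rdiv_lt_0_compat; lra).
  destruct (Hcont 0%nat ltac:(lia) t Ht e' He') as (d1 & Hd1 & H1).
  destruct (Hcont 2%nat ltac:(lia) t Ht e' He') as (d2 & Hd2 & H2).
  exists (Rmin d1 d2). split. now apply Rmin_pos. intros s Hs Hst.
  pose proof (Rmin_l d1 d2). pose proof (Rmin_r d1 d2).
  unfold b. rewrite <- (ip_minus_l N) by pc.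
  eapply Rle_lt_trans; [apply (ip_CS N); auto; now apply PC_minus; auto|].
  apply Rle_lt_trans with (2 * e' * L2norm Psi).
  + apply Rmult_le_compat_r; auto. apply (L2_bound N); auto. apply PC_minus; auto. lra.
    intros i x Hi Hx. pose proof (H1 s Hs ltac:(lra) x) as A1. pose proof (H2 s Hs ltac:(lra) x) as A2. change (Rabs (u s x - u t x) < e') in A1.
    replace (u s x - Derive_n (u s) 2 x - (u t x - Derive_n (u t) 2 x)) with
      ((u s x - u t x) + - (Derive_n (u s) 2 x - Derive_n (u t) 2 x)) by ring.
    eapply Rle_trans; [apply Rabs_triang|]. rewrite Rabs_Ropp. lra.
  + assert (E : 2 * e' * (L2norm Psi + 1) = eps) by (unfold e'; field; lra). nra.
- intros t Ht. apply is_derive_Reals. intros eps He.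
  set (e' := eps / (2 * (L2norm Psi + 1))).
  assert (He' : 0 < e') by (apply Rdiv_lt_0_compat; lra).
  (* The difference of (1 + u) u_x between two nearby times is at most e2 M + (1 + M) e2 = e'. *)
  set (e2 := e' / (1 + 2 * M)). assert (He2 : 0 < e2) by (apply Rdiv_lt_0_compat; lra).
  assert (Ht' : 0 <= t <= T) by lra.
  destruct (Hcont 0%nat ltac:(lia) t Ht' e2 He2) as (d1 & Hd1 & H1).
  destruct (Hcont 1%nat ltac:(lia) t Ht' e2 He2) as (d2 & Hd2 & H2).
  set (d := Rmin (Rmin d1 d2) (Rmin t (T - t))).
  assert (Hd : 0 < d) by (repeat apply Rmin_pos; lra).
  assert (Hdd : d <= d1 /\ d <= d2 /\ d <= t /\ d <= T - t).
  { unfold d, Rmin. repeat destruct Rle_dec; lra. }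
  exists (mkposreal d Hd). intros h Hh Hhd. simpl in Hhd.
  assert (Hth : 0 <= t + h <= T) by (apply Rabs_def2 in Hhd; lra).
  assert (Pr : PC N (Derive (flux (u t)))).
  { apply (PC_ext N (fun x => (1 + u t x) * Derive (u t) x)); auto. intros; symmetry; apply Derive_flux; auto.
    apply PC_mult. apply PC_plus. apply PC_const. apply (Hcj t O); auto; lia. apply (Hcj t 1%nat); auto; lia. }
  set (g := fun x => (u (t+h) x - Derive_n (u (t+h)) 2 x) - (u t x - Derive_n (u t) 2 x) + h * Derive (flux (u t)) x).
  assert (Pg : PC N g) by (apply PC_plus; [apply PC_minus; auto|now apply PC_scal]).
  assert (Eb : (b (t + h) - b t) / h - - ip (Derive (flux (u t))) Psi = / h * ip g Psi).
  { unfold g. rewrite (ip_plus_l N), (ip_minus_l N), (ip_scal_l N); auto. fold (b (t+h)) (b t). field; auto.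
    apply PC_minus; auto. pc. }
  rewrite Eb, Rabs_mult.
  assert (Hg : L2norm g <= e' * Rabs h).
  { apply (L2_bound N); auto. apply Rmult_le_pos; [lra|apply Rabs_pos].
    intros i x Hi Hx. specialize (HinN i x Hi Hx).
    set (W := fun s => u s x - Derive_n (u s) 2 x).
    set (r := fun s => - ((1 + u s x) * Derive (u s) x)).
    assert (DW : forall s, 0 < s < T -> is_derive W s (r s)).
    { intros s Hs. destruct (Hpde s x Hs HinN) as (X1 & X2 & X3).
      replace (r s) with (Derive (fun s => u s x) s - Derive (fun s => Derive_n (u s) 2 x) s) by (unfold r; lra).
      apply (is_derive_minusR (fun s => u s x) (fun s => Derive_n (u s) 2 x)); now apply Derive_correct. }
    assert (HI : forall c, Rmin t (t+h) <= c <= Rmax t (t+h) -> 0 < c < T /\ Rabs (c - t) < d).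
    { intros c Hc. assert (Rabs (c - t) < d).
      { unfold Rmin, Rmax in Hc. apply Rabs_def2 in Hhd. destruct (Rle_dec t (t+h)); apply Rabs_def1; lra. }
      split; auto. apply Rabs_def2 in H. lra. }
    destruct (MVT_gen W t (t + h) r) as (c & Hc & E).
    - intros y Hy. apply DW. apply HI; lra.
    - intros y Hy. apply continuity_pt_filterlim. apply (is_derive_cont W y (r y)). apply DW. now apply HI.
    - destruct (HI c Hc) as [Hc1 Hc2]. assert (Hc1' : 0 <= c <= T) by lra.
      unfold g. rewrite Derive_flux by pc. change (Rabs (W (t+h) - W t + h * ((1 + u t x) * Derive (u t) x)) <= e' * Rabs h).
      rewrite E. replace (r c * (t + h - t) + h * ((1 + u t x) * Derive (u t) x)) with
       (((u t x - u c x) * Derive (u t) x + (1 + u c x) * (Derive (u t) x - Derive (u c) x)) * h) by (unfold r; ring).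
      rewrite Rabs_mult. apply Rmult_le_compat_r; [apply Rabs_pos|].
      pose proof (H1 c Hc1' ltac:(lra) x) as A1. pose proof (H2 c Hc1' ltac:(lra) x) as A2.
      change (Rabs (u c x - u t x) < e2) in A1. change (Rabs (Derive (u c) x - Derive (u t) x) < e2) in A2.
      rewrite Rabs_minus_sym in A1, A2.
      assert (B1 : Rabs (u c x) <= M) by (apply (proj2 (proj1 (Hbd c Hc1')) O); lia).
      assert (B2 : Rabs (Derive (u t) x) <= M) by (apply (proj2 (proj1 (Hbd t Ht')) 1%nat); lia).
      eapply Rle_trans; [apply Rabs_triang|]. rewrite !Rabs_mult.
      assert (B3 : Rabs (1 + u c x) <= 1 + M) by (eapply Rle_trans; [apply Rabs_triang|]; rewrite Rabs_R1; lra).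
      assert (E2 : e' = e2 * (1 + 2 * M)) by (unfold e2; field; lra).
      assert (Rabs (u t x - u c x) * Rabs (Derive (u t) x) <= e2 * M) by (apply Rmult_le_compat; try apply Rabs_pos; lra).
      assert (Rabs (1 + u c x) * Rabs (Derive (u t) x - Derive (u c) x) <= (1 + M) * e2) by (apply Rmult_le_compat; try apply Rabs_pos; lra).
      lra. }
  pose proof (ip_CS N g Psi HN Pg HPsi) as C.
  assert (Hhp : 0 < Rabs h) by now apply Rabs_pos_lt.
  rewrite Rabs_inv.
  apply Rle_lt_trans with (/ Rabs h * ((e' * Rabs h) * L2norm Psi)).
  { apply Rmult_le_compat_l. left; now apply Rinv_0_lt_compat. eapply Rle_trans; [apply C|]. apply Rmult_le_compat_r; auto. }
  replace (/ Rabs h * (e' * Rabs h * L2norm Psi)) with (e' * L2norm Psi) by (field; lra).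
  assert (E : 2 * e' * (L2norm Psi + 1) = eps) by (unfold e'; field; lra). nra.
Qed.

Lemma periodic_1_0 (f : R -> R) : (forall x, f (x + 1) = f x) -> f 1 = f 0.
Proof. intros H. rewrite <- (H 0). f_equal; ring. Qed.

(** [RLW_w_derive] integrated by parts in x, periodicity cancelling the boundary terms. Besides
    members of [Vh], the general [Psi] allows the primitive of a projection defect and the constant
    1. *)
Lemma RLW_weak N k T U0 u Psi psi : 0 < T -> (1 <= k)%nat -> (1 <= N)%nat -> RLW_solution k T U0 u -> PC1 N Psi psi -> Psi 1 = Psi 0 ->
  let b := fun t => ip (u t) Psi + ip (dx (u t)) psi in
  contT T b /\ forall t, 0 < t < T -> is_derive b t (ip (flux (u t)) psi).
Proof.
intros HT Hk HN Hu HP HP1 b. pose proof (PC1_PC _ _ _ HP) as PP.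
destruct (RLW_w_derive N k T U0 u Psi HT HN Hu PP) as [H1 H2].
destruct (RLW_bound k T U0 u HT Hu) as (M & HM & Hbd).
assert (Eb : forall t, 0 <= t <= T -> ip (fun x => u t x - Derive_n (u t) 2 x) Psi = b t).
{ intros t Ht. destruct (Hbd t Ht) as [Hsm _]. replace (k+2)%nat with (S (k+1)) in Hsm by lia.
  assert (Q : PC1 N (Derive (u t)) (Derive (Derive (u t)))) by (apply (per_Cm_PC1 N (k+1) M); [lia|now apply per_Cm_Derive]).
  rewrite (ip_minus_l N); auto. 2: apply PC_cont; intros; apply (per_Cm_cont (S (k+1)) M); auto; lia.
  2:{ apply (PC1_PC' _ _ _ Q). }
  pose proof (ip_by_parts N _ _ _ _ HN Q HP) as E. rewrite HP1 in E.
  rewrite (periodic_1_0 (Derive (u t))) in E. 2:{ apply (proj1 (per_Cm_Derive _ _ _ Hsm)). }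
  unfold b. change (Derive_n (u t) 2) with (Derive (Derive (u t))). unfold dx. change (fun x => Derive (u t) x) with (Derive (u t)). lra. }
split.
- intros x. apply continuous_ext with (2 := H1 x). intros s. apply Eb. apply clamp_in; lra.
- intros t Ht. replace (ip (flux (u t)) psi) with (- ip (Derive (flux (u t))) Psi).
  + apply is_derive_ext_loc with (2 := H2 t Ht).
    assert (L : locally t (fun y => 0 < y /\ y < T)) by (apply locally_between; lra).
    revert L; apply filter_imp. intros y Hy. apply Eb; lra.
  + assert (Ht' : 0 <= t <= T) by lra.
    assert (Q : PC1 N (flux (u t)) (Derive (flux (u t)))) by (apply (per_Cm_PC1 N (k+2) M); [lia|now apply Hbd]).
    pose proof (ip_by_parts N _ _ _ _ HN Q HP) as E. rewrite HP1, (periodic_1_0 (flux (u t)) (proj1 (proj2 (Hbd t Ht')))) in E. lra.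
Qed.

Lemma primitive_PC1 N f : (1 <= N)%nat -> PC N f -> PC1 N (fun x => RInt f 0 x) f.
Proof.
intros HN Hf i Hi. destruct (Hf i Hi) as (g & Cg & E).
exists (fun x => RInt f 0 (node N i) + RInt g (node N i) x), g. split; [|split; [|split]]; auto.
- intros x. replace (g x) with (0 + g x) by ring.
  apply (is_derive_plusR (fun _ => RInt f 0 (node N i))). apply @is_derive_const.
  apply (is_derive_RInt g (fun t => RInt g (node N i) t) (node N i) x); auto.
  apply filter_forall. intros y. apply (@RInt_correct R_CompleteNormedModule). now apply ex_RInt_cont.
- intros x Hx.
  assert (Ex : ex_RInt f (node N i) x) by (apply (ex_RInt_sub f (node N i) (node N (i+1))); try lra; now apply PC_ex_el).
  rewrite <- (RInt_ChaslesR f 0 (node N i) x); auto. 2: apply (PC_Sum_el N f i); auto; lia.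
  f_equal. apply RInt_ext. intros y Hy. rewrite Rmin_left, Rmax_right in Hy by lra. apply E; lra.
Qed.

(** The weak form tested with a constant. Conservation of the mean makes the primitive of u(t) -
    u(0) periodic. *)
Lemma RLW_mass N k T U0 u t : 0 < T -> (1 <= k)%nat -> (1 <= N)%nat -> RLW_solution k T U0 u -> 0 <= t <= T ->
  ip (u t) (fun _ => 1) = ip (u 0) (fun _ => 1).
Proof.
intros HT Hk HN Hu Ht.
assert (Q : PC1 N (fun _ => 1) (fun _ => 0)).
{ intros i Hi. exists (fun _ => 1), (fun _ => 0). split; [|split; [|split]]; auto. intros; apply @is_derive_const. intros; apply continuous_const. }
destruct (RLW_weak N k T U0 u _ _ HT Hk HN Hu Q eq_refl) as [H1 H2].
pose proof (lipschitz_T T _ _ 0 (Rle_refl 0) H1 H2) as L.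
cbv beta in L.
assert (Z : forall f, ip f (fun _ => 0) = 0) by (intros; rewrite ip_sym; apply ip_0_l).
specialize (L ltac:(intros; rewrite Z, Rabs_R0; lra) t Ht). cbv beta in L; rewrite !Z, Rmult_0_l in L.
apply Rabs_le_between in L. lra.
Qed.

(** * Consistency *)

(** The part (I - P) chi_x of the derivative that [Vh] does not see. What is estimated is never its
    norm, only its pairing with smooth functions. *)
Definition dx_defect N k chi : R -> R := fun x => dx chi x - Gh N k chi x.

Lemma dx_defect_PC N k chi : (1 <= N)%nat -> Vh N k chi -> PC N (dx_defect N k chi).
Proof. intros. apply PC_minus. pc. eapply Vh_PC, Gh_V; eauto. Qed.

Lemma dx_defect_orth N k chi th : (1 <= N)%nat -> Vh N k chi -> Vh N k th -> ip th (dx_defect N k chi) = 0.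
Proof.
intros HN Hc Ht. assert (PC N th) by pc. assert (PC N (dx chi)) by pc.
unfold dx_defect. rewrite (ip_minus_r N); auto. 2: eapply Vh_PC, Gh_V; eauto.
rewrite (ip_dx_Gh N k); auto. ring.
Qed.

(** I - P is symmetric: (v, (I - P) chi_x) = (v - P v, chi_x), which superconvergence bounds. *)
Lemma dx_defect_small kappa : let k := (2 * kappa + 1)%nat in exists C, 0 <= C /\ forall N v M chi, (1 <= N)%nat -> per_Cm (k + 2) M v -> Vh N k chi ->
  Rabs (ip v (dx_defect N k chi)) <= C * M * (/ INR N) ^ (k + 1) * L2norm chi.
Proof.
intros k. destruct (proj_super kappa) as (C & HC & H). fold k in H. exists C; split; auto.
intros N v M chi HN Hv Hc. destruct (H N v M HN Hv) as (_ & Hs & _).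
assert (Pv : PC N v) by (apply PC_cont; intros; apply (per_Cm_cont (k+2) M); auto; lia).
pose proof (Proj_V N k v HN Pv) as VP.
pose proof (Gh_V N k chi HN Hc) as VG.
replace (ip v (dx_defect N k chi)) with (ip (fun x => v x - Proj N k v x) (dx chi)); auto.
pose proof (dx_defect_orth N k chi (Proj N k v) HN Hc VP) as E1.
pose proof (proj2 (Proj_spec N k v HN Pv) _ VG) as E2.
unfold dx_defect in *. rewrite (ip_minus_l N) in E2 by pc. rewrite (ip_minus_r N) in E1 by pc.
rewrite (ip_minus_r N), (ip_minus_l N) by pc. lra.
Qed.

(** Zero mean makes the primitive periodic, and since the period has length 1 the primitive obeys
    the bound M of [d]. *)
Lemma primitive_periodic_Cm m M d : (1 <= m)%nat -> RInt d 0 1 = 0 -> per_Cm m M d -> per_Cm (S m) M (fun x => RInt d 0 x).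
Proof.
intros Hm H0 Hd. pose proof (per_Cm_ge0 _ _ _ Hd) as HM. assert (Hc : forall x, continuous d x) by (intros; now apply (per_Cm_cont m M)).
destruct Hd as [Hp Hb]. set (A := fun x => RInt d 0 x).
assert (DA : forall x, is_derive A x (d x)) by (intros; apply is_derive_RInt_cont; auto).
assert (EA : Derive A = d) by (apply fun_ext; intros; apply is_derive_unique; auto).
assert (A0 : A 0 = 0) by apply (RInt_point 0 d).
assert (PA : forall x, A (x + 1) = A x).
{ set (g := fun x => A (x + 1) - A x).
  assert (Dg : forall x, is_derive g x 0).
  { intros x. replace 0 with (d (x + 1) - d x) by (rewrite Hp; ring).
    apply (is_derive_minusR (fun x => A (x + 1)) A); auto.
    replace (d (x+1)) with (scal 1 (d (x + 1))) by (unfold scal; simpl; unfold mult; simpl; ring).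
    apply (@is_derive_comp R_AbsRing R_NormedModule A (fun x => x + 1)); auto. auto_derive; auto. }
  assert (G : forall a b, a <= b -> g b = g a).
  { intros a b Hab. pose proof (Derive_lipschitz g 0 a b) as L. rewrite Rmult_0_l in L.
    assert (Rabs (g b - g a) <= 0). { apply L; auto. intros x; eexists; apply Dg. intros y. rewrite (is_derive_unique _ _ _ (Dg y)), Rabs_R0; lra. }
    apply Rabs_le_between in H. lra. }
  intros x. assert (E : g x = g 0) by (destruct (Rle_dec 0 x); [apply G; lra|symmetry; apply G; lra]).
  unfold g in E. rewrite Rplus_0_l, A0 in E. unfold A at 3 in E. rewrite H0 in E. lra. }
split; auto. apply Cm_bd_S. split; [|split].
- assert (CA : Cp A). { split; auto. intros; eapply is_derive_cont; eauto. }
  intros x. destruct (frac_ex x) as (z & y & Hy & ->). change (Rabs (A (y + IZR z)) <= M). rewrite Cp_per by pc.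
  apply Rle_trans with ((y - 0) * M); [|nra]. apply abs_RInt_le_const. lra. now apply ex_RInt_cont.
  intros t _. apply (Hb O); lia.
- intros x; eexists; apply DA.
- fold A. now rewrite EA.
Qed.

(* [u_x] alone is one derivative short. But u_x(t) - u_x(0) is an antiderivative of u(t) - u(0) plus a time integral of [flux u]; testing the equation against the primitive of the defect exhibits this without differentiating under the integral. *)
Lemma consistency kappa T U0 u : let k := (2 * kappa + 1)%nat in 0 < T -> RLW_solution k T U0 u ->
  exists C, 0 <= C /\ forall N t chi, (1 <= N)%nat -> 0 <= t <= T -> Vh N k chi ->
  Rabs (ip (fun x => dx (u t) x - dx (u 0) x) (dx_defect N k chi)) <= C * (/ INR N) ^ (k + 1) * L2norm chi.
Proof.
intros k HT Hu. destruct (dx_defect_small kappa) as (Cs & HCs & HS). fold k in HS.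
destruct (RLW_bound k T U0 u HT Hu) as (M & HM & Hbd). assert (HM0 : 0 <= M) by lra.
exists (Cs * M * T + Cs * (M + M)). split.
{ apply Rplus_le_le_0_compat; apply Rmult_le_pos; try lra. now apply Rmult_le_pos. }
intros N t chi HN Ht Hc.
set (psi := dx_defect N k chi). assert (Pp : PC N psi) by (now apply dx_defect_PC).
set (Psi := fun x => RInt psi 0 x). assert (Q : PC1 N Psi psi) by now apply primitive_PC1.
assert (PP : PC N Psi) by (eapply PC1_PC; eauto).
assert (P0 : Psi 0 = 0) by apply (RInt_point 0 psi).
(* Constants belong to [Vh], so the defect has mean zero and its primitive is an admissible periodic
   test function. *)
assert (P1 : Psi 1 = 0).
{ rewrite <- (dx_defect_orth N k chi (fun _ => 1) HN Hc (Vh_const N k 1)). rewrite ip_sym. unfold ip, Psi.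
  f_equal. apply fun_ext. intros; unfold psi; ring. }
assert (Hk1 : (1 <= k)%nat) by (unfold k; lia).
destruct (RLW_weak N k T U0 u Psi psi HT Hk1 HN Hu Q ltac:(lra)) as [W1 W2].
set (X := (/ INR N) ^ (k + 1) * L2norm chi).
assert (HX : 0 <= X). { apply Rmult_le_pos; [apply pow_le; left; apply Rinv_0_lt_compat, INR_gt0; auto|apply L2_pos]. }
(* In time this functional has derivative (flux u, psi), a pairing of the defect with a function
   that has k + 2 derivatives, so it varies by at most that bound times t. *)
assert (L : Rabs (ip (u t) Psi + ip (dx (u t)) psi - (ip (u 0) Psi + ip (dx (u 0)) psi)) <= Cs * M * X * t).
{ apply (lipschitz_T T (fun t => ip (u t) Psi + ip (dx (u t)) psi) (fun t => ip (flux (u t)) psi)); auto.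
  - apply Rmult_le_pos; auto. now apply Rmult_le_pos.
  - intros s Hs. replace (Cs * M * X) with (Cs * M * (/ INR N) ^ (k + 1) * L2norm chi) by (unfold X; ring).
    apply HS; auto. apply Hbd; lra. }
assert (H0T : 0 <= 0 <= T) by lra.
set (d := fun x => u t x - u 0 x).
assert (Hds : per_Cm (k + 2) (M + M) d) by (apply per_Cm_minus; now apply Hbd).
assert (Hreg := RLW_regular N k T U0 u HT HN Hu).
assert (Hcu := fun s Hs => proj1 (proj2 (Hreg s Hs))).
assert (Hcdu := fun s Hs => proj2 (proj2 (Hreg s Hs))).
assert (Hmean : RInt d 0 1 = 0).
{ pose proof (RLW_mass N k T U0 u t HT Hk1 HN Hu Ht) as E.
  assert (E2 : ip d (fun _ => 1) = 0) by (unfold d; rewrite (ip_minus_l N); auto; [lra|apply PC_const]).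
  transitivity (ip d (fun _ => 1)); [|exact E2]. apply RInt_ext. intros x _. change (d x = d x * 1). ring. }
assert (BA := primitive_periodic_Cm (k + 1) (M + M) d ltac:(lia) Hmean (per_Cm_le (k + 1) (k + 2) _ _ ltac:(lia) Hds)).
replace (S (k+1)) with (k+2)%nat in BA by lia. set (A := fun x => RInt d 0 x) in *.
assert (QA : PC1 N A d) by (apply primitive_PC1; auto; apply PC_minus; auto).
(* (d, Psi) = - (A, psi) with A a primitive of d: again the defect is paired with a function having
   k + 2 derivatives. *)
pose proof (ip_by_parts N _ _ _ _ HN QA Q) as EA. rewrite P0, P1 in EA.
assert (L2 : Rabs (ip A psi) <= Cs * (M + M) * X).
{ replace (Cs * (M + M) * X) with (Cs * (M + M) * (/ INR N) ^ (k + 1) * L2norm chi) by (unfold X; ring).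
  now apply HS. }
rewrite (ip_minus_l N) by pc. fold psi.
assert (Ed : ip d Psi = ip (u t) Psi - ip (u 0) Psi) by (apply (ip_minus_l N); auto).
replace ((Cs * M * T + Cs * (M + M)) * (/ INR N) ^ (k + 1) * L2norm chi) with (Cs * M * X * T + Cs * (M + M) * X) by (unfold X; ring).
assert (Cs * M * X * t <= Cs * M * X * T) by (apply Rmult_le_compat_l; [apply Rmult_le_pos; auto; now apply Rmult_le_pos|lra]).
apply Rabs_le_between in L, L2. apply Rabs_le_between. lra.
Qed.

Lemma energy_L2 N k f c : (1 <= N)%nat -> Vh N k f -> 0 <= c -> energy N k f f <= c * c -> L2norm f <= c /\ L2norm (Gh N k f) <= c.
Proof.
intros HN Hf Hc H. assert (P : PC N f) by pc. assert (PG : PC N (Gh N k f)) by pc.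
unfold energy in H. pose proof (ip_pos N f HN P). pose proof (ip_pos N _ HN PG).
split; apply (L2_le_sq N); auto; lra.
Qed.

(* [y] is the Riesz representative, for the energy product, of the weak form of u(t) - u(0). *)
Lemma lift_error kappa T U0 u : let k := (2 * kappa + 1)%nat in 0 < T -> RLW_solution k T U0 u ->
  exists C, 0 <= C /\ forall N t y, (1 <= N)%nat -> 0 <= t <= T -> Vh N k y ->
  (forall chi, Vh N k chi -> energy N k y chi = ip (fun x => u t x - u 0 x) chi + ip (fun x => dx (u t) x - dx (u 0) x) (dx chi)) ->
  let z := fun x => y x - (Proj N k (u t) x - Proj N k (u 0) x) in
  L2norm z <= C * (/ INR N) ^ (k + 1) /\ L2norm (Gh N k z) <= C * (/ INR N) ^ (k + 1).
Proof.
intros k HT Hu. destruct (consistency kappa T U0 u HT Hu) as (C1 & HC1 & H1). fold k in H1.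
destruct (proj_super kappa) as (C2 & HC2 & H2). fold k in H2.
destruct (RLW_bound k T U0 u HT Hu) as (M & HM & Hbd).
exists (C1 + C2 * (M + M)). split; [nra|].
intros N t y HN Ht Hy Hen z.
assert (H0T : 0 <= 0 <= T) by lra.
set (d := fun x => u t x - u 0 x).
assert (Hds : per_Cm (k + 2) (M + M) d) by (apply per_Cm_minus; now apply Hbd).
assert (Hreg := RLW_regular N k T U0 u HT HN Hu).
assert (Hcu := fun s Hs => proj1 (proj2 (Hreg s Hs))).
assert (Hcdu := fun s Hs => proj2 (proj2 (Hreg s Hs))).
assert (Pd : PC N d) by pc.
assert (Edx : dx d = fun x => dx (u t) x - dx (u 0) x).
{ apply fun_ext; intros x. unfold dx, d.
  assert (Hex : forall s, 0 <= s <= T -> ex_derive (u s) x) by (intros s Hs; exact (proj1 (proj2 (proj1 (Hbd s Hs)) 1%nat ltac:(lia) x))).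
  apply Derive_minus; auto. }
assert (Vd := Proj_V N k d HN Pd).
assert (EP : forall x, Proj N k d x = Proj N k (u t) x - Proj N k (u 0) x).
{ apply Proj_unique; auto. apply subsp_minus; try apply Proj_V; auto. apply Vh_subsp.
  intros chi Hc. assert (PC N chi) by pc. unfold d.
  rewrite !(ip_minus_l N), !Proj_ip; auto; now apply Proj_PC; auto. }
assert (Ez : z = fun x => 1 * y x + (-1) * Proj N k d x) by (apply fun_ext; intros; unfold z; rewrite EP; ring).
assert (Vz : Vh N k z) by (rewrite Ez; apply Vh_subsp; auto).
set (H := (/ INR N) ^ (k + 1)). assert (HH : 0 <= H) by (apply pow_le; left; apply Rinv_0_lt_compat, INR_gt0; auto).
destruct (H2 N d (M + M) HN Hds) as (_ & S2 & _).
set (G := Gh N k z). assert (VG : Vh N k G) by (now apply Gh_V).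
assert (Pdd : PC N (dx d)) by (rewrite Edx; apply PC_minus; auto).
(* P d drops out of the L^2 part. In the derivative part, (d_x, z_x) splits into (d_x, defect of z)
   + (d_x, G z), and (d_x - (P d)_x, G z) = - (d - P d, (G z)_x) by parts. The two surviving terms
   are consistency and superconvergence. *)
assert (E : energy N k z z = ip (dx d) (dx_defect N k z) - ip (fun x => d x - Proj N k d x) (dx G)).
{ pose proof (energy_bilin N k HN) as (B1 & _).
  replace (energy N k z z) with (energy N k y z - energy N k (Proj N k d) z).
  2:{ rewrite Ez at 3. rewrite B1; auto. ring. }
  rewrite Hen by pc. fold d. rewrite <- Edx.
  unfold energy. rewrite Proj_ip by pc. fold G.
  rewrite (Gh_ip N k (Proj N k d) G) by pc. unfold dx_defect. fold G. rewrite (ip_minus_r N) by pc.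
  assert (Q1 : PC1 N d (dx d)) by (apply (per_Cm_PC1 N (k+2) (M+M)); auto; lia).
  pose proof (ip_by_parts N _ _ _ _ HN Q1 (Vh_PC1 N k G HN VG)) as E1.
  pose proof (ip_by_parts N _ _ _ _ HN (Vh_PC1 N k _ HN Vd) (Vh_PC1 N k G HN VG)) as E2.
  rewrite (Vh_per1 N k G), (periodic_1_0 d (proj1 Hds)) in E1 by pc.
  rewrite (Vh_per1 N k G), (Vh_per1 N k (Proj N k d)) in E2 by pc.
  rewrite (ip_minus_l N) by pc. lra. }
pose proof (H1 N t z HN Ht Vz) as A1. rewrite <- Edx in A1. fold H in A1.
specialize (S2 G VG). fold H in S2.
set (K := (C1 + C2 * (M + M)) * H). assert (HK : 0 <= K) by (apply Rmult_le_pos; nra).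
set (s := sqrt (energy N k z z)).
assert (Hen0 : 0 <= energy N k z z) by (apply (proj1 (proj2 (proj2 (energy_bilin N k HN)))); auto).
assert (Es : s * s = energy N k z z) by (apply sqrt_sqrt; auto).
assert (Hs0 : 0 <= s) by apply sqrt_pos.
destruct (energy_L2 N k z s HN Vz Hs0 ltac:(lra)) as [N1 N2]. fold G in N2.
assert (Hs : s <= K).
{ assert (s * s <= K * s).
  { rewrite Es, E. apply Rabs_le_between in A1, S2.
    assert (C1 * H * L2norm z <= C1 * H * s) by (apply Rmult_le_compat_l; auto; now apply Rmult_le_pos).
    assert (C2 * (M + M) * H * L2norm G <= C2 * (M + M) * H * s) by (apply Rmult_le_compat_l; auto; apply Rmult_le_pos; auto; nra).
    unfold K. lra. }
  destruct (Req_dec s 0); [lra|]. apply Rmult_le_reg_r with s; lra. }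
split; lra.
Qed.

(** * The error estimate *)

Definition lincomb (n : nat) (phi : nat -> R -> R) (c : nat -> R) : R -> R := fun x => Sum (fun j => c j * phi j x) n.

Lemma lincomb_Vh N k n phi c : (forall j, Vh N k (phi j)) -> Vh N k (lincomb n phi c).
Proof. intros. apply (subsp_Sum (Vh N k)); auto. apply Vh_subsp. Qed.

Lemma dx_lincomb N k n phi c : (1 <= N)%nat -> (forall j, Vh N k (phi j)) -> dx (lincomb n phi c) = fun x => Sum (fun j => c j * dx (phi j) x) n.
Proof. intros HN H. apply fun_ext; intros x. apply (dx_Sum N k); auto. Qed.

Lemma Gh_lincomb N k n phi c : (1 <= N)%nat -> (forall j, Vh N k (phi j)) -> Gh N k (lincomb n phi c) = fun x => Sum (fun j => c j * Gh N k (phi j) x) n.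
Proof. intros HN H. apply fun_ext; intros x. apply (Gh_Sum N k); auto. Qed.

Lemma ip_Sum_r N (c : nat -> R) (f : nat -> R -> R) h n : (1 <= N)%nat -> (forall j, (j<n)%nat -> PC N (f j)) -> PC N h ->
  ip h (fun x => Sum (fun j => c j * f j x) n) = Sum (fun j => c j * ip h (f j)) n.
Proof. intros HN Hf Hh. rewrite ip_sym, (ip_Sum_l N) by pc. apply Sum_ext; intros; now rewrite ip_sym. Qed.

Lemma energy_lincomb_l N k n phi c chi : (1 <= N)%nat -> (forall j, Vh N k (phi j)) -> Vh N k chi ->
  energy N k (lincomb n phi c) chi = Sum (fun j => c j * energy N k (phi j) chi) n.
Proof. intros. apply (bilin_Sum (Vh N k)); auto. apply Vh_subsp. now apply energy_bilin. Qed.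

Lemma energy_sym N k f g : energy N k f g = energy N k g f.
Proof. unfold energy. now rewrite (ip_sym f), (ip_sym (Gh N k f)). Qed.

Lemma energy_lincomb_coord N k n phi c i : (1 <= N)%nat -> (forall j, Vh N k (phi j)) -> orthonormal (energy N k) n phi -> (i < n)%nat ->
  energy N k (lincomb n phi c) (phi i) = c i.
Proof.
intros HN HV Ho Hi. rewrite energy_lincomb_l by pc.
rewrite (Sum_ext _ (fun j => c j * (if Nat.eq_dec j i then 1 else 0))). now rewrite Sum_delta.
intros; rewrite Ho; auto.
Qed.

Lemma energy_lincomb_sq N k n phi c : (1 <= N)%nat -> (forall j, Vh N k (phi j)) -> orthonormal (energy N k) n phi ->
  energy N k (lincomb n phi c) (lincomb n phi c) = Sum (fun j => c j * c j) n.
Proof.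
intros HN HV Ho. rewrite energy_lincomb_l; auto. 2: now apply lincomb_Vh. apply Sum_ext. intros i Hi. f_equal.
rewrite energy_sym. now apply energy_lincomb_coord.
Qed.

Lemma is_derive_Sum (f : nat -> R -> R) (f' : nat -> R) t n : (forall j, (j < n)%nat -> is_derive (f j) t (f' j)) ->
  is_derive (fun s => Sum (fun j => f j s) n) t (Sum f' n).
Proof.
induction n; intros H; simpl. apply @is_derive_const.
apply (is_derive_plusR (fun s => Sum (fun j => f j s) n)); auto.
Qed.

Lemma cont_Sum (f : nat -> R -> R) t n : (forall j, (j < n)%nat -> continuous (f j) t) -> continuous (fun s => Sum (fun j => f j s) n) t.
Proof. induction n; intros H; simpl. apply continuous_const. apply cont_plus; auto. Qed.

Lemma lip_cont L (f : R -> R) x : 0 <= L -> (forall a b, Rabs (f a - f b) <= L * Rabs (a - b)) -> continuous f x.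
Proof.
intros HL H. apply filterlim_locally. intros eps.
assert (Hd : 0 < eps / (L + 1)) by (apply Rdiv_lt_0_compat; [apply cond_pos|lra]).
exists (mkposreal _ Hd). intros y Hy. change (Rabs (y - x) < eps / (L + 1)) in Hy.
change (Rabs (f y - f x) < eps). eapply Rle_lt_trans; [apply H|].
pose proof (Rabs_pos (y - x)).
apply Rle_lt_trans with ((L + 1) * Rabs (y - x)); [nra|].
replace (pos eps) with ((L + 1) * (eps / (L + 1))) by (field; lra). apply Rmult_lt_compat_l; lra.
Qed.

(** [FM] stands for the truncated flux: globally Lipschitz and equal to the flux along u, so ut
    needs no a priori bound. The error ut - P u is split as eps + z: eps is differentiated in time,
    z is the lifting error, bounded at each time by [lift_error]. *)
Lemma error_estimate kappa T U0 u Lam (FM : R -> R) : let k := (2 * kappa + 1)%nat in 0 < T -> RLW_solution k T U0 u ->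
  0 <= Lam -> (forall a b, Rabs (FM a - FM b) <= Lam * Rabs (a - b)) -> (forall t, 0 <= t <= T -> forall x, FM (u t x) = flux (u t) x) ->
  exists C, 0 <= C /\ forall N n phi (b : R -> nat -> R), (1 <= N)%nat -> (forall j, Vh N k (phi j)) -> orthonormal (energy N k) n phi ->
   (forall f, Vh N k f -> forall x, f x = Sum (fun j => energy N k f (phi j) * phi j x) n) ->
   (forall j, (j < n)%nat -> contT T (fun t => b t j)) ->
   (forall j, (j < n)%nat -> forall t, 0 < t < T -> is_derive (fun t => b t j) t (ip (fun x => FM (lincomb n phi (b t) x)) (Gh N k (phi j)))) ->
   (forall x, lincomb n phi (b 0) x = Proj N k (u 0) x) ->
   forall t, 0 <= t <= T -> let e := fun x => lincomb n phi (b t) x - Proj N k (u t) x in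
    L2norm e <= C * (/ INR N) ^ (k + 1) /\ L2norm (Gh N k e) <= C * (/ INR N) ^ (k + 1).
Proof.
intros k HT Hu HLam HL HF.
destruct (lift_error kappa T U0 u HT Hu) as (C1 & HC1 & H1). fold k in H1.
destruct (proj_super kappa) as (C2 & HC2 & H2). fold k in H2.
destruct (dx_defect_small kappa) as (C3 & HC3 & H3). fold k in H3.
destruct (RLW_bound k T U0 u HT Hu) as (M & HM & Hbd). assert (HM0 : 0 <= M) by lra.
set (Cb := C1 + C2 * M + C3 * M).
assert (HC2M : 0 <= C2 * M) by nra. assert (HC3M : 0 <= C3 * M) by nra.
assert (HCb : 0 <= Cb) by (unfold Cb; lra).
(* 2 Lam comes from the Lipschitz bound, the 1 from 2 c0 r <= r^2 + c0^2; [X] bounds the Gronwall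
   factor up to time T. *)
set (lam := 2 * Lam + 1). set (X := T * exp (lam * T)).
assert (HX : 0 <= X) by (apply Rmult_le_pos; [lra|left; apply exp_pos]).
exists ((Lam + 1) * Cb * (1 + X) + C1). split.
{ apply Rplus_le_le_0_compat; auto. apply Rmult_le_pos; [|lra]. apply Rmult_le_pos; lra. }
intros N n phi b HN HV Ho Hrep Cbj Db Hb0 t Ht e.
set (H := (/ INR N) ^ (k + 1)). assert (HH : 0 <= H) by (apply pow_le; left; apply Rinv_0_lt_compat, INR_gt0; auto).
assert (Hk1 : (1 <= k)%nat) by (unfold k; lia).
assert (H0T : 0 <= 0 <= T) by lra.
assert (Hreg := RLW_regular N k T U0 u HT HN Hu).
assert (Hcu := fun s Hs => proj1 (proj2 (Hreg s Hs))).
assert (Hcdu := fun s Hs => proj2 (proj2 (Hreg s Hs))).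
assert (HdP : forall j, PC N (dx (phi j))) by (intros; pc).
assert (HGP : forall j, PC N (Gh N k (phi j))) by (intros; pc).
set (B := fun j s => ip (u s) (phi j) + ip (dx (u s)) (dx (phi j))).
assert (HB : forall j, contT T (B j) /\ forall s, 0 < s < T -> is_derive (B j) s (ip (flux (u s)) (dx (phi j)))).
{ intros j. apply (RLW_weak N k T U0 u (phi j) (dx (phi j)) HT Hk1 HN Hu). apply (Vh_PC1 N k); auto. apply (Vh_per1 N k); auto. }
(* Coordinates of ut(s) - ut(0) minus those of the lift of u(s) - u(0): zero at s = 0, with a
   derivative that involves only the two fluxes. *)
set (ep := fun s j => b s j - b 0 j - (B j s - B j 0)).
set (ut := fun s => lincomb n phi (b s)).
set (eps := fun s => lincomb n phi (ep s)).
set (y := fun s => lincomb n phi (fun j => B j s - B j 0)).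
set (z := fun s x => y s x - (Proj N k (u s) x - Proj N k (u 0) x)).
assert (Vut : forall s, Vh N k (ut s)) by (intros; now apply lincomb_Vh).
assert (Veps : forall s, Vh N k (eps s)) by (intros; now apply lincomb_Vh).
assert (Vy : forall s, Vh N k (y s)) by (intros; now apply lincomb_Vh).
assert (VPu : forall s, 0 <= s <= T -> Vh N k (Proj N k (u s))) by (intros; apply Proj_V; auto).
assert (Vz : forall s, 0 <= s <= T -> Vh N k (z s)).
{ intros s Hs. apply (subsp_minus _ _ _ (Vh_subsp N k)); auto. apply (subsp_minus _ _ _ (Vh_subsp N k)); auto. }
assert (Hz : forall s, 0 <= s <= T -> L2norm (z s) <= C1 * H /\ L2norm (Gh N k (z s)) <= C1 * H).
{ intros s Hs. apply (H1 N s (y s)); auto. intros chi Hc.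
  unfold y. rewrite energy_lincomb_l by pc.
  assert (Ec := fun_ext chi _ (Hrep chi Hc)).
  assert (Edc : dx chi = fun x => Sum (fun j => energy N k chi (phi j) * dx (phi j) x) n).
  { rewrite <- (dx_lincomb N k n phi (fun j => energy N k chi (phi j)) HN HV). now f_equal. }
  assert (E1 : ip (fun x => u s x - u 0 x) chi = ip (fun x => u s x - u 0 x) (fun x => Sum (fun j => energy N k chi (phi j) * phi j x) n)) by (f_equal; exact Ec).
  rewrite Edc, E1. rewrite !(ip_Sum_r N) by pc. rewrite <- Sum_plus.
  apply Sum_ext. intros j Hj. unfold B. rewrite !(ip_minus_l N) by pc. rewrite (energy_sym N k (phi j)). change (fun x : R => dx (phi j) x) with (dx (phi j)). ring. }
assert (Edec : forall s x, ut s x - Proj N k (u s) x = eps s x + z s x).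
{ intros s x. unfold z. rewrite <- (Hb0 x). unfold ut, eps, y, lincomb.
  assert (E : Sum (fun j => ep s j * phi j x) n = Sum (fun j => b s j * phi j x) n - Sum (fun j => b 0 j * phi j x) n - Sum (fun j => (B j s - B j 0) * phi j x) n).
  { rewrite <- !Sum_minus. apply Sum_ext; intros; unfold ep; ring. }
  rewrite E. ring. }
set (S := fun s => Sum (fun j => ep s j * ep s j) n).
assert (HS0 : forall s, 0 <= S s) by (intros; apply Sum_nonneg; intros; apply Rle_0_sqr).
assert (HSn : forall s, L2norm (eps s) <= sqrt (S s) /\ L2norm (Gh N k (eps s)) <= sqrt (S s)).
{ intros s. apply energy_L2; auto. apply sqrt_pos. rewrite sqrt_sqrt by pc. unfold eps. rewrite energy_lincomb_sq by pc. apply Rle_refl. }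
assert (FMc : forall x, continuous FM x) by (intros; apply (lip_cont Lam); auto).
assert (PFM : forall f, (forall x, continuous f x) -> PC N (fun x => FM (f x))).
{ intros f Hf. apply PC_cont. intros x. apply (continuous_comp f FM); auto. }
set (S' := fun s => 2 * (ip (fun x => FM (ut s x)) (Gh N k (eps s)) - ip (flux (u s)) (dx (eps s)))).
assert (HFlP : forall s, 0 <= s <= T -> PC N (flux (u s))) by (intros; apply PC_cont; intros; apply (per_Cm_cont (k+2) M); [lia|now apply Hbd]).
assert (PFMut : forall s, PC N (fun x => FM (ut s x))) by (intros; apply PFM; intros; eapply Vh_cont; eauto).
assert (Cep : forall j, (j < n)%nat -> contT T (fun s => ep s j)).
{ intros j Hj x. unfold ep. apply cont_minus. apply cont_minus. apply (Cbj j Hj). apply continuous_const.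
  apply cont_minus. apply (proj1 (HB j)). apply continuous_const. }
set (ep' := fun s j => ip (fun x => FM (ut s x)) (Gh N k (phi j)) - ip (flux (u s)) (dx (phi j))).
assert (Dep : forall j, (j < n)%nat -> forall s, 0 < s < T -> is_derive (fun s => ep s j) s (ep' s j)).
{ intros j Hj s Hs. unfold ep, ep'.
  apply (is_derive_minusR (fun s => b s j - b 0 j) (fun s => B j s - B j 0)).
  - replace (ip (fun x => FM (ut s x)) (Gh N k (phi j))) with (ip (fun x => FM (ut s x)) (Gh N k (phi j)) - 0) by ring.
    apply (is_derive_minusR (fun s => b s j)). apply Db; auto. apply @is_derive_const.
  - replace (ip (flux (u s)) (dx (phi j))) with (ip (flux (u s)) (dx (phi j)) - 0) by ring.
    apply (is_derive_minusR (B j)). apply HB; auto. apply @is_derive_const. }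
assert (DS : forall s, 0 < s < T -> is_derive S s (S' s)).
{ intros s Hs. replace (S' s) with (Sum (fun j => ep' s j * ep s j + ep s j * ep' s j) n).
  - apply (is_derive_Sum (fun j s => ep s j * ep s j)). intros j Hj.
    apply (is_derive_multR (fun s => ep s j) (fun s => ep s j)); auto.
  - unfold S', eps. rewrite (Gh_lincomb N k n phi (ep s) HN HV), (dx_lincomb N k n phi (ep s) HN HV).
    rewrite !(ip_Sum_r N); auto. 2: apply HFlP; lra. rewrite <- Sum_minus, <- Sum_scal. apply Sum_ext; intros i Hi. unfold ep'. change (fun x : R => dx (phi i) x) with (dx (phi i)). change (fun x : R => Gh N k (phi i) x) with (Gh N k (phi i)). ring. }
set (c0 := (Lam + 1) * Cb * H). assert (Hc0 : 0 <= c0) by (apply Rmult_le_pos; auto; apply Rmult_le_pos; lra).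
assert (HS' : forall s, 0 < s < T -> S' s <= lam * S s + c0 * c0).
{ intros s Hs. assert (Hs' : 0 <= s <= T) by lra.
  destruct (HSn s) as [N1 N2]. set (r := sqrt (S s)) in *.
  assert (Hrr : r * r = S s) by (apply sqrt_sqrt; auto).
  assert (PG : PC N (Gh N k (eps s))) by pc.
  (* Writing the derivative of eps as G eps plus its defect separates a Lipschitz difference of
     fluxes from a consistency term containing only the smooth flux of u. *)
  assert (E : S' s = 2 * (ip (fun x => FM (ut s x) - flux (u s) x) (Gh N k (eps s)) - ip (flux (u s)) (dx_defect N k (eps s)))).
  { unfold S', dx_defect. rewrite (ip_minus_l N), (ip_minus_r N) by pc. ring. }
  assert (A2 : Rabs (ip (flux (u s)) (dx_defect N k (eps s))) <= Cb * H * r).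
  { eapply Rle_trans; [apply (H3 N (flux (u s)) M); auto|]. now apply Hbd.
    fold H. apply Rmult_le_compat; auto. apply Rmult_le_pos; auto. apply L2_pos. apply Rmult_le_compat_r; auto. unfold Cb; lra. }
  assert (Pm : PC N (fun x => ut s x - u s x)) by (apply PC_minus; auto; eapply Vh_PC; eauto).
  assert (Nm : L2norm (fun x => ut s x - u s x) <= r + Cb * H).
  {
    assert (Pe : PC N (eps s)) by pc. assert (Pz : PC N (z s)) by pc.
    rewrite (L2_ext _ (fun x => (eps s x + z s x) - (u s x - Proj N k (u s) x))) by (intros; rewrite <- Edec; ring).
    eapply Rle_trans; [apply (L2_minus N); pc|].
    pose proof (L2_triang N (eps s) (z s) HN Pe Pz). destruct (Hz s Hs') as [Z1 _].
    destruct (H2 N (u s) M HN (proj1 (Hbd s Hs'))) as (Z2 & _).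
    fold H in Z2. assert (0 <= C3 * M * H) by (apply Rmult_le_pos; auto). unfold Cb. lra. }
  assert (ND : L2norm (fun x => FM (ut s x) - flux (u s) x) <= Lam * (r + Cb * H)).
  { apply Rle_trans with (L2norm (fun x => Lam * (ut s x - u s x))).
    - apply (L2_mono N); auto. apply PC_minus; auto. apply PC_scal; auto.
      intros i x _ _. rewrite <- HF by pc. rewrite Rabs_mult, (Rabs_right Lam) by lra. apply HL.
    - rewrite (L2_scal N), Rabs_right by (auto; lra). now apply Rmult_le_compat_l. }
  assert (A1 : Rabs (ip (fun x => FM (ut s x) - flux (u s) x) (Gh N k (eps s))) <= Lam * (r + Cb * H) * r).
  { eapply Rle_trans; [apply (ip_CS N); pc|]. apply Rmult_le_compat; auto; apply L2_pos. }
  rewrite E. apply Rabs_le_between in A1, A2. unfold lam. rewrite <- Hrr.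
  assert (EQ : 2 * (Lam * (r + Cb * H) * r + Cb * H * r) = 2 * Lam * (r * r) + 2 * c0 * r) by (unfold c0; ring).
  assert (0 <= (r - c0) * (r - c0)) by apply Rle_0_sqr. lra. }
assert (CS : contT T S).
{ intros x. apply (cont_Sum (fun j s => ep (clamp 0 T s) j * ep (clamp 0 T s) j)). intros j Hj. apply cont_mult; apply (Cep j Hj). }
pose proof (gronwall T S S' lam (c0 * c0) ltac:(unfold lam; lra) ltac:(apply Rle_0_sqr) CS DS HS' t Ht) as G.
assert (S0 : S 0 = 0).
{ unfold S. rewrite (Sum_ext _ (fun _ => 0)). rewrite Sum_const; ring. intros; unfold ep; ring. }
rewrite S0, Rplus_0_l in G.
(* X <= (1 + X)^2 puts the bound in the form of a square, ready for the square root. *)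
assert (GX : S t <= (c0 * (1 + X)) * (c0 * (1 + X))).
{ eapply Rle_trans; [apply G|]. apply Rle_trans with (c0 * c0 * X).
  - unfold X. rewrite Rmult_assoc. apply Rmult_le_compat_l. apply Rle_0_sqr. apply Rmult_le_compat; try lra. left; apply exp_pos.
    destruct (Req_dec (lam * t) (lam * T)) as [->|]; [lra|]. left; apply exp_increasing. unfold lam in *. nra.
  - replace (c0 * (1 + X) * (c0 * (1 + X))) with (c0 * c0 * ((1 + X) * (1 + X))) by ring. apply Rmult_le_compat_l. apply Rle_0_sqr. nra. }
assert (Hsq : sqrt (S t) <= c0 * (1 + X)).
{ rewrite <- (sqrt_square (c0 * (1 + X))). now apply sqrt_le_1_alt. apply Rmult_le_pos; lra. }
destruct (HSn t) as [N1 N2]. destruct (Hz t Ht) as [Z1 Z2].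
assert (Ee : e = fun x => 1 * eps t x + 1 * z t x) by (apply fun_ext; intros x; unfold e; fold (ut t); rewrite Edec; ring).
replace (((Lam + 1) * Cb * (1 + X) + C1) * H) with (c0 * (1 + X) + C1 * H) by (unfold c0; ring).
split.
- rewrite Ee, (L2_ext _ (fun x => eps t x + z t x)) by (intros; ring).
  eapply Rle_trans; [apply (L2_triang N); pc|]. lra.
- rewrite Ee. rewrite (fun_ext _ _ (fun x => Gh_lin N k (eps t) (z t) 1 1 x HN (Veps t) (Vz t Ht))).
  rewrite (L2_ext _ (fun x => Gh N k (eps t) x + Gh N k (z t) x)) by (intros; ring).
  eapply Rle_trans; [apply (L2_triang N); auto; eapply Vh_PC, Gh_V; eauto|]. lra.
Qed.

(** * Existence and uniqueness of the semi-discrete solution *)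

Lemma flux_PC N v : PC N v -> PC N (flux v).
Proof.
intros H. apply PC_plus; auto. apply PC_scal. simpl.
apply PC_mult; auto. apply PC_mult; auto. apply PC_const.
Qed.

(** Any semi-discrete solution solves the coordinate system. Continuity and differentiability in t,
    assumed at each x separately, reach the coordinates through the point-value formula [al]. *)
Lemma solution_coords N k T U0 v n phi m (p : nat -> R) al : 0 < T -> (1 <= N)%nat -> (forall j, Vh N k (phi j)) ->
  orthonormal (energy N k) n phi -> (forall f, Vh N k f -> forall x, f x = Sum (fun j => energy N k f (phi j) * phi j x) n) ->
  (forall f, Vh N k f -> forall j, (j < n)%nat -> energy N k f (phi j) = Sum (fun i => al j i * f (p i)) m) ->
  semidiscrete_solution N k T U0 v ->
  forall j, (j < n)%nat -> contT T (fun t => energy N k (v t) (phi j)) /\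
    forall t, 0 < t < T -> is_derive (fun t => energy N k (v t) (phi j)) t (ip (flux (v t)) (Gh N k (phi j))).
Proof.
intros HT HN HV Ho Hrep Hal (Hv1 & Hv2 & Hv3 & Hv4 & _) j Hj. split.
- intros x. apply continuous_ext with (fun s => Sum (fun i => al j i * v (clamp 0 T s) (p i)) m).
  { intros s. symmetry. apply Hal; auto. apply Hv1, clamp_in; lra. }
  apply (cont_Sum (fun i s => al j i * v (clamp 0 T s) (p i))). intros i Hi. apply cont_scal.
  apply (contT_within T (fun s => v s (p i))); [lra|]. intros; apply Hv2; auto.
- intros t Ht.
  assert (Lt : locally t (fun s => 0 < s /\ s < T)) by (apply locally_between; lra).
  set (c' := fun j => Sum (fun i => al j i * Derive (fun s => v s (p i)) t) m).
  assert (Dc : forall j, (j < n)%nat -> is_derive (fun s => energy N k (v s) (phi j)) t (c' j)).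
  { intros i Hi. apply is_derive_ext_loc with (fun s => Sum (fun q => al i q * v s (p q)) m).
    - revert Lt; apply filter_imp. intros s Hs. symmetry. apply Hal; auto. apply Hv1; lra.
    - apply (is_derive_Sum (fun q s => al i q * v s (p q))). intros q _. apply is_derive_scal.
      exact (Derive_correct (fun s => v s (p q)) t (proj1 (Hv3 t (p q) Ht))). }
  set (y := lincomb n phi c'). assert (Vy : Vh N k y) by now apply lincomb_Vh.
  assert (Ev : forall s, 0 <= s <= T -> lincomb n phi (fun j => energy N k (v s) (phi j)) = v s) by (intros s Hs; apply fun_ext; intros; symmetry; apply Hrep; auto).
  assert (DS : forall a : nat -> R, is_derive (fun s => Sum (fun j => energy N k (v s) (phi j) * a j) n) t (Sum (fun j => c' j * a j) n)).
  { intros a. apply (is_derive_Sum (fun j s => energy N k (v s) (phi j) * a j)). intros i Hi.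
    replace (c' i * a i) with (c' i * a i + energy N k (v t) (phi i) * 0) by ring.
    apply (is_derive_multR (fun s => energy N k (v s) (phi i)) (fun _ => a i)); auto. apply @is_derive_const. }
  (* By the basis expansion the time derivative is again a member of [Vh] and commutes with [dx];
     hence P[v_xt] is G y and the scheme becomes energy(y, chi) = (flux v, G chi). *)
  assert (Ey : (fun x => Derive (fun s => v s x) t) = y).
  { apply fun_ext; intros x. apply is_derive_unique.
    apply is_derive_ext_loc with (2 := DS (fun j => phi j x)).
    revert Lt; apply filter_imp. intros s Hs. symmetry; apply Hrep. apply Hv1; lra. }
  assert (Edy : (fun x => Derive (fun s => dx (v s) x) t) = dx y).
  { unfold y. rewrite (dx_lincomb N k n phi c' HN HV). apply fun_ext; intros x. apply is_derive_unique.
    apply is_derive_ext_loc with (2 := DS (fun j => dx (phi j) x)).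
    revert Lt; apply filter_imp. intros s Hs. transitivity (dx (lincomb n phi (fun j => energy N k (v s) (phi j))) x); [now rewrite (dx_lincomb N k n phi _ HN HV)|].
    rewrite (Ev s) by lra. reflexivity. }
  pose proof (Hv4 t Ht (phi j) (HV j)) as E. rewrite Ey, Edy in E.
  change (ip y (phi j) + ip (Gh N k y) (dx (phi j)) = ip (Proj N k (flux (v t))) (dx (phi j))) in E.
  assert (PF : PC N (flux (v t))) by (apply flux_PC; eapply Vh_PC; apply Hv1; lra).
  assert (VG : Vh N k (Gh N k (phi j))) by (now apply Gh_V).
  rewrite !(ip_dx_Gh N k) in E; auto. 2: now apply Proj_V. 2: now apply Gh_V.
  rewrite Proj_ip in E by auto. rewrite <- E. change (ip y (phi j) + ip (Gh N k y) (Gh N k (phi j))) with (energy N k y (phi j)).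
  unfold y. rewrite energy_lincomb_coord; auto.
Qed.

Lemma flux_lip B a b : Rabs a <= B -> Rabs b <= B -> Rabs ((a + / 2 * a ^ 2) - (b + / 2 * b ^ 2)) <= (1 + B) * Rabs (a - b).
Proof.
intros Ha Hb. replace ((a + / 2 * a ^ 2) - (b + / 2 * b ^ 2)) with ((1 + / 2 * (a + b)) * (a - b)) by ring.
rewrite Rabs_mult. apply Rmult_le_compat_r. apply Rabs_pos.
apply Rabs_le_between in Ha, Hb. apply Rabs_le_between. lra.
Qed.

(** Each solution is bounded because its coordinates are continuous on [0,T], so the flux is
    Lipschitz along both; Gronwall in the energy norm makes the difference vanish. *)
Lemma solution_unique N k T U0 v1 v2 : 0 < T -> (1 <= N)%nat ->
  semidiscrete_solution N k T U0 v1 -> semidiscrete_solution N k T U0 v2 ->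
  forall t x, 0 <= t <= T -> v1 t x = v2 t x.
Proof.
intros HT HN H1 H2.
destruct (Vh_basis N k (energy N k) HN (energy_bilin N k HN)) as (n & phi & HV & Ho & Hrep & m & p & al0 & Hal).
set (a := fun (v : R -> R -> R) t j => energy N k (v t) (phi j)).
assert (HC : forall v, semidiscrete_solution N k T U0 v -> forall j, (j < n)%nat -> contT T (fun t => a v t j) /\
   forall t, 0 < t < T -> is_derive (fun t => a v t j) t (ip (flux (v t)) (Gh N k (phi j)))).
{ intros v Hv. now apply (solution_coords N k T U0 v n phi m p al0). }
assert (HVv : forall v, semidiscrete_solution N k T U0 v -> forall t, 0 <= t <= T -> Vh N k (v t)) by (intros v (Hv & _); exact Hv).
assert (HB : forall v, semidiscrete_solution N k T U0 v -> exists B, 0 <= B /\ forall t x, 0 <= t <= T -> 0 <= x <= 1 -> Rabs (v t x) <= B).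
{ intros v Hv.
  assert (Hcb : forall q, (q <= n)%nat -> exists D, 0 <= D /\ forall j, (j < q)%nat -> forall t, 0 <= t <= T -> Rabs (a v t j) <= D).
  { induction q as [|q IHq]; intros Hq. exists 0; split; [lra|intros; lia]. destruct IHq as (D & HD & IH); [lia|].
    destruct (contT_bounded T (fun t => a v t q) ltac:(lra) (proj1 (HC v Hv q Hq))) as (E & HE & HEb).
    exists (D + E); split; [lra|]. intros j Hj t Ht. destruct (Nat.eq_dec j q) as [->|]. specialize (HEb t Ht); simpl in HEb; lra.
    specialize (IH j ltac:(lia) t Ht). lra. }
  destruct (Hcb n (le_n _)) as (D & HD & HDb).
  destruct (Sum_bound phi 0 1 n) as (C & HCn & HCb); [lra|intros; eapply Vh_cont; eauto|].
  exists (C * D). split; [nra|]. intros t x Ht Hx. rewrite (Hrep (v t) (HVv v Hv t Ht)). apply HCb; auto. intros j Hj; exact (HDb j Hj t Ht). }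
destruct (HB v1 H1) as (B1 & HB1 & Hb1). destruct (HB v2 H2) as (B2 & HB2 & Hb2).
set (B := B1 + B2).
set (al := fun t j => a v1 t j - a v2 t j).
set (z := fun t => lincomb n phi (al t)).
assert (Vz : forall t, Vh N k (z t)) by (intros; now apply lincomb_Vh).
assert (Ez : forall t x, 0 <= t <= T -> z t x = v1 t x - v2 t x).
{ intros t x Ht. rewrite (Hrep _ (HVv v1 H1 t Ht) x), (Hrep _ (HVv v2 H2 t Ht) x), <- Sum_minus. apply Sum_ext; intros; unfold al, a. ring. }
set (S := fun t => Sum (fun j => al t j * al t j) n).
assert (ES : forall t, energy N k (z t) (z t) = S t) by (intros; now apply energy_lincomb_sq).
assert (HS0 : forall t, 0 <= S t) by (intros; apply Sum_nonneg; intros; apply Rle_0_sqr).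
set (S' := fun t => 2 * ip (fun x => flux (v1 t) x - flux (v2 t) x) (Gh N k (z t))).
assert (HGP : forall j, PC N (Gh N k (phi j))) by (intros; pc).
assert (DS : forall t, 0 < t < T -> is_derive S t (S' t)).
{ intros t Ht. set (al' := fun j => ip (flux (v1 t)) (Gh N k (phi j)) - ip (flux (v2 t)) (Gh N k (phi j))).
  assert (P1 : PC N (flux (v1 t))) by (apply flux_PC; eapply Vh_PC; apply (HVv v1 H1); lra).
  assert (P2 : PC N (flux (v2 t))) by (apply flux_PC; eapply Vh_PC; apply (HVv v2 H2); lra).
  replace (S' t) with (Sum (fun j => al' j * al t j + al t j * al' j) n).
  - apply (is_derive_Sum (fun j s => al s j * al s j)). intros j Hj.
    assert (Da : is_derive (fun s => al s j) t (al' j)).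
    { apply (is_derive_minusR (fun s => a v1 s j) (fun s => a v2 s j)); apply HC; auto. }
    apply (is_derive_multR (fun s => al s j) (fun s => al s j)); auto.
  - unfold S', z. rewrite (Gh_lincomb N k n phi _ HN HV). rewrite (ip_Sum_r N); auto. 2: pc.
    rewrite <- Sum_scal. apply Sum_ext; intros j Hj. rewrite (ip_minus_l N); auto. unfold al'.
    change (fun x : R => Gh N k (phi j) x) with (Gh N k (phi j)). ring. }
assert (CS : contT T S).
{ intros x. apply (cont_Sum (fun j s => al (clamp 0 T s) j * al (clamp 0 T s) j)). intros j Hj.
  assert (Ca : continuous (fun s => al (clamp 0 T s) j) x) by exact (cont_minus _ _ _ (proj1 (HC v1 H1 j Hj) x) (proj1 (HC v2 H2 j Hj) x)).
  now apply cont_mult. }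
assert (HS' : forall t, 0 < t < T -> S' t <= 2 * (1 + B) * S t + 0).
{ intros t Ht. assert (Ht' : 0 <= t <= T) by lra.
  assert (P1 : PC N (v1 t)) by pc. assert (P2 : PC N (v2 t)) by pc.
  set (r := sqrt (S t)). assert (Hr0 : 0 <= r) by apply sqrt_pos. assert (Hrr : r * r = S t) by (apply sqrt_sqrt; auto).
  destruct (energy_L2 N k (z t) r HN (Vz t) Hr0) as [N1 N2]. rewrite ES; lra.
  assert (PG : PC N (Gh N k (z t))) by pc.
  assert (PF : PC N (fun x => flux (v1 t) x - flux (v2 t) x)) by (apply PC_minus; now apply flux_PC).
  assert (ND : L2norm (fun x => flux (v1 t) x - flux (v2 t) x) <= (1 + B) * r).
  { apply Rle_trans with (L2norm (fun x => (1 + B) * z t x)).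
    - apply (L2_mono N); auto. apply PC_scal. pc.
      intros i x Hi Hx. pose proof (node_range N i HN ltac:(lia)). pose proof (node_range N (i+1) HN ltac:(lia)).
      rewrite Ez by pc. rewrite Rabs_mult, (Rabs_right (1 + B)) by (unfold B; lra). apply flux_lip.
      eapply Rle_trans; [apply Hb1; lra|unfold B; lra]. eapply Rle_trans; [apply Hb2; lra|unfold B; lra].
    - rewrite (L2_scal N), Rabs_right; auto; try (unfold B; lra). apply Rmult_le_compat_l; auto; unfold B; lra. pc. }
  pose proof (ip_CS N _ _ HN PF PG) as C. pose proof (Rle_abs (ip (fun x => flux (v1 t) x - flux (v2 t) x) (Gh N k (z t)))) as C'.
  assert (L2norm (fun x => flux (v1 t) x - flux (v2 t) x) * L2norm (Gh N k (z t)) <= (1 + B) * r * r) by (apply Rmult_le_compat; auto; apply L2_pos).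
  unfold S'. rewrite <- Hrr. lra. }
intros t x Ht.
pose proof (gronwall T S S' (2 * (1 + B)) 0 ltac:(unfold B; lra) (Rle_refl 0) CS DS HS' t Ht) as G.
assert (S0 : S 0 = 0).
{ rewrite <- ES. assert (E : z 0 = fun _ => 0).
  { apply fun_ext; intros y. rewrite Ez by lra. destruct H1 as (_ & _ & _ & _ & E1), H2 as (_ & _ & _ & _ & E2). rewrite E1, E2; ring. }
  rewrite E. apply (bilin_0 (Vh N k)). apply Vh_subsp. now apply energy_bilin. apply Vh_const. }
rewrite S0, Rmult_0_l, Rplus_0_l, Rmult_0_l in G.
assert (E : energy N k (z t) (z t) = 0) by (rewrite ES; specialize (HS0 t); lra).
pose proof (proj2 (proj2 (proj2 (energy_bilin N k HN))) (z t) (Vz t) E x) as E'. rewrite Ez in E' by pc. lra.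
Qed.

Lemma lincomb_L2 N n phi c : (1 <= N)%nat -> (forall j, PC N (phi j)) -> (forall j, (j < n)%nat -> L2norm (phi j) <= 1) ->
  L2norm (lincomb n phi c) <= Sum (fun j => Rabs (c j)) n.
Proof.
intros HN HP H. unfold lincomb. induction n; simpl.
- rewrite L2_const, Rabs_R0; lra.
- eapply Rle_trans; [apply (L2_triang N (fun x => Sum (fun j => c j * phi j x) n)); auto|].
  apply (PC_Sum N (fun j x => c j * phi j x)). intros; pc. pc.
  rewrite (L2_scal N) by pc. specialize (IHn ltac:(auto)). specialize (H n (le_n _)). pose proof (Rabs_pos (c n)). nra.
Qed.

(* Globally Lipschitz, and equal to [flux] below the a priori bound of the exact solution. *)
Definition flux_cut (B v : R) : R := clamp (- B) B v + / 2 * clamp (- B) B v ^ 2.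

Lemma flux_cut_lip B a b : 0 <= B -> Rabs (flux_cut B a - flux_cut B b) <= (1 + B) * Rabs (a - b).
Proof.
intros HB. unfold flux_cut. eapply Rle_trans; [apply (flux_lip B)|].
1,2: apply Rabs_le_between; apply clamp_in; lra.
apply Rmult_le_compat_l; [lra|apply clamp_lip].
Qed.

Lemma flux_cut_id B v x : Rabs (v x) <= B -> flux_cut B (v x) = flux v x.
Proof. intros H. unfold flux_cut, flux. rewrite clamp_id; auto. now apply Rabs_le_between. Qed.

(** The basis functions and their images under G have L^2 norm at most 1, so the coordinate vector
    field inherits the Lipschitz constant 1 + B of the truncated flux in the sum norm. *)
Lemma cut_flow N k B n phi (b0 : nat -> R) : (1 <= N)%nat -> 0 <= B -> (forall j, Vh N k (phi j)) -> orthonormal (energy N k) n phi ->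
  exists b : R -> nat -> R, (forall j, (j < n)%nat -> b 0 j = b0 j) /\
    (forall j, (j < n)%nat -> forall t, continuous (fun s => b s j) t) /\
    (forall j, (j < n)%nat -> forall t, 0 < t -> is_derive (fun s => b s j) t (ip (fun x => flux_cut B (lincomb n phi (b t) x)) (Gh N k (phi j)))).
Proof.
intros HN HB HV Ho.
assert (HP : forall j, PC N (phi j)) by (intros; pc).
assert (Hn1 : forall j, (j < n)%nat -> L2norm (phi j) <= 1 /\ L2norm (Gh N k (phi j)) <= 1).
{ intros j Hj. apply energy_L2; auto. lra. rewrite Ho by pc. destruct (Nat.eq_dec j j); lra. }
assert (Fc : forall x, continuous (flux_cut B) x) by (intros; apply (lip_cont (1 + B)); [lra|intros; now apply flux_cut_lip]).
assert (PF : forall c, PC N (fun x => flux_cut B (lincomb n phi c x))).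
{ intros c. apply PC_cont. intros x. apply (continuous_comp (lincomb n phi c) (flux_cut B)); auto. eapply Vh_cont, lincomb_Vh; eauto. }
apply (picard n (fun b j => ip (fun x => flux_cut B (lincomb n phi b x)) (Gh N k (phi j))) (1 + B)). lra.
intros b b' j Hj.
rewrite <- (ip_minus_l N) by pc.
eapply Rle_trans; [apply (ip_CS N); pc|].
apply Rle_trans with (((1 + B) * Sum (fun i => Rabs (b i - b' i)) n) * 1); [|lra].
apply Rmult_le_compat; try apply L2_pos; [|exact (proj2 (Hn1 j Hj))].
set (df := lincomb n phi (fun i => b i - b' i)).
assert (Pdf : PC N df) by (eapply Vh_PC, lincomb_Vh; eauto).
apply Rle_trans with (L2norm (fun x => (1 + B) * df x)).
- apply (L2_mono N); auto. pc. pc.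
  intros i x _ _. rewrite Rabs_mult, (Rabs_right (1 + B)) by lra.
  replace (df x) with (lincomb n phi b x - lincomb n phi b' x). now apply flux_cut_lip.
  unfold df, lincomb. rewrite <- Sum_minus. apply Sum_ext; intros; ring.
- rewrite (L2_scal N), Rabs_right by (auto; lra). apply Rmult_le_compat_l; [lra|]. apply (lincomb_L2 N); auto. exact (fun j Hj => proj1 (Hn1 j Hj)).
Qed.

(** The bound on [0,1] makes the truncation inactive inside every inner product; expanding chi in
    the basis then recovers the scheme from its coordinates. *)
Lemma flow_solution N k T U0 B n phi b : 0 < T -> (1 <= N)%nat -> (forall j, Vh N k (phi j)) ->
  (forall f, Vh N k f -> forall x, f x = Sum (fun j => energy N k f (phi j) * phi j x) n) ->
  (forall j, (j < n)%nat -> forall t, continuous (fun s => b s j) t) ->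
  (forall j, (j < n)%nat -> forall t, 0 < t -> is_derive (fun s => b s j) t (ip (fun x => flux_cut B (lincomb n phi (b t) x)) (Gh N k (phi j)))) ->
  (forall x, lincomb n phi (b 0) x = Proj N k U0 x) ->
  (forall t x, 0 <= t <= T -> 0 <= x <= 1 -> Rabs (lincomb n phi (b t) x) <= B) ->
  semidiscrete_solution N k T U0 (fun t => lincomb n phi (b t)).
Proof.
intros HT HN HV Hrep Cb Db Hb0 HB.
set (b' := fun t j => ip (fun x => flux_cut B (lincomb n phi (b t) x)) (Gh N k (phi j))).
assert (DS : forall (a : nat -> R) t, 0 < t -> is_derive (fun s => Sum (fun j => b s j * a j) n) t (Sum (fun j => b' t j * a j) n)).
{ intros a t Ht. apply (is_derive_Sum (fun j s => b s j * a j)). intros j Hj.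
  replace (b' t j * a j) with (b' t j * a j + b t j * 0) by ring.
  apply (is_derive_multR (fun s => b s j) (fun _ => a j)). apply Db; auto. apply @is_derive_const. }
assert (Ddx : forall t x, 0 < t -> is_derive (fun s => dx (lincomb n phi (b s)) x) t (dx (lincomb n phi (b' t)) x)).
{ intros t x Ht. rewrite (dx_lincomb N k n phi _ HN HV).
  apply is_derive_ext with (fun s => Sum (fun j => b s j * dx (phi j) x) n); [|now apply DS].
  intros s. now rewrite (dx_lincomb N k n phi _ HN HV). }
split; [|split; [|split; [|split]]]; auto.
- intros; now apply lincomb_Vh.
- intros x t Ht. assert (C : continuous (fun s => lincomb n phi (b s) x) t).
  { apply (cont_Sum (fun j s => b s j * phi j x)). intros j Hj. apply cont_mult. now apply Cb. apply continuous_const. }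
  eapply filterlim_filter_le_1; [|exact C]. apply filter_le_within.
- intros t x Ht. split; eexists; [apply DS|apply Ddx]; lra.
- intros t Ht chi Hc.
  rewrite (fun_ext (fun x => Derive (fun s => lincomb n phi (b s) x) t) (lincomb n phi (b' t))).
  2:{ intros x. apply is_derive_unique. now apply DS. }
  rewrite (fun_ext (fun x => Derive (fun s => dx (lincomb n phi (b s)) x) t) (dx (lincomb n phi (b' t)))).
  2:{ intros x. apply is_derive_unique. now apply Ddx. }
  set (y := lincomb n phi (b' t)). assert (Vy : Vh N k y) by now apply lincomb_Vh.
  change (ip y chi + ip (Gh N k y) (dx chi) = ip (Proj N k (flux (lincomb n phi (b t)))) (dx chi)).
  assert (PF : PC N (flux (lincomb n phi (b t)))) by (apply flux_PC; eapply Vh_PC, lincomb_Vh; eauto).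
  rewrite (ip_dx_Gh N k), (ip_dx_Gh N k (Proj _ _ _)); auto; [|now apply Proj_V|now apply Gh_V].
  rewrite Proj_ip by pc.
  change (ip y chi + ip (Gh N k y) (Gh N k chi)) with (energy N k y chi). unfold y. rewrite energy_lincomb_l by pc.
  assert (Ec : chi = lincomb n phi (fun j => energy N k chi (phi j))) by (apply fun_ext; intros; now apply Hrep).
  rewrite (f_equal (Gh N k) Ec), (Gh_lincomb N k n phi _ HN HV), (ip_Sum_r N) by pc.
  apply Sum_ext. intros j Hj. rewrite (energy_sym N k (phi j)). rewrite Rmult_comm. f_equal.
  unfold b'. apply ip_ext; auto. intros x Hx. apply flux_cut_id. apply HB; lra.
Qed.

Theorem theorem3p3 (kappa : nat) (T : R) (U0 : R -> R) (u : R -> R -> R) :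
  0 < T ->
  RLW_solution (2 * kappa + 1) T U0 u ->
  exists (N0 : nat) (C : R), 0 < C /\
    forall N : nat, (N0 <= N)%nat -> (1 <= N)%nat ->
      exists ut : R -> R -> R,
        semidiscrete_solution N (2 * kappa + 1) T U0 ut /\
        (forall v, semidiscrete_solution N (2 * kappa + 1) T U0 v ->
           forall t x, 0 <= t <= T -> v t x = ut t x) /\
        (forall t, 0 <= t <= T ->
           L2norm (fun x => u t x - ut t x)
             <= C * (/ INR N) ^ (2 * kappa + 1 + 1) /\
           L2norm (fun x => dx (u t) x - Proj N (2 * kappa + 1) (dx (ut t)) x)
             <= C * (/ INR N) ^ (2 * kappa + 1 + 1) /\
           L2norm (fun x => dx (u t) x - dx (ut t) x)
             <= C * (/ INR N) ^ (2 * kappa + 1)).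
Proof.
intros HT Hu. set (k := (2 * kappa + 1)%nat) in *.
destruct (RLW_bound k T U0 u HT Hu) as (M & HM & Hbd).
(* The cut lies one unit above the bound M of u: it is inactive along u, and along ut as soon as the
   pointwise error is at most 1. *)
assert (HB : 0 <= M + 1) by lra.
destruct (error_estimate kappa T U0 u (1 + (M + 1)) (flux_cut (M + 1)) HT Hu ltac:(lra)) as (Ce & HCe & HE).
{ intros; now apply flux_cut_lip. }
{ intros t Ht x. apply flux_cut_id. pose proof (proj2 (proj2 (proj1 (Hbd t Ht)) O ltac:(lia) x)) as E. simpl in E. lra. }
fold k in HE.
destruct (proj_super kappa) as (C2 & HC2 & H2). fold k in H2.
destruct (inverse_ineq k) as (Ci & HCi & HI).
(* D h will bound ut - u pointwise on [0,1]: Ci Ce from the inverse inequality for ut - P u, and C2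
   M from u - P u. Taking N0 above D makes it at most 1. *)
set (D := Ci * Ce + C2 * M). assert (HC2M : 0 <= C2 * M) by nra. assert (HCiCe : 0 <= Ci * Ce) by nra.
destruct (INR_unbounded D) as [N0 HN0].
(* The three errors are bounded by Ce + C2 M, by Ce + C2 M + 2 M and by C2 M + Ci Ce, times their
   powers of h; the final 1 makes the constant positive. *)
exists N0, (Ce + 2 * (C2 * M) + 2 * M + Ci * Ce + 1). split; [lra|].
intros N HNN HN.
set (h := / INR N).
destruct (mesh_size N HN) as (Hh & Hh1 & HNh). fold h in Hh, Hh1, HNh.
assert (Hk1 : (1 <= k)%nat) by (unfold k; lia).
assert (Hhk1 : h ^ (k + 1) = h * h ^ k) by (replace (k+1)%nat with (S k) by lia; reflexivity).
assert (Hhkh : h ^ k <= h).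
{ replace k with (S (2 * kappa)) by (unfold k; lia). simpl pow.
  assert (h ^ (2 * kappa) <= 1) by (rewrite <- (pow1 (2 * kappa)); apply pow_incr; lra).
  change (h * h ^ (2 * kappa) <= h). nra. }
assert (HDh : D * h <= 1).
{ apply Rle_trans with (INR N * h); [|lra]. apply Rmult_le_compat_r; [lra|]. pose proof (le_INR _ _ HNN). lra. }
destruct (Vh_basis N k (energy N k) HN (energy_bilin N k HN)) as (n & phi & HV & Ho & Hrep & _).
assert (H0T : 0 <= 0 <= T) by lra.
assert (Hreg := RLW_regular N k T U0 u HT HN Hu).
assert (Hcu := fun s Hs => proj1 (proj2 (Hreg s Hs))).
assert (VPu : forall s, 0 <= s <= T -> Vh N k (Proj N k (u s))) by (intros; apply Proj_V; auto).
destruct (cut_flow N k (M + 1) n phi (fun j => energy N k (Proj N k (u 0)) (phi j)) HN HB HV Ho) as (b & Hb0 & Cb & Db).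
set (ut := fun t => lincomb n phi (b t)).
assert (Vut : forall t, Vh N k (ut t)) by (intros; now apply lincomb_Vh).
assert (Hut0 : forall x, ut 0 x = Proj N k (u 0) x).
{ intros x. rewrite (Hrep _ (VPu 0 H0T) x). apply Sum_ext. intros; rewrite Hb0; auto. }
assert (Herr : forall t, 0 <= t <= T -> let e := fun x => ut t x - Proj N k (u t) x in L2norm e <= Ce * h ^ (k + 1) /\ L2norm (Gh N k e) <= Ce * h ^ (k + 1)).
{ intros t Ht. apply (HE N n phi b); auto.
  intros j Hj. apply contT_cont. now apply Cb. intros j Hj s Hs. apply Db; auto; lra. }
assert (Hproj := fun t Ht => H2 N (u t) M HN (proj1 (Hbd t Ht))).
fold h in Hproj.
assert (Ve : forall t, 0 <= t <= T -> Vh N k (fun x => ut t x - Proj N k (u t) x)).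
{ intros t Ht. apply (subsp_minus _ _ _ (Vh_subsp N k)); auto. }
assert (Hbnd : forall t x, 0 <= t <= T -> 0 <= x <= 1 -> Rabs (ut t x) <= M + 1).
{ intros t x Ht Hx. destruct (HI N _ HN (Ve t Ht)) as [_ I]. specialize (I x Hx). destruct (Herr t Ht) as [E1 _].
  destruct (Hproj t Ht) as (_ & _ & _ & P4). specialize (P4 x Hx).
  pose proof (proj2 (proj2 (proj1 (Hbd t Ht)) O ltac:(lia) x)) as Eu. simpl in Eu.
  assert (I2 : Rabs (ut t x - Proj N k (u t) x) <= Ci * Ce * h).
  { eapply Rle_trans; [apply I|]. apply Rle_trans with (Ci * INR N * (Ce * h ^ (k + 1))).
    apply Rmult_le_compat_l; auto. nra.
    rewrite Hhk1. replace (Ci * INR N * (Ce * (h * h ^ k))) with (Ci * Ce * h ^ k * (INR N * h)) by ring. rewrite HNh. nra. }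
  assert (P5 : C2 * M * h ^ (k + 1) <= C2 * M * h) by (apply Rmult_le_compat_l; auto; rewrite Hhk1; nra).
  replace (ut t x) with ((ut t x - Proj N k (u t) x) + (- (u t x - Proj N k (u t) x) + u t x)) by ring.
  eapply Rle_trans; [apply Rabs_triang|]. eapply Rle_trans; [apply Rplus_le_compat_l, Rabs_triang|]. rewrite Rabs_Ropp.
  unfold D in HDh. lra. }
assert (EU0 : U0 = u 0). { apply fun_ext; intros x. destruct Hu as (_ & _ & _ & E). now rewrite E. }
assert (Hsol : semidiscrete_solution N k T U0 ut).
{ apply (flow_solution N k T U0 (M + 1) n phi b); auto. rewrite EU0. exact Hut0. }
exists ut. split; [|split]; auto.
{ intros v Hv t x Ht. now apply (solution_unique N k T U0). }
intros t Ht. destruct (Herr t Ht) as [E1 E2]. destruct (Hproj t Ht) as (P1 & P2 & P3 & _).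
specialize (Ve t Ht). set (e := fun x => ut t x - Proj N k (u t) x) in *.
set (P := Proj N k (u t)) in *. assert (VP : Vh N k P) by (apply VPu; auto).
assert (PP : PC N P) by pc. assert (Pe : PC N e) by pc.
assert (Pu : PC N (u t)) by pc.
assert (PdP : PC N (dx P)) by pc. assert (Pde : PC N (dx e)) by pc.
destruct (Hreg t Ht) as (Q & _ & Pdu).
set (H := h ^ (k + 1)) in *. assert (HH : 0 < H) by now apply pow_lt.
assert (Eut : ut t = fun x => 1 * e x + 1 * P x) by (apply fun_ext; intros; unfold e; ring).
replace (2 * kappa + 1 + 1)%nat with (k + 1)%nat by (unfold k; lia). fold H.
split; [|split].
- rewrite (L2_ext _ (fun x => (u t x - P x) - e x)) by (intros; unfold e; ring).
  eapply Rle_trans; [apply (L2_minus N); pc|]. nra.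
- change (Proj N k (dx (ut t))) with (Gh N k (ut t)).
  rewrite Eut, (fun_ext _ _ (fun x => Gh_lin N k e P 1 1 x HN Ve VP)).
  (* u_x - P[ut_x] = (u_x - P u_x) + th - G e, where [th] measures how far projection and
     differentiation are from commuting on u. *)
  set (th := fun x => Proj N k (dx (u t)) x - Gh N k P x).
  assert (VPd : Vh N k (Proj N k (dx (u t)))) by (now apply Proj_V).
  assert (VGP : Vh N k (Gh N k P)) by (now apply Gh_V). assert (VGe : Vh N k (Gh N k e)) by (now apply Gh_V).
  assert (PPd := Vh_PC _ _ _ VPd). assert (PGP := Vh_PC _ _ _ VGP). assert (PGe := Vh_PC _ _ _ VGe).
  assert (Vth : Vh N k th) by (apply (subsp_minus _ _ _ (Vh_subsp N k)); auto).
  assert (Pth := Vh_PC _ _ _ Vth).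
  assert (Nth : L2norm th <= C2 * M * H).
  { assert (E : L2norm th * L2norm th = - ip (fun x => u t x - P x) (dx th)).
    { rewrite (L2_sq N) by pc. unfold th at 1. rewrite (ip_minus_l N), Proj_ip, Gh_ip by pc.
      pose proof (ip_by_parts N _ _ _ _ HN Q (Vh_PC1 N k th HN Vth)) as B1.
      pose proof (ip_by_parts N _ _ _ _ HN (Vh_PC1 N k P HN VP) (Vh_PC1 N k th HN Vth)) as B2.
      rewrite (Vh_per1 N k th), (periodic_1_0 (u t) (proj1 (proj1 (Hbd t Ht)))) in B1 by auto.
      rewrite (Vh_per1 N k th), (Vh_per1 N k P) in B2 by pc.
      rewrite (ip_minus_l N); auto. lra. pc. }
    specialize (P2 th Vth). apply Rabs_le_between in P2. pose proof (L2_pos th).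
    destruct (Req_dec (L2norm th) 0); [nra|]. apply Rmult_le_reg_r with (L2norm th); lra. }
  assert (N3 : L2norm (fun x => dx (u t) x - Proj N k (dx (u t)) x) <= 2 * M * H).
  { replace H with (h ^ S k) by (unfold H; f_equal; lia). apply proj_plain; auto.
apply per_Cm_Derive. replace (S (S k)) with (k + 2)%nat by lia. now apply Hbd. }
  rewrite (L2_ext _ (fun x => ((dx (u t) x - Proj N k (dx (u t)) x) + th x) - Gh N k e x)) by (intros; unfold th; ring).
  eapply Rle_trans; [apply (L2_minus N); auto; apply PC_plus; pc|].
  pose proof (L2_triang N (fun x => dx (u t) x - Proj N k (dx (u t)) x) th HN ltac:(pc) Pth). nra.
- rewrite (L2_ext _ (fun x => (dx (u t) x - dx P x) - dx e x)).
  2:{ intros x _. rewrite Eut, (dx_lin N k e P 1 1 x HN Ve VP). ring. }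
  eapply Rle_trans; [apply (L2_minus N); pc|].
  destruct (HI N e HN Ve) as [I _].
  assert (Ci * INR N * L2norm e <= Ci * Ce * h ^ k).
  { apply Rle_trans with (Ci * INR N * (Ce * H)). apply Rmult_le_compat_l; auto; nra.
    rewrite Hhk1. replace (Ci * INR N * (Ce * (h * h ^ k))) with (Ci * Ce * h ^ k * (INR N * h)) by ring. rewrite HNh. lra. }
  nra.
Qed.
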